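(* Let $p>1$, $V\in\mathcal V^p$, let the generator $g$ satisfy the one-sided Osgood condition in $y$ and the linear growth condition in $z$ (with exponent $p$), with $g(\cdot,0,0)\in\mathcal H^p$, and let $\xi\in\mathbb L^p(\mathcal F_T)$ and $L\in\mathcal S$ with $L_T\le\xi$. If the reflected BSDE $(\xi,g+dV,L)$ admits a solution $(Y,Z,K)\in\mathcal S^p\times\mathrm M^p\times\mathcal V^{+,p}$, then $g(\cdot,Y_\cdot,0)\in\mathcal H^p$. Consequently, there exists a semimartingale $X\in\mathcal M^p+\mathcal V^p$ such that $g(\cdot,X_\cdot,0)\in\mathcal H^p$ and $X_t\ge L_t$ for each $t\in[0,T]$.
   Context: Setting: $T>0$ and an integer $d\ge1$ are fixed. $(\Omega,\mathcal F,\mathbb P)$ is a complete probability space carrying a standard $d$-dimensional Brownian motion $B$, $(\mathcal F_t)$ is the completed filtration generated by $B$, and $\mathcal F=\mathcal F_T$. (In)equalities between random elements hold $\mathbb P$-a.s. A generator is a random function $g:\Omega\times[0,T]\times\mathbb R\times\mathbb R^d\to\mathbb R$ such that $g(\cdot,y,z)$ is $(\mathcal F_t)$-progressively measurable for each $(y,z)$; processes obtained by substituting progressively measurable processes for $(y,z)$ in $g$ are understood to be progressively measurable. $\mathbb R_+=[0,\infty)$; $\operatorname{sgn}$ is the sign function. Spaces: $\mathbb L^p(\mathcal F_T)$: $\mathcal F_T$-measurable $\xi$ with $\mathbb E|\xi|^p<\infty$. $\mathcal S$: continuous progressively measurable processes; $\mathcal S^p$: $Y\in\mathcal S$ with $\mathbb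 E[\sup_{t\in[0,T]}|Y_t|^p]<\infty$. $\mathrm M^p$: progressively measurable $\mathbb R^d$-valued $Z$ with $\mathbb E[(\int_0^T|Z_t|^2dt)^{p/2}]<\infty$. $\mathcal H^p$: progressively measurable $X$ with $\mathbb E[(\int_0^T|X_t|dt)^p]<\infty$. $\mathcal M^p$: continuous $(\mathcal F_t)$-martingales $M$ with $\mathbb E[\langle M\rangle_T^{p/2}]<\infty$. $\mathcal V^p$: continuous progressively measurable finite variation processes $V$ whose total variation $|V|_T$ on $[0,T]$ satisfies $\mathbb E[|V|_T^p]<\infty$; $\mathcal V^{+,p}$: the increasing processes in $\mathcal V^p$. A solution of the reflected BSDE $(\xi,g+dV,L)$ is a triple $(Y,Z,K)$ of progressively measurable processes with $t\mapsto|g(t,Y_t,Z_t)|\in L^1(0,T)$, $t\mapsto|Z_t|\in L^2(0,T)$ a.s., and $$Y_t=\xi+\int_t^Tg(s,Y_s,Z_s)ds+\int_t^TdV_s+\int_t^TdK_s-\int_t^TZ_sdB_s,\quad Y_t\ge L_t,\quad t\in[0,T],$$ where $K$ is nondecreasing, continuous, $K_0=0$ and $\int_0^T(Y_t-L_t)dK_t=0$. Conditions on $g$: - One-sided Osgood condition in $y$: there is a nondecreasing concave $\rho:\mathbb R_+\to\mathbb R_+$ with $\rho(0)=0$, $\rho(u)>0$ for $u>0$, $\int_{0^+}\frac{du}{\rho(u)}=+\infty$, such that $d\mathbb P\times dt$-a.e., for all $y_1,y_2\in\mathbb R$, $z\in\mathbb R^d$: $(g(t,y_1,z)-g(t,y_2,z))\operatorname{sgn}(y_1-y_2)\le\rho(|y_1-y_2|)$.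 - Linear growth in $z$: there are constants $\mu,\lambda\ge0$ and a nonnegative $f\in\mathcal H^p$ such that $d\mathbb P\times dt$-a.e., for all $(y,z)$: $|g(\omega,t,y,z)-g(\omega,t,y,0)|\le f_t(\omega)+\mu|y|+\lambda|z|$. *)

(* Defs.v *)
From HB Require Import structures.
From mathcomp Require Import all_boot all_order all_algebra.
From mathcomp Require Import all_classical all_reals all_analysis.
Import Order.TTheory GRing.Theory Num.Theory.
Import numFieldNormedType.Exports.

Set Implicit Arguments.
Unset Strict Implicit.
Unset Printing Implicit Defensive.

Local Open Scope classical_set_scope.
Local Open Scope ring_scope.

(* Processes have type [R -> Omega -> _], time first; only their values at
   times in [0, T] matter.  Path properties hold P-almost surely. *)

(* The norm [`|z|] of the library on ['rV[R]_d] is the sup norm. *)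
Definition enorm (R : realType) (d : nat) (z : 'rV[R]_d) : R :=
  Num.sqrt (\sum_i z 0 i ^+ 2).

Section BrownianFiltration.
Context (R : realType) (dO : measure_display) (Omega : measurableType dO)
  (P : probability Omega R) (T : R) (d : nat) (B : R -> Omega -> 'rV[R]_d).

Definition history_generators (t : R) : set (set Omega) :=
  \bigcup_(s in `[0, t]) \bigcup_(i in [set: 'I_d])
    preimage_set_system setT (fun w => B s w 0 i) measurable.

Definition brownian_filtration (t : R) : set (set Omega) :=
  <<s history_generators t `|` P.-negligible >>.

Definition independent_systems (G H : set (set Omega)) :=
  forall A C, G A -> H C -> P (A `&` C) = (P A * P C)%E.

Definition is_brownian_motion :=
  [/\ (forall t i, 0 <= t <= T -> measurable_fun setT (fun w => B t w 0 i)),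
      {ae P, forall w, B 0 w = 0},
      {ae P, forall w, forall i, {within `[0, T], continuous (fun t => B t w 0 i)}},
      (forall s t, 0 <= s -> s < t -> t <= T ->
        independent_systems <<s history_generators s >>
          (g_sigma_preimage (fun i w => B t w 0 i - B s w 0 i))) &
      (forall s t, 0 <= s -> s < t -> t <= T ->
        forall U : 'I_d -> set R, (forall i, measurable (U i)) ->
        P [set w | forall i, U i (B t w 0 i - B s w 0 i)] =
        \big[*%E/1%E]_(i < d) normal_prob 0 (Num.sqrt (t - s)) (U i))].

End BrownianFiltration.

Section Processes.
Context (R : realType) (dO : measure_display) (Omega : measurableType dO)
  (P : probability Omega R) (T : R) (F : R -> set (set Omega)).
Implicit Types (X Y M A V K L : R -> Omega -> R) (p : R).

Local Notation leb := (@lebesgue_measure R).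

Definition measurable_wrt (G : set (set Omega)) (X : Omega -> R) :=
  measurable_fun [set: g_sigma_algebraType G] (X : g_sigma_algebraType G -> R).

Definition progressive X :=
  forall t, 0 <= t <= T ->
  measurable_fun (`[0, t]%classic `*` [set: g_sigma_algebraType (F t)])
    (fun u : R * g_sigma_algebraType (F t) => X u.1 u.2).

Definition progressive_vec (d : nat) (Z : R -> Omega -> 'rV[R]_d) :=
  forall i, progressive (fun t w => Z t w 0 i).

Definition as_continuous X :=
  {ae P, forall w, {within `[0, T], continuous (X ^~ w)}}.

Definition as_nondecreasing X :=
  {ae P, forall w, {in `[0, T] &, {homo X ^~ w : s t / s <= t}}}.

(* The space L^p of F_T-measurable variables. *)
Definition in_Lp p (xi : Omega -> R) :=
  measurable_wrt (F T) xi /\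
  (\int[P]_w (`|xi w| `^ p)%:E < +oo)%E.

Definition in_S X := progressive X /\ as_continuous X.

Definition in_Sp p Y :=
  in_S Y /\
  (\int[P]_w ereal_sup [set (`|Y t w| `^ p)%:E | t in `[0%R, T]] < +oo)%E.

(* The space M^p of integrands (roman M). *)
Definition in_Mp p (d : nat) (Z : R -> Omega -> 'rV[R]_d) :=
  progressive_vec Z /\
  (\int[P]_w ((\int[leb]_(t in `[0%R, T]) (enorm (Z t w) ^+ 2)%:E)
                `^ (p / 2)%R) < +oo)%E.

Definition in_Hp p X :=
  progressive X /\
  (\int[P]_w ((\int[leb]_(t in `[0%R, T]) `|X t w|%:E) `^ p) < +oo)%E.

Definition in_Vp p V :=
  [/\ progressive V, as_continuous V,
      {ae P, forall w, bounded_variation 0 T (V ^~ w)} &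
      (\int[P]_w (total_variation 0 T (V ^~ w) `^ p) < +oo)%E].

Definition in_Vplusp p V := in_Vp p V /\ as_nondecreasing V.

Definition is_condexp (G : set (set Omega)) (X Y : Omega -> R) :=
  [/\ measurable_wrt G Y, P.-integrable setT (EFin \o Y) &
      forall C, G C -> (\int[P]_(w in C) (Y w)%:E = \int[P]_(w in C) (X w)%:E)%E].

Definition martingale M :=
  [/\ (forall t, 0 <= t <= T -> measurable_wrt (F t) (M t)),
      (forall t, 0 <= t <= T -> P.-integrable setT (EFin \o M t)) &
      forall s t, 0 <= s -> s <= t -> t <= T -> is_condexp (F s) (M t) (M s)].

Definition stopping_time (tau : Omega -> R) :=
  (forall w, 0 <= tau w <= T) /\
  (forall t, 0 <= t <= T -> F t [set w | tau w <= t]).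

(* On [0, T] a localizing sequence is one that is stationary at T. *)
Definition local_martingale M :=
  exists tau : nat -> Omega -> R,
  [/\ (forall k, stopping_time (tau k)),
      (forall k w, tau k w <= tau k.+1 w),
      {ae P, forall w, exists k, tau k w = T} &
      forall k, martingale (fun t w => M (Num.min t (tau k w)) w)].

(* [A] is the bracket <M> of the continuous martingale [M]. *)
Definition is_bracket M A :=
  [/\ in_S A, {ae P, forall w, A 0 w = 0}, as_nondecreasing A &
      local_martingale (fun t w => M t w ^+ 2 - A t w)].

(* The space of continuous martingales (calligraphic M^p). *)
Definition in_calMp p M :=
  [/\ in_S M, martingale M &
      exists2 A, is_bracket M A & (\int[P]_w ((A T w)%:E `^ (p / 2)%R) < +oo)%E].

Definition in_calMp_plus_Vp p X :=
  exists M V, [/\ in_calMp p M, in_Vp p V &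
    forall t w, 0 <= t <= T -> X t w = M t w + V t w].

Definition cvg_in_prob0 (X : nat -> Omega -> \bar R) :=
  forall e : R, 0 < e ->
    P [set w | (e%:E <= X k w)%E] @[k --> \oo] --> 0%E.

Section Ito.
Context (d : nat) (B : R -> Omega -> 'rV[R]_d).

(* The process \sum_(k < size) val k * 1_(]time k, time k.+1]). *)
Record simple_process := SimpleProcess {
  sp_size : nat ;
  sp_time : nat -> R ;
  sp_val : nat -> Omega -> 'rV[R]_d }.

Definition simple_predictable (H : simple_process) :=
  [/\ (forall k, (k <= sp_size H)%N -> 0 <= sp_time H k <= T),
      (forall k, (k < sp_size H)%N -> sp_time H k <= sp_time H k.+1),
      (forall k i, (k < sp_size H)%N ->
         measurable_wrt (F (sp_time H k)) (fun w => sp_val H k w 0 i)) &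
      exists C, forall k i w, (k < sp_size H)%N -> `|sp_val H k w 0 i| <= C].

Definition sp_eval (H : simple_process) (t : R) (w : Omega) : 'rV[R]_d :=
  \sum_(k < sp_size H | sp_time H k < t <= sp_time H k.+1) sp_val H k w.

Definition sp_int (H : simple_process) (t : R) (w : Omega) : R :=
  \sum_(k < sp_size H) \sum_(i < d) sp_val H k w 0 i *
    (B (Num.min (sp_time H k.+1) t) w 0 i - B (Num.min (sp_time H k) t) w 0 i).

(* [I] is the process t |-> \int_0^t Z_s dB_s, for [Z] progressive with
   \int_0^T |Z_s|^2 ds < oo a.s.: the limit, uniformly on [0, T] in probability,
   of the integrals of simple processes H k such that
   \int_0^T |H k - Z|^2 ds tends to 0 in probability.  It does not depend on
   the approximating sequence, up to indistinguishability. *)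
Definition is_ito_integral (Z : R -> Omega -> 'rV[R]_d) (I : R -> Omega -> R) :=
  in_S I /\
  exists H : nat -> simple_process,
  [/\ (forall k, simple_predictable (H k)),
      cvg_in_prob0 (fun k w =>
        \int[leb]_(t in `[0%R, T]) (enorm (sp_eval (H k) t w - Z t w) ^+ 2)%:E)%E &
      cvg_in_prob0 (fun k w =>
        ereal_sup [set `|sp_int (H k) t w - I t w|%:E | t in `[0%R, T]])].

End Ito.

(* \int_0^T f_t dk_t = 0, as a Lebesgue-Stieltjes integral; [k] is extended
   to the whole line by constants, which adds no mass. *)
Definition stieltjes_integral_eq0 (f k : R -> R) :=
  exists kT : cumulative R R,
    (forall t, kT t = k (Num.max 0 (Num.min t T))) /\
    (\int[lebesgue_stieltjes_measure kT]_(t in `[0%R, T]) (f t)%:E = 0)%E.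

Section Generators.
Context (d : nat).
Implicit Types (g : Omega -> R -> R -> 'rV[R]_d -> R).

Definition is_generator g :=
  (forall y z, progressive (fun t w => g w t y z)) /\
  (forall (Y : R -> Omega -> R) (Z : R -> Omega -> 'rV[R]_d),
     progressive Y -> progressive_vec Z ->
     progressive (fun t w => g w t (Y t w) (Z t w))).

Definition one_sided_osgood g :=
  exists rho : R -> R,
  [/\ (forall u, 0 <= u -> 0 <= rho u),
      {in `[0, +oo[ &, {homo rho : u v / u <= v}},
      convex_function (`[0, +oo[%classic : set R) (fun u => - rho u),
      (rho 0 = 0 /\ forall u, 0 < u -> 0 < rho u) &
      (forall e : R, 0 < e ->
         (\int[leb]_(u in `]0%R, e]) ((rho u)^-1)%:E = +oo)%E) /\
      {ae (P \x leb)%E, forall wt, 0 <= wt.2 <= T -> forall y1 y2 z,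
         (g wt.1 wt.2 y1 z - g wt.1 wt.2 y2 z) * Num.sg (y1 - y2)
           <= rho `|y1 - y2|}].

Definition linear_growth_z p g :=
  exists (mu lam : R) (f : R -> Omega -> R),
  [/\ 0 <= mu, 0 <= lam, in_Hp p f, (forall t w, 0 <= t <= T -> 0 <= f t w) &
      {ae (P \x leb)%E, forall wt, 0 <= wt.2 <= T -> forall y z,
         `|g wt.1 wt.2 y z - g wt.1 wt.2 y 0|
           <= f wt.2 wt.1 + mu * `|y| + lam * enorm z}].

(* Solutions (Y, Z, K) of the reflected BSDE (xi, g + dV, L). *)
Definition rbsde_solution (B : R -> Omega -> 'rV[R]_d) (xi : Omega -> R) g V L
    Y (Z : R -> Omega -> 'rV[R]_d) K :=
  [/\ [/\ progressive Y, progressive_vec Z & progressive K],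
      {ae P, forall w,
         leb.-integrable `[0, T] (fun t => `|g w t (Y t w) (Z t w)|%:E) /\
         leb.-integrable `[0, T] (fun t => (enorm (Z t w) ^+ 2)%:E)},
      (exists2 I, is_ito_integral B Z I &
         {ae P, forall w, forall t, 0 <= t <= T ->
            Y t w = xi w
              + \int[leb]_(s in `[t, T]) g w s (Y s w) (Z s w)
              + (V T w - V t w) + (K T w - K t w) - (I T w - I t w)}),
      {ae P, forall w, forall t, 0 <= t <= T -> L t w <= Y t w} &
      [/\ as_nondecreasing K, as_continuous K, {ae P, forall w, K 0 w = 0} &
          {ae P, forall w,
             stieltjes_integral_eq0 (fun t => Y t w - L t w) (K ^~ w)}]].

End Generators.
End Processes.

(* Main.v *)
(* One takes X = Y, with martingale part I = int Z dB and drift Y - I; everything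
   reduces to bounding the L^p norm of int |g(t, Y, 0)| dt. The one-sided Osgood
   condition, with rho(u) <= rho(1) (1 + u) by concavity, and the linear growth in z give
     |g(Y, 0)| <= 2 rho(|Y|) + 2 |g(0, 0)| + f + mu |Y| + lam |Z| - sgn(Y) g(Y, Z),
   so only - int sgn(Y) g(Y, Z) dt has to be controlled. Summing
     sgn(Y_ti) (Y_t(i+1) - Y_ti) <= |Y_t(i+1)| - |Y_ti|
   over a uniform grid, a discrete Tanaka inequality, bounds it in the limit by
     |Y_T| + |V|_T + K_T - K_0 - sum_i sgn(Y_ti) (I_t(i+1) - I_ti) + int N dt, where N is
   the majorant above: it controls the times where Y = 0, at which the grid signs need
   not converge. The sum is bounded in L^p uniformly in the grid by the
   Burkholder inequality, and Fatou's lemma concludes.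
   The Ito integral is only given as a limit of integrals of simple processes. Its
   Burkholder inequality, martingale property and bracket are proved for discrete
   integrals truncated along the clock t + int_0^t |Z|^2 and passed to the limit by
   uniform integrability. *)

(* The Osgood condition bounds sgn(Y) g(Y, 0) only from above. One side suffices because |a| <= 2 b
   - a as soon as a <= b and b >= 0; the missing information on the other side is carried by the
   equation. Two obstacles shape the rest. The discrete Tanaka bound holds only for grids finer than
   a threshold depending on the path, so it cannot be integrated for a fixed grid: it becomes a
   lower limit along each path, and the Burkholder constant must not depend on the grid. Moreover
   the total variation and the running supremum are not shown to be measurable in omega, so their
   moments are lower integrals, which are not additive in general; every estimate is arranged as a
   measurable majorant plus a single summand of this kind. The Burkholder inequality is needed at a
   terminal time only: explicit functions of the integral and of 1 + bracket do not increase in mean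
   at each Gaussian step, where all moments exist. The shift by 1 keeps negative powers bounded and
   costs a constant under a probability. *)
Require Import Defs.
From HB Require Import structures.
From mathcomp Require Import all_boot all_order all_algebra.
From mathcomp Require Import all_classical all_reals all_analysis.
From mathcomp Require Import measurable_realfun ring lra.
Import Order.TTheory GRing.Theory Num.Theory.
Import numFieldNormedType.Exports.

Set Implicit Arguments.
Unset Strict Implicit.
Unset Printing Implicit Defensive.

Local Open Scope classical_set_scope.
Local Open Scope ring_scope.

(** * Power inequalities *)

Section RealInequalities.
Context {R : realType}.
Implicit Types (a b r s u v w x y p q K : R).

(** Young's inequality with the conjugate exponents 1/r and 1/(1-r), applied to (y/b)^r and 1, is
    the tangent bound at b = 1; homogeneity gives it at every b. *)
Lemma powR_le_tangent r y b : 0 < r <= 1 -> 0 <= y -> 0 < b ->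
  y `^ r <= b `^ r + r * b `^ (r - 1) * (y - b).
Proof.
move=> /andP[r0]; rewrite le_eqVlt => /predU1P[->|r1] y0 b0.
  by rewrite !powRr1 ?(ltW b0)// subrr powRr0; lra.
have z0 : 0 <= y / b by rewrite divr_ge0 // ltW.
have H : (y / b) `^ r <= r * (y / b) + (1 - r).
  have r1' : 0 < 1 - r by rewrite subr_gt0.
  have := @conjugate_powR R ((y / b) `^ r) 1 r^-1 (1 - r)^-1 (powR_ge0 _ _) ler01.
  rewrite !invrK powR1 -powRrM mulfV ?gt_eqF// powRr1// mulr1 mul1r.
  rewrite !invr_gt0 r0 r1'; move=> /(_ isT isT).
  rewrite [_ * r]mulrC; apply.
  by rewrite addrC subrK.
have yE : y = b * (y / b) by rewrite mulrC divfK// gt_eqF.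
rewrite {1}yE powRM ?(ltW b0)//.
have -> : b `^ r = b * b `^ (r - 1).
  by rewrite mulr_powRB1 // ltW.
have -> : b * b `^ (r - 1) + r * b `^ (r - 1) * (y - b) =
    b * b `^ (r - 1) * (r * (y / b) + (1 - r)).
  by field; rewrite gt_eqF.
by rewrite ler_wpM2l // mulr_ge0 ?powR_ge0// ltW.
Qed.

(** Convexity is read off the concave case: [powR_le_tangent] with exponent 1/r at the point b^r,
    applied to y^r and solved for y^r. *)
Lemma powR_ge_tangent r y b : 1 <= r -> 0 <= y -> 0 < b ->
  b `^ r + r * b `^ (r - 1) * (y - b) <= y `^ r.
Proof.
move=> r1 y0 b0; have r0 : 0 < r by apply: lt_le_trans r1.
have br0 : 0 < b `^ r by rewrite powR_gt0.
have bq0 : 0 < b `^ (r - 1) by rewrite powR_gt0.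
have rr : 0 < r^-1 <= 1 by rewrite invr_gt0 r0 invf_le1.
have := powR_le_tangent rr (powR_ge0 y r) br0.
rewrite -!powRrM !mulfV ?gt_eqF// !powRr1 ?(ltW b0)//.
have -> : r * (r^-1 - 1) = - (r - 1) by field; rewrite gt_eqF.
rewrite powRN -(ler_pM2l (mulr_gt0 r0 bq0)).
have -> : r * b `^ (r - 1) *
    (b + r^-1 / b `^ (r - 1) * (y `^ r - b `^ r)) =
    r * (b * b `^ (r - 1)) + (y `^ r - b `^ r).
  by field; rewrite !gt_eqF.
by rewrite mulr_powRB1 ?(ltW b0)//; rewrite -(mulr_powRB1 (ltW b0) r0); nra.
Qed.

Lemma le_powR2r q u v : 0 <= q -> 0 <= u -> u <= v -> u `^ q <= v `^ q.
Proof.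
by move=> q0 u0 uv; apply: ge0_ler_powR => //; rewrite nnegrE// (le_trans u0).
Qed.

Lemma powR_antimono q u v : q <= 0 -> 0 < u -> u <= v -> v `^ q <= u `^ q.
Proof.
move=> q0 u0 uv; have v0 : 0 < v by exact: lt_le_trans uv.
rewrite -[q]opprK (powRN u) (powRN v) lef_pV2 ?posrE ?powR_gt0//.
by apply: le_powR2r => //; lra.
Qed.

(** If [a, a+s] and [w, w+s] do not overlap, the tangents at a+s and at w compare the two
    increments. If they overlap, the steps of length w - a starting at a and at a+s are compared
    instead. *)
Lemma powR_concave_increment r w a s : 0 < r <= 1 -> 0 < a -> a <= w -> 0 <= s ->
  (w + s) `^ r - w `^ r <= (a + s) `^ r - a `^ r.
Proof.
move=> r01 a0 aw s0.
have [r0 r1] := andP r01.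
have w0 : 0 < w by lra.
have as0 : 0 < a + s by lra.
have as0' : 0 <= a + s by lra.
have ws0 : 0 <= w + s by lra.
have B : 0 <= (a + s) `^ (r - 1) by exact: powR_ge0.
have H1 := powR_le_tangent r01 (ltW a0) as0.
have [asw|wlt] := leP (a + s) w.
  have H2 := powR_le_tangent r01 ws0 w0.
  have H3 : w `^ (r - 1) <= (a + s) `^ (r - 1).
    by apply: powR_antimono => //; lra.
  have : r * s * w `^ (r - 1) <= r * s * (a + s) `^ (r - 1).
    by rewrite ler_wpM2l// mulr_ge0// ltW.
  lra.
have H2 := powR_le_tangent r01 ws0 as0.
have H3 := powR_le_tangent r01 (ltW a0) w0.
have H4 : (a + s) `^ (r - 1) <= w `^ (r - 1).
  by apply: powR_antimono => //; lra.
have : r * (w - a) * (a + s) `^ (r - 1) <= r * (w - a) * w `^ (r - 1).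
  by rewrite ler_wpM2l// mulr_ge0//; lra.
lra.
Qed.

Lemma powR_add_le q u v : 0 <= q -> 0 <= u -> 0 <= v ->
  (u + v) `^ q <= 2 `^ q * (u `^ q + v `^ q).
Proof.
move=> q0 u0 v0.
wlog uv : u v u0 v0 / u <= v.
  move=> W; have [uv|/ltW vu] := leP u v; first exact: W.
  by rewrite addrC [u `^ _ + _]addrC W.
apply: (@le_trans _ _ ((2 * v) `^ q)).
  by apply: le_powR2r; rewrite ?normr_ge0//; lra.
by rewrite powRM// ler_wpM2l ?powR_ge0// lerDr powR_ge0.
Qed.

(* For p <= 2, with a = 1 + <M>, this is a supermartingale along (M, a); this is the
   upper Burkholder inequality. *)
Definition bdg_small p x a := (x ^+ 2 + a) `^ (p / 2) - 2 * a `^ (p / 2).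

(** The tangent is taken at x^2 + a + s, which is known before the increment y, so both correction
    terms vanish in mean when y is centred with conditional variance s. Of the two copies of
    a^(p/2), one pays for the growth of a inside the power and the other supplies the -s that
    compensates y^2. *)
Lemma bdg_small_step p x a s y : 0 < p <= 2 -> 0 < a -> 0 <= s ->
  bdg_small p (x + y) (a + s) <= bdg_small p x a
    + p * x * (x ^+ 2 + a + s) `^ (p / 2 - 1) * y
    + p / 2 * (x ^+ 2 + a + s) `^ (p / 2 - 1) * (y ^+ 2 - s).
Proof.
move=> /andP[p0 p2] a0 s0; rewrite /bdg_small.
set r := p / 2; have r01 : 0 < r <= 1 by rewrite /r; lra.
set w := x ^+ 2 + a; have aw : a <= w by rewrite /w; nra.
have ws0 : 0 < w + s by lra.
have as0 : 0 < a + s by lra.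
have H0 : 0 <= (x + y) ^+ 2 + (a + s) by have := sqr_ge0 (x + y); lra.
have H1 := powR_le_tangent r01 H0 ws0.
have H2 := powR_concave_increment r01 a0 aw s0.
have H3 := powR_le_tangent r01 (ltW a0) as0.
have H4 : (w + s) `^ (r - 1) <= (a + s) `^ (r - 1).
  by apply: powR_antimono => //; lra.
have [r0 _] := andP r01.
have : r * s * (w + s) `^ (r - 1) <= r * s * (a + s) `^ (r - 1).
  by rewrite ler_wpM2l// mulr_ge0// ltW.
have -> : p = 2 * r by rewrite /r; field.
move: H1; rewrite /w; nra.
Qed.

(* The analogue for p >= 2: with u = sqrt (x^2 + a), the Taylor error of u^p is absorbed
   by the decrease of - u^(p-1) sqrt a and - a^(p/2) when K is large. *)
Definition bdg_large p K x a :=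
  Num.sqrt (x ^+ 2 + a) `^ p
  - (p + 2 * K) * Num.sqrt (x ^+ 2 + a) `^ (p - 1) * Num.sqrt a
  - K * Num.sqrt a `^ p.

(** Convexity of t^(p-1) bounds v^(p-1) - u^(p-1), and the left side is at most 2 (v - u) times that
    difference. This measures the cost of moving the slope t^(p-2) from one end of a step to the
    other. *)
Lemma powR_monotone_product p u v : 2 <= p -> 0 < u -> u <= v ->
  (v `^ (p - 2) - u `^ (p - 2)) * (v ^+ 2 - u ^+ 2) <=
  2 * (p - 1) * v `^ (p - 2) * (v - u) ^+ 2.
Proof.
move=> p2 u0 uv; have v0 : 0 < v by lra.
have q1 : 1 <= p - 1 by lra.
have := powR_ge_tangent q1 (ltW u0) v0.
have -> : p - 1 - 1 = p - 2 by ring.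
have q0 : 0 < p - 1 by lra.
rewrite -(mulr_powRB1 (ltW v0) q0) -(mulr_powRB1 (ltW u0) q0).
have -> : p - 1 - 1 = p - 2 by ring.
set V := v `^ _; set U := u `^ _ => H.
have UV : U <= V by apply: le_powR2r; lra.
have U0 : 0 <= U by exact: powR_ge0.
have -> : (V - U) * (v ^+ 2 - u ^+ 2) = (v - u) * ((V - U) * (v + u)) by ring.
have -> : 2 * (p - 1) * V * (v - u) ^+ 2 = (v - u) * (2 * ((p - 1) * V * (v - u))).
  by ring.
rewrite ler_wpM2l ?subr_ge0//; nra.
Qed.

Lemma powR_sqrt_taylor p : 2 <= p -> exists2 C, 0 <= C & forall x b y, 0 < b ->
  Num.sqrt ((x + y) ^+ 2 + b) `^ p <= Num.sqrt (x ^+ 2 + b) `^ p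
    + p * Num.sqrt (x ^+ 2 + b) `^ (p - 2) * x * y
    + C * (Num.sqrt (x ^+ 2 + b) `^ (p - 2) * y ^+ 2 + `|y| `^ p).
Proof.
(* The p/2 is the coefficient of y^2 in the tangent bound. The other summand pays for replacing the
   slope v'^(p-2) by v^(p-2), with 2^(p-2) from splitting (v + |y|)^(p-2). *)
move=> p2; exists (p / 2 + p * (p - 1) * 2 `^ (p - 2)).
  by rewrite addr_ge0// ?mulr_ge0 ?powR_ge0//; lra.
move=> x b y b0.
set v := Num.sqrt (x ^+ 2 + b); set v' := Num.sqrt ((x + y) ^+ 2 + b).
have w0 : 0 < x ^+ 2 + b by have := sqr_ge0 x; lra.
have w'0 : 0 < (x + y) ^+ 2 + b by have := sqr_ge0 (x + y); lra.
have v0 : 0 < v by rewrite sqrtr_gt0.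
have v'0 : 0 < v' by rewrite sqrtr_gt0.
have vE : v ^+ 2 = x ^+ 2 + b by rewrite sqr_sqrtr// ltW.
have v'E : v' ^+ 2 = (x + y) ^+ 2 + b by rewrite sqr_sqrtr// ltW.
(* Cauchy-Schwarz for the vectors (x, sqrt b) and (x + y, sqrt b); it yields |v' - v| <= |y|. *)
have xyb : x * (x + y) + b <= v * v'.
  apply: (le_trans (ler_norm _)); rewrite -ler_sqr ?nnegrE ?(mulr_ge0 (ltW v0) (ltW v'0))//.
  rewrite real_normK ?num_real// exprMn vE v'E.
  have := mulr_ge0 (ltW b0) (sqr_ge0 y); nra.
have vv' : (v' - v) ^+ 2 <= y ^+ 2 by nra.
have p21 : 1 <= p / 2 by lra.
have E z : 0 < z -> (z ^+ 2) `^ (p / 2) = z `^ p.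
  by move=> z0; rewrite -powR_mulrn ?ltW// -powRrM mulrCA mulfV ?mulr1.
have E' z : 0 < z -> (z ^+ 2) `^ (p / 2 - 1) = z `^ (p - 2).
  move=> z0; rewrite -powR_mulrn ?ltW// -powRrM; by congr powR; field.
(* Convexity is used at the far end v'^2, because an upper bound on v'^p is wanted; the slope then
   sits at v' and has to be moved back to v, which is known before the step. *)
have := powR_ge_tangent p21 (sqr_ge0 v) (exprn_gt0 2 v'0).
rewrite !E// E'// => H1.
have H2 : (v' `^ (p - 2) - v `^ (p - 2)) * (v' ^+ 2 - v ^+ 2) <=
  2 * (p - 1) * (v + `|y|) `^ (p - 2) * y ^+ 2.
  have nvv' : `|v' - v| <= `|y|.
    by rewrite -ler_sqr ?nnegrE// !real_normK ?num_real.
  have p20 : 0 <= p - 2 by lra.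
  have [uv|/ltW vu] := leP v v'.
    apply: (le_trans (powR_monotone_product p2 v0 uv)).
    apply: ler_pM; rewrite ?sqr_ge0 ?mulr_ge0 ?powR_ge0//; first lra.
    rewrite ler_wpM2l//; first lra.
    apply: le_powR2r => //; first lra.
    by move: nvv'; rewrite ger0_norm ?subr_ge0//; lra.
  have := powR_monotone_product p2 v'0 vu.
  have -> : (v `^ (p - 2) - v' `^ (p - 2)) * (v ^+ 2 - v' ^+ 2) =
    (v' `^ (p - 2) - v `^ (p - 2)) * (v' ^+ 2 - v ^+ 2) by ring.
  move=> /le_trans; apply.
  apply: ler_pM; rewrite ?sqr_ge0 ?mulr_ge0 ?powR_ge0//; first lra.
    rewrite ler_wpM2l//; first lra.
    by apply: le_powR2r; rewrite ?lerDl//; lra.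
  by rewrite -[leLHS]sqrrN opprB.
have H3 : (v + `|y|) `^ (p - 2) * y ^+ 2 <=
    2 `^ (p - 2) * (v `^ (p - 2) * y ^+ 2 + `|y| `^ p).
  have p20 : 0 <= p - 2 by lra.
  have -> : `|y| `^ p = `|y| `^ (p - 2) * y ^+ 2.
    have [->|y0] := eqVneq y 0; first by rewrite normr0 powR0 ?gt_eqF//; clear -p2; lra.
    rewrite -(real_normK (num_real y)) -powR_mulrn// -powRD ?normr_eq0 ?y0 ?implybT//.
    by congr powR; ring.
  rewrite -mulrDl mulrA ler_wpM2r ?sqr_ge0//.
  exact: powR_add_le (ltW v0) (normr_ge0 _).
set X := (v + `|y|) `^ (p - 2) in H2 H3; set Z := _ + `|y| `^ p in H3 *.
have YZ : v `^ (p - 2) * y ^+ 2 <= Z by rewrite /Z lerDl powR_ge0.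
have D : v' ^+ 2 - v ^+ 2 = 2 * x * y + y ^+ 2 by rewrite vE v'E; ring.
rewrite D in H2.
have H4 : p * (p - 1) * (X * y ^+ 2) <= p * (p - 1) * (2 `^ (p - 2) * Z).
  by rewrite ler_wpM2l// mulr_ge0; clear -p2; lra.
have H5 : p / 2 * (v `^ (p - 2) * y ^+ 2) <= p / 2 * Z by rewrite ler_wpM2l//; lra.
have H6 : p / 2 * ((v' `^ (p - 2) - v `^ (p - 2)) * (2 * x * y + y ^+ 2)) <=
   p / 2 * (2 * (p - 1) * X * y ^+ 2) by rewrite ler_wpM2l//; lra.
have H7 : v' `^ p <= v `^ p + p / 2 * v' `^ (p - 2) * (2 * x * y + y ^+ 2).
  by move: H1; rewrite -D; clear; lra.
clear -H4 H5 H6 H7; lra.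
Qed.

(** C precedes K, which can then be taken large against it. By [H3] the growth of v^(p-1) sqrt a
    over a step is at least half of v^(p-2) s, so the weight p + 2K = 2 (p/2 + K) spends p/2 on the
    growth of a inside the square root and leaves -K v^(p-2) s; by [H4] the last term of [bdg_large]
    leaves -K s^(p/2). The term linear in y has a coefficient known before the step. *)
Lemma bdg_large_step p : 2 <= p -> exists2 C, 0 <= C & forall K x a s y,
  0 <= K -> 0 < a -> 0 <= s ->
  forall v, v = Num.sqrt (x ^+ 2 + (a + s)) ->
  bdg_large p K (x + y) (a + s) <= bdg_large p K x a
    + (p * v `^ (p - 2) * x
       - (p + 2 * K) * Num.sqrt (a + s) * (p - 1) * (v `^ (p - 2) / v) * x) * y
    + C * (v `^ (p - 2) * y ^+ 2 + `|y| `^ p)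
    - K * (v `^ (p - 2) * s + s `^ (p / 2)).
Proof.
move=> p2; have [C C0 HC] := powR_sqrt_taylor p2; exists C; first exact: C0.
move=> K x a s y K0 a0 s0 v vdef.
have as0 : 0 < a + s by lra.
have {}HC := HC x _ y as0; rewrite -vdef in HC.
rewrite /bdg_large; set v' := Num.sqrt ((x + y) ^+ 2 + (a + s)) in HC *.
set u := Num.sqrt (x ^+ 2 + a); set al := Num.sqrt a; set al' := Num.sqrt (a + s).
have w0 : 0 < x ^+ 2 + (a + s) by have := sqr_ge0 x; lra.
have wu0 : 0 < x ^+ 2 + a by have := sqr_ge0 x; lra.
have w'0 : 0 < (x + y) ^+ 2 + (a + s) by have := sqr_ge0 (x + y); lra.
have v0 : 0 < v by rewrite vdef sqrtr_gt0.
have u0 : 0 < u by rewrite sqrtr_gt0.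
have v'0 : 0 < v' by rewrite sqrtr_gt0.
have al0 : 0 < al by rewrite sqrtr_gt0.
have al'0 : 0 < al' by rewrite sqrtr_gt0.
have vE : v ^+ 2 = x ^+ 2 + (a + s) by rewrite vdef sqr_sqrtr// ltW.
have uE : u ^+ 2 = x ^+ 2 + a by rewrite sqr_sqrtr// ltW.
have v'E : v' ^+ 2 = (x + y) ^+ 2 + (a + s) by rewrite sqr_sqrtr// ltW.
have alE : al ^+ 2 = a by rewrite sqr_sqrtr// ltW.
have al'E : al' ^+ 2 = a + s by rewrite sqr_sqrtr// ltW.
have alv : al' <= v.
  by rewrite vdef ler_sqrt ?(ltW w0)// lerDr sqr_ge0.
have alal' : al <= al' by rewrite ler_sqrt//; lra.
have uv : u <= v by rewrite vdef ler_sqrt//; lra.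
have p1 : 1 <= p - 1 by lra.
have xyb : x * (x + y) + (a + s) <= v * v'.
  apply: (le_trans (ler_norm _)); rewrite -ler_sqr ?nnegrE ?(mulr_ge0 (ltW v0) (ltW v'0))//.
  rewrite real_normK ?num_real// exprMn vE v'E.
  have := mulr_ge0 (ltW as0) (sqr_ge0 y); nra.
have H1 : v `^ (p - 1) + (p - 1) * (v `^ (p - 2) / v) * x * y <= v' `^ (p - 1).
  apply: le_trans (powR_ge_tangent p1 (ltW v'0) v0); rewrite lerD2l.
  have -> : p - 1 - 1 = p - 2 by ring.
  rewrite -!mulrA ler_wpM2l//; first lra.
  rewrite ler_wpM2l ?powR_ge0// ler_pdivrMl//; nra.
have E z : 0 < z -> (z ^+ 2) `^ (p / 2) = z `^ p.
  by move=> z0; rewrite -powR_mulrn ?ltW// -powRrM mulrCA mulfV ?mulr1.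
have E' z : 0 < z -> (z ^+ 2) `^ (p / 2 - 1) = z `^ (p - 2).
  move=> z0; rewrite -powR_mulrn ?ltW// -powRrM; by congr powR; field.
have p21 : 1 <= p / 2 by lra.
have H2 : v `^ p <= u `^ p + p / 2 * v `^ (p - 2) * s.
  have := powR_ge_tangent p21 (sqr_ge0 u) (exprn_gt0 2 v0).
  by rewrite !E// E'// uE vE; lra.
have P1 z : 0 < z -> z `^ (p - 1) = z * z `^ (p - 2).
  move=> z0; rewrite -(@mulr_powRB1 _ _ (p - 1) (ltW z0)); last lra.
  by congr (_ * powR _ _); ring.
have H3 : v `^ (p - 2) * s <= 2 * (v `^ (p - 1) * al' - u `^ (p - 1) * al).
  have q0 : 0 <= v `^ (p - 2) by exact: powR_ge0.
  have : u `^ (p - 1) <= v `^ (p - 1) by apply: le_powR2r => //; [clear -p2; lra|exact: ltW].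
  move=> /(ler_wpM2r (ltW al0)) H.
  apply: (@le_trans _ _ (2 * (v `^ (p - 1) * (al' - al)))); last by lra.
  rewrite P1//.
  have -> : s = al' ^+ 2 - al ^+ 2 by rewrite alE al'E; ring.
  have -> : 2 * (v * v `^ (p - 2) * (al' - al)) = v `^ (p - 2) * (2 * v * (al' - al)).
    by ring.
  rewrite ler_wpM2l//; nra.
have H4 : s `^ (p / 2) <= al' `^ p - al `^ p.
  rewrite -!E// al'E alE.
  have r0 : 0 < p / 2 by lra.
  rewrite -(mulr_powRB1 (ltW as0) r0) -(mulr_powRB1 (ltW a0) r0) -(mulr_powRB1 s0 r0).
  have A1 : a `^ (p / 2 - 1) <= (a + s) `^ (p / 2 - 1).
    by apply: le_powR2r; clear -p2 a0 s0; lra.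
  have A2 : s `^ (p / 2 - 1) <= (a + s) `^ (p / 2 - 1).
    by apply: le_powR2r; clear -p2 a0 s0; lra.
  have := ler_wpM2l (ltW a0) A1; have := ler_wpM2l s0 A2; clear; lra.
have Kp0 : 0 <= p + 2 * K by clear -p2 K0; lra.
have H5 := ler_wpM2l (mulr_ge0 Kp0 (ltW al'0)) H1.
have H6 : 0 <= p / 2 + K by clear -p2 K0; lra.
have {}H3 := ler_wpM2l H6 H3.
have {}H4 := ler_wpM2l K0 H4.
clear -HC H2 H3 H4 H5; lra.
Qed.

(** Coercivity: the mixed term is at most half of u^p when u >= 2 (p + 2K) sqrt a; otherwise u,
    hence the mixed term, is controlled by sqrt a alone. *)
Lemma bdg_large_ge p K x a : 2 <= p -> 0 <= K -> 0 < a ->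
  `|x| `^ p <= 2 * bdg_large p K x a +
    2 * ((p + 2 * K) * (2 * (p + 2 * K)) `^ (p - 1) + K) * a `^ (p / 2).
Proof.
move=> p2 K0 a0; rewrite /bdg_large.
set u := Num.sqrt (x ^+ 2 + a); set al := Num.sqrt a.
set L := p + 2 * K; have L0 : 0 < L by rewrite /L; lra.
have wu0 : 0 < x ^+ 2 + a by have := sqr_ge0 x; lra.
have u0 : 0 < u by rewrite sqrtr_gt0.
have al0 : 0 < al by rewrite sqrtr_gt0.
have uE : u ^+ 2 = x ^+ 2 + a by rewrite sqr_sqrtr// ltW.
have alE : al ^+ 2 = a by rewrite sqr_sqrtr// ltW.
have xu : `|x| <= u.
  by rewrite -ler_sqr ?nnegrE ?(ltW u0)// real_normK ?num_real// uE; lra.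
have H1 : `|x| `^ p <= u `^ p by apply: le_powR2r; rewrite ?normr_ge0//; lra.
have -> : a `^ (p / 2) = al `^ p.
  rewrite -alE -powR_mulrn ?ltW// -powRrM; by congr powR; field.
have p0 : 0 < p by lra.
suff : L * u `^ (p - 1) * al <= 2^-1 * u `^ p + L * (2 * L) `^ (p - 1) * al `^ p by nra.
have [H|H] := leP (2 * L * al) u.
  apply: (@le_trans _ _ (2^-1 * u `^ p)); last first.
    by rewrite lerDl !mulr_ge0 ?powR_ge0// ltW.
  rewrite -(mulr_powRB1 (ltW u0) p0).
  have := ler_wpM2r (powR_ge0 u (p - 1)) H; lra.
apply: (@le_trans _ _ (L * (2 * L) `^ (p - 1) * al `^ p)); last first.
  by rewrite lerDr !mulr_ge0 ?powR_ge0//.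
rewrite -(mulr_powRB1 (ltW al0) p0).
have : u `^ (p - 1) <= (2 * L) `^ (p - 1) * al `^ (p - 1).
  rewrite -powRM ?(ltW al0)//; last lra.
  by apply: le_powR2r; rewrite ?normr_ge0//; lra.
move=> /(ler_wpM2l (mulr_ge0 (ltW L0) (ltW al0))); lra.
Qed.

End RealInequalities.

(** * Gaussian moments *)

Section Density.
Context {R : realType}.
Local Notation leb := (@lebesgue_measure R).

(** The Radon-Nikodym derivative of the Gaussian law agrees almost everywhere with [normal_pdf],
    since both have the same integral over every measurable set. *)
Lemma ge0_integral_normal_prob (m s : R) (f : R -> \bar R) :
  measurable_fun setT f -> (forall x, 0 <= f x)%E ->
  (\int[normal_prob m s]_x f x = \int[leb]_x (f x * (normal_pdf m s x)%:E))%E.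
Proof.
move=> mf f0; pose h := Radon_Nikodym_SigmaFinite.f (normal_prob m s) leb.
have mh : measurable_fun setT h.
  apply: measurable_int.
  exact: (Radon_Nikodym_SigmaFinite.f_integrable (normal_prob_dominates m s)).
rewrite -(Radon_Nikodym_SigmaFinite.change_of_variables
  (normal_prob_dominates m s) f0 measurableT mf).
apply: ae_eq_integral => //.
- exact: emeasurable_funM.
- apply: emeasurable_funM => //; apply/measurable_EFinP.
  exact: measurable_normal_pdf.
- apply: ae_eqe_mul2l; apply: integral_ae_eq => //=.
  + exact: (Radon_Nikodym_SigmaFinite.f_integrable (normal_prob_dominates m s)).
  + by apply/measurable_EFinP; exact: measurable_normal_pdf.
  + move=> E _ mE.
    by rewrite -(Radon_Nikodym_SigmaFinite.f_integral (normal_prob_dominates m s)).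
Qed.

Lemma normal_prob_mgf (s th : R) : s != 0 ->
  (\int[normal_prob 0 s]_x (expR (th * x))%:E =
   (expR (th ^+ 2 * s ^+ 2 / 2))%:E)%E.
Proof.
move=> s0; rewrite ge0_integral_normal_prob; last 2 first.
- by apply/measurable_EFinP; apply: measurableT_comp => //; exact: measurable_funM.
- by move=> x; rewrite lee_fin expR_ge0.
(* Completing the square: the exponentially tilted density is the normal density recentred at th
   s^2. *)
transitivity (\int[leb]_x ((expR (th ^+ 2 * s ^+ 2 / 2))%:E *
   (normal_pdf (th * s ^+ 2) s x)%:E))%E.
  apply: eq_integral => x _; rewrite -!EFinM; congr EFin.
  rewrite !normal_pdfE// mulrCA [RHS]mulrCA; congr (_ * _).
  rewrite /normal_fun -!expRD; congr expR; field.
  by [].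
rewrite ge0_integralZl//.
- by rewrite integral_normal_pdf mule1.
- by apply/measurable_EFinP; exact: measurable_normal_pdf.
- by move=> x _; rewrite lee_fin normal_pdf_ge0.
Qed.

Lemma powR_le_expR (q x : R) : 0 < q -> 0 <= x -> x `^ q <= q `^ q * expR x.
Proof.
move=> q0 x0; have xE : x = q * (x / q) by rewrite mulrC divfK// gt_eqF.
have z0 : 0 <= x / q by rewrite divr_ge0// ltW.
rewrite {1}xE powRM ?(ltW q0)// ler_wpM2l ?powR_ge0//.
have : x / q <= expR (x / q).
  by apply: le_trans (expR_ge1Dx (x / q)); rewrite lerDr.
move=> /(le_powR2r (ltW q0) z0) /le_trans; apply.
by rewrite -expRM_natl || rewrite /powR gt_eqF ?expR_gt0// expRK mulrC divfK ?gt_eqF.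
Qed.

Lemma expR_sub1_le (x : R) : expR x - 1 <= x * expR x.
Proof.
have := expR_ge1Dx (- x); rewrite expRN => H.
have e0 := expR_gt0 x.
have := ler_wpM2r (ltW e0) H; rewrite mulVf ?gt_eqF//; lra.
Qed.

Lemma expR_norm_le (x : R) : expR `|x| <= expR x + expR (- x).
Proof.
have [x0|x0] := leP 0 x.
  by rewrite ger0_norm// lerDl expR_ge0.
by rewrite ltr0_norm// lerDr expR_ge0.
Qed.

(** The middle term is (e^(x/2) - e^(-x/2))^2, squeezed for x >= 0 between (x e^(-x/2))^2 and (x
    e^(x/2))^2. The cubic errors let the variance be read off the moment generating function. *)
Lemma cosh_taylor (x : R) :
  x ^+ 2 - `|x| ^+ 3 <= expR x + expR (- x) - 2 <= x ^+ 2 + `|x| ^+ 3 * expR `|x|.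
Proof.
wlog x0 : x / 0 <= x.
  move=> H; have [/H//|/ltW x0] := leP 0 x.
  have := H (- x); rewrite oppr_ge0 x0 normrN sqrrN opprK.
  by rewrite [expR (- x) + _]addrC; exact.
rewrite ger0_norm//; set y := x / 2.
have y0 : 0 <= y by rewrite divr_ge0.
have xE : x = y + y by rewrite /y; field.
set e := expR y; set f := expR (- y).
have e0 : 0 < e by exact: expR_gt0.
have f0 : 0 < f by exact: expR_gt0.
have ef : e * f = 1 by rewrite /e /f -expRD subrr expR0.
have E1 : expR x = e * e by rewrite xE expRD.
have E2 : expR (- x) = f * f by rewrite xE opprD expRD.
have D : expR x + expR (- x) - 2 = (e - f) ^+ 2 by rewrite E1 E2; lra.
have ee : 1 + x <= e * e by rewrite -E1; exact: expR_ge1Dx.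
have ff : 1 - x <= f * f by rewrite -E2; exact: expR_ge1Dx.
have up : e - f <= x * e.
  have := ler_wpM2l (ltW e0) ff; rewrite mulrA ef; lra.
have lo : x * f <= e - f.
  have := ler_wpM2l (ltW f0) ee; rewrite mulrA [f * e]mulrC ef; lra.
have ef0 : 0 <= e - f by apply: le_trans lo; rewrite mulr_ge0// ltW.
have xf0 : 0 <= x * f by rewrite mulr_ge0// ltW.
rewrite D; apply/andP; split.
  have : (x * f) ^+ 2 <= (e - f) ^+ 2 by rewrite ler_sqr ?nnegrE.
  apply: le_trans; rewrite exprMn.
  have := ler_wpM2l (sqr_ge0 x) ff; lra.
have : (e - f) ^+ 2 <= (x * e) ^+ 2.
  by rewrite ler_sqr ?nnegrE// mulr_ge0// ltW.
move=> /le_trans; apply; rewrite exprMn -[e ^+ 2]/(e * e) -E1.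
have := expR_sub1_le x => /(ler_wpM2l (sqr_ge0 x)); lra.
Qed.

End Density.

(** * Random variables with moments of all orders *)

Section Moments.
Context {R : realType} {dO : measure_display} {Omega : measurableType dO}.
Variable P : probability Omega R.
Implicit Types X Y : Omega -> R.

Lemma integrable_RZl (c : R) X : P.-integrable setT (EFin \o X) ->
  P.-integrable setT (EFin \o (fun w => c * X w)).
Proof.
move=> iX; rewrite (_ : _ \o _ = fun w => (c%:E * (EFin \o X) w)%E)//.
exact: integrableZl.
Qed.

Lemma integrable_RD X Y : P.-integrable setT (EFin \o X) ->
  P.-integrable setT (EFin \o Y) ->
  P.-integrable setT (EFin \o (fun w => X w + Y w)).
Proof.
move=> iX iY; rewrite (_ : _ \o _ = (EFin \o X) \+ (EFin \o Y))%E//.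
exact: integrableD.
Qed.

Lemma Rintegral_cst_prob (c : R) : (\int[P]_w c)%R = c.
Proof. by rewrite Rintegral_cst//= probability_setT mulr1. Qed.

(** A class stable under sums and products that contains the bounded variables and the Gaussian
    increments: integrability of the discrete expressions below reduces to membership. *)
Definition all_moments X := measurable_fun setT X /\
  forall m : nat, P.-integrable setT (fun w => (`|X w| ^+ m)%:E).

Lemma all_moments_integrable X : all_moments X -> P.-integrable setT (EFin \o X).
Proof.
move=> [mX /(_ 1%N) iX]; apply: le_integrable iX => //.
  exact/measurable_EFinP.
by move=> w _; rewrite /= expr1 lee_fin normr_id.
Qed.

Lemma all_moments_le X Y : all_moments X -> measurable_fun setT Y ->
  (forall w, `|Y w| <= `|X w|) -> all_moments Y.
Proof.
move=> [mX iX] mY YX; split => // m; apply: le_integrable (iX m) => //.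
  apply/measurable_EFinP; apply: measurable_funX; exact: measurableT_comp.
move=> w _; rewrite lee_fin !normrX !normr_id.
by apply: lerXn2r; rewrite ?nnegrE.
Qed.

Lemma all_moments_bounded X C : measurable_fun setT X ->
  (forall w, `|X w| <= C) -> all_moments X.
Proof.
move=> mX XC; split => // m.
apply: (@le_integrable _ _ _ P _ _ _ (cst (C ^+ m)%:E)) => //.
- apply/measurable_EFinP; apply: measurable_funX; exact: measurableT_comp.
- move=> w _; rewrite lee_fin normrX normr_id.
  apply: le_trans (ler_norm _); apply: lerXn2r; rewrite ?nnegrE//.
  exact: le_trans (XC w).
- exact: finite_measure_integrable_cst.
Qed.

Lemma all_moments_cst C : all_moments (cst C).
Proof. by apply: (@all_moments_bounded _ `|C|) => //; exact: measurable_cst. Qed.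

Lemma all_moments_norm X : all_moments X -> all_moments (fun w => `|X w|).
Proof.
move=> mX; apply: (all_moments_le mX); last by move=> w; rewrite normr_id.
by apply: measurableT_comp => //; case: mX.
Qed.

Lemma all_momentsD X Y : all_moments X -> all_moments Y ->
  all_moments (fun w => X w + Y w).
Proof.
move=> [mX iX] [mY iY]; split; first exact: measurable_funD.
move=> m; apply: (@le_integrable _ _ _ P _ measurableT _
   (fun w => ((2 ^+ m)%:E * (`|X w| ^+ m)%:E) + ((2 ^+ m)%:E * (`|Y w| ^+ m)%:E))%E) => //.
- apply/measurable_EFinP; apply: measurable_funX; apply: measurableT_comp => //.
  exact: measurable_funD.
- move=> w _; rewrite -!EFinM -EFinD lee_fin normrX normr_id; apply: le_trans (ler_norm _).
  rewrite -mulrDr -!powR_mulrn//; apply: le_trans (powR_add_le _ _ _) => //.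
  by rewrite le_powR2r// ler_normD.
- by apply: integrableD => //; apply: integrableZl.
Qed.

Lemma all_momentsM X Y : all_moments X -> all_moments Y ->
  all_moments (fun w => X w * Y w).
Proof.
move=> [mX iX] [mY iY]; split; first exact: measurable_funM.
move=> m; apply: (@le_integrable _ _ _ P _ measurableT _
   (fun w => ((`|X w| ^+ (2 * m))%:E + (`|Y w| ^+ (2 * m))%:E)%E)) => //.
- apply/measurable_EFinP; apply: measurable_funX; apply: measurableT_comp => //.
  exact: measurable_funM.
- move=> w _; rewrite -EFinD lee_fin normrX normr_id; apply: le_trans (ler_norm _).
  rewrite normrM exprMn mulnC !exprM.
  have := exprn_ge0 m (normr_ge0 (X w)); have := exprn_ge0 m (normr_ge0 (Y w)); nra.
- exact: integrableD.
Qed.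

Lemma all_moments_sum (I : Type) (r : seq I) (Q : pred I) (X : I -> Omega -> R) :
  (forall i, Q i -> all_moments (X i)) ->
  all_moments (fun w => \sum_(i <- r | Q i) X i w).
Proof.
move=> H; elim: r => [|i r IH].
  by under eq_fun do rewrite big_nil; exact: all_moments_cst.
under eq_fun do rewrite big_cons.
by case Qi : (Q i) => //; apply: all_momentsD => //; exact: H.
Qed.

Lemma all_moments_powR X q : 0 <= q -> (forall w, 0 <= X w) -> all_moments X ->
  all_moments (fun w => X w `^ q).
Proof.
move=> q0 X0 mX.
have [n qn] : exists n : nat, q <= n%:R.
  exists (Num.truncn q).+1; apply/ltW; have /andP[] := truncn_itv q0; by [].
have H : all_moments (fun w => 1 + X w ^+ n).
  apply: all_momentsD; first exact: all_moments_cst.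
  elim: {qn} n => [|n IH]; first exact: all_moments_cst.
  by under eq_fun do rewrite exprS; exact: all_momentsM.
apply: (all_moments_le H).
  by apply: (measurableT_comp (measurable_powR _)) => //; case: mX.
move=> w; rewrite !ger0_norm ?powR_ge0 ?addr_ge0 ?exprn_ge0//.
have [X1|/ltW X1] := leP (X w) 1.
  apply: (@le_trans _ _ 1); last by rewrite lerDl exprn_ge0.
  by have := le_powR2r q0 (X0 w) X1; rewrite powR1.
apply: (@le_trans _ _ (X w ^+ n)); last by rewrite lerDr.
by rewrite -powR_mulrn// ler_powR.
Qed.

Lemma all_moments_normal X s : 0 < s -> measurable_fun setT X ->
  (forall U, measurable U -> P (X @^-1` U) = normal_prob 0 s U) ->
  [/\ all_moments X,
      (forall th, P.-integrable setT (fun w => (expR (th * X w))%:E)) &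
      forall th, (\int[P]_w expR (th * X w))%R = expR (th ^+ 2 * s ^+ 2 / 2)].
Proof.
move=> s0 mX law.
have E th : (\int[P]_w (expR (th * X w))%:E = (expR (th ^+ 2 * s ^+ 2 / 2))%:E)%E.
  rewrite -(normal_prob_mgf th (lt0r_neq0 s0)).
  pose X' : {mfun Omega >-> measurableTypeR R} := HB.pack (X : Omega -> measurableTypeR R)
    (isMeasurableFun.Build _ _ _ (measurableTypeR R) X mX).
  rewrite -(@ge0_integral_distribution _ _ _ _ _ P X' (fun x => (expR (th * x))%:E)).
  - have H := @eq_measure_integral _ (measurableTypeR R) R setT (normal_prob 0 s)
      (distribution P X') (fun y => (expR (th * y))%:E).
    apply: H.
    by move=> A mA _; exact: law.
  - by apply/measurable_EFinP; apply: measurableT_comp => //; exact: measurable_funM.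
  - by move=> x; rewrite lee_fin expR_ge0.
have I th : P.-integrable setT (fun w => (expR (th * X w))%:E).
  apply/integrableP; split.
    apply/measurable_EFinP; apply: measurableT_comp => //.
    exact: measurable_funM.
  under eq_integral do rewrite gee0_abs ?lee_fin ?expR_ge0//.
  by rewrite E ltry.
split => //; last by move=> th; rewrite /Rintegral E.
(* The majorant uses |x|^m <= 1 + |x|^(m+1), because [powR_le_expR] requires a positive exponent and
   m may be 0. *)
split => // m; apply: (@le_integrable _ _ _ P _ measurableT _
   (fun w => ((m.+1%:R `^ m.+1%:R)%:E * ((expR (1 * X w))%:E + (expR (- 1 * X w))%:E) + 1)%E)) => //.
- by apply/measurable_EFinP; apply: measurable_funX; exact: measurableT_comp.
- move=> w _; rewrite -[(_ + (expR (-1 * _))%:E)%E]EFinD -EFinM -EFinD lee_fin normrX normr_id.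
  apply: le_trans (ler_norm _); rewrite mul1r mulN1r.
  have H := @powR_le_expR R m.+1%:R `|X w|.
  have {}H : `|X w| ^+ m.+1 <= m.+1%:R `^ m.+1%:R * (expR (X w) + expR (- X w)).
    rewrite -powR_mulrn//; apply: le_trans (H _ _) _ => //.
    by rewrite ler_wpM2l ?powR_ge0// expR_norm_le.
  have [X1|/ltW X1] := leP `|X w| 1.
    apply: (@le_trans _ _ 1); first exact: exprn_ile1.
    by rewrite lerDr mulr_ge0 ?powR_ge0// addr_ge0 ?expR_ge0.
  apply: (@le_trans _ _ (`|X w| ^+ m.+1)); first exact: ler_weXn2l.
  by apply: (le_trans H); rewrite lerDl.
- apply: integrableD => //; last exact: finite_measure_integrable_cst.
  by apply: integrableZl => //; apply: integrableD.
Qed.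


Lemma le_of_forall_small (a b C d : R) : 0 < d ->
  (forall t, 0 < t <= d -> a <= b + t * C) -> a <= b.
Proof.
move=> d0 H; apply/ler_addgt0Pr => e e0.
have k0 : 0 < 1 + `|C| + e / d by rewrite addr_gt0 ?divr_gt0// ltr_pwDl.
have := H (e / (1 + `|C| + e / d)).
rewrite divr_gt0//= ler_pdivrMr//.
have -> : d * (1 + `|C| + e / d) = d * (1 + `|C|) + e by field; rewrite gt_eqF.
have dc : 0 <= d * (1 + `|C|) by rewrite mulr_ge0 ?addr_ge0// ltW.
rewrite lerDr dc => /(_ isT) /le_trans; apply; rewrite lerD2l.
rewrite mulrAC ler_pdivrMr// ler_wpM2l ?(ltW e0)//.
apply: (le_trans (ler_norm _)); have := divr_gt0 e0 d0; lra.
Qed.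

(** Both moments are read off the moment generating function near 0: 1 + x <= e^x at th and -th
    gives the mean, and [cosh_taylor] gives the variance, its cubic remainders being integrable. *)
Lemma normal_mean_variance X s : 0 < s -> measurable_fun setT X ->
  (forall U, measurable U -> P (X @^-1` U) = normal_prob 0 s U) ->
  (\int[P]_w X w)%R = 0 /\ (\int[P]_w (X w ^+ 2))%R = s ^+ 2.
Proof.
move=> s0 mX law; have [aX iE EE] := all_moments_normal s0 mX law.
have iX := all_moments_integrable aX.
have aX2 : all_moments (fun w => X w ^+ 2) by exact: all_momentsM.
have aN := all_moments_norm aX.
have aX3 : all_moments (fun w => `|X w| ^+ 3).
  by apply: all_momentsM => //; exact: all_momentsM.
have int1 := Rintegral_cst_prob.
have ic (c : R) : P.-integrable setT (EFin \o (fun _ : Omega => c)).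
  exact: finite_measure_integrable_cst.
have iZ := integrable_RZl.
have iD := integrable_RD.
set m := (\int[P]_w X w)%R; set e := expR 1 : R.
have e0 : 0 < e by exact: expR_gt0.
have s20 : 0 < s ^+ 2 by rewrite exprn_gt0.
have expB (h : R) : 0 <= h <= 1 -> h <= expR h - 1 <= h * e.
  move=> /andP[h0 h1]; have := expR_ge1Dx h; have := expR_sub1_le h.
  have : expR h <= e by rewrite ler_expR.
  move=> /(ler_wpM2l h0); lra.
have mE th : th * m <= expR (th ^+ 2 * s ^+ 2 / 2) - 1.
  rewrite -EE /m -RintegralZl// lerBrDl -{1}[1]int1 -RintegralD//; last exact: iZ.
  apply: le_Rintegral => //; [by apply: iD => //; exact: iZ | exact: iE|].
  by move=> w _; exact: expR_ge1Dx.
(* This range of t keeps h = t^2 s^2 / 2 in [0, 1], where e^h - 1 lies between h and e h. *)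
have d0 : 0 < Num.min 1 (s ^+ 2)^-1 by rewrite lt_min ltr01 invr_gt0.
have small t : 0 < t <= Num.min 1 (s ^+ 2)^-1 -> 0 <= t ^+ 2 * s ^+ 2 / 2 <= 1.
  move=> /andP[t0]; rewrite le_min => /andP[t1 t2].
  have t3 : t * s ^+ 2 <= 1 by rewrite -ler_pdivlMr// div1r.
  move: s20 t3; set q := s ^+ 2 => q0 t3.
  have H1 : 0 <= t ^+ 2 * q by rewrite mulr_ge0 ?sqr_ge0// ltW.
  have H2 : t ^+ 2 * q <= 1.
    rewrite expr2 -mulrA mulr_ile1 ?(ltW t0)//.
    by rewrite mulr_ge0 ?(ltW t0) ?(ltW q0).
  by apply/andP; split; lra.
have sml : forall x : R, x <= 0 -> - x <= 0 -> x = 0 by move=> x; lra.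
split.
  apply: sml.
    apply: (@le_of_forall_small _ _ (s ^+ 2 / 2 * e) _ d0) => t td.
    have := expB _ (small _ td) => /andP[_].
    have [t0 _] := andP td; have := mE t => H1 /(le_trans H1) H2.
    rewrite -(ler_pM2l t0); apply: (le_trans H2).
    by rewrite add0r [leRHS]mulrA -expr2 !mulrA.
  apply: (@le_of_forall_small _ _ (s ^+ 2 / 2 * e) _ d0) => t td.
  have := expB _ (small _ td) => /andP[_].
  have [t0 _] := andP td; have := mE (- t); rewrite sqrrN => H1 /(le_trans H1) H2.
  rewrite -(ler_pM2l t0) mulrN -mulNr; apply: (le_trans H2).
  by rewrite add0r [leRHS]mulrA -expr2 !mulrA.
have ik : P.-integrable setT (EFin \o (fun w => `|X w| ^+ 3 * expR `|X w|)).
  apply: (@le_integrable _ _ _ P _ measurableT _ (EFin \o (fun w =>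
     (3 `^ 3) * (expR (2 * X w) + expR (- 2 * X w))))) => //.
  - apply/measurable_EFinP; apply: measurable_funM; first by case: aX3.
    by apply: measurableT_comp => //; exact: measurableT_comp.
  - move=> w _; rewrite lee_fin normrM normrX normr_id (ger0_norm (expR_ge0 _)).
    apply: le_trans (ler_norm _).
    have H : `|X w| ^+ 3 <= 3 `^ 3 * expR `|X w|.
      rewrite -powR_mulrn//; exact: powR_le_expR.
    apply: (le_trans (ler_wpM2r (expR_ge0 _) H)).
    rewrite -mulrA -expRD ler_wpM2l//.
    have := expR_norm_le (2 * X w); rewrite normrM (ger0_norm (ler0n _ 2)).
    by rewrite mulNr mulrDl !mul1r.
  - by apply: iZ; apply: iD; exact: iE.
have [iX2 iX3] := (all_moments_integrable aX2, all_moments_integrable aX3).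
set v := (\int[P]_w (X w ^+ 2))%R.
set c := (\int[P]_w (`|X w| ^+ 3))%R.
set k := (\int[P]_w (`|X w| ^+ 3 * expR `|X w|))%R.
have coshE t : (\int[P]_w (expR (t * X w) + expR (- t * X w) - 2))%R =
    2 * (expR (t ^+ 2 * s ^+ 2 / 2) - 1).
  rewrite RintegralB//; last by apply: iD; exact: iE.
  rewrite RintegralD//; [|exact: iE..].
  by rewrite int1 !EE sqrrN; ring.
have icosh t : P.-integrable setT (EFin \o (fun w => expR (t * X w) + expR (- t * X w) - 2)).
  by apply: (iD) => //; apply: iD; exact: iE.
apply/eqP; rewrite eq_le; apply/andP; split.
  apply: (@le_of_forall_small _ _ (c + s ^+ 2 * (s ^+ 2 / 2) * e) _ d0) => t td.
  have [t0 t1'] := andP td.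
  have t1 : t <= 1 by move: t1'; rewrite le_min => /andP[].
  have /andP[_ H1] := expB _ (small _ td).
  have H2 : t ^+ 2 * v - t ^+ 3 * c <= 2 * (expR (t ^+ 2 * s ^+ 2 / 2) - 1).
    rewrite -coshE /v /c -!RintegralZl// -RintegralB//; [|exact: iZ..].
    apply: le_Rintegral => //; first by apply: iD; [exact: iZ|rewrite -[EFin \o _]/(EFin \o (fun w => - (t ^+ 3 * `|X w| ^+ 3))); under eq_fun do rewrite -mulNr; exact: iZ].
    move=> w _; have /andP[+ _] := cosh_taylor (t * X w).
    by rewrite normrM (ger0_norm (ltW t0)) !exprMn mulNr.
  have t2 : 0 < t ^+ 2 by rewrite exprn_gt0.
  rewrite -(ler_pM2l t2).
  have H3 : 2 * (expR (t ^+ 2 * s ^+ 2 / 2) - 1) <= t ^+ 2 * s ^+ 2 + t ^+ 2 * (t * (s ^+ 2 * (s ^+ 2 / 2) * e)).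
    have /andP[h0 h1] := small _ td.
    set h := t ^+ 2 * s ^+ 2 / 2 in H1 h0 h1 *.
    have B := expR_sub1_le h.
    have A : h * expR h <= h * (1 + h * e) by rewrite ler_wpM2l//; lra.
    have hE : t ^+ 2 * s ^+ 2 = 2 * h by rewrite /h; field.
    rewrite hE.
    have -> : t ^+ 2 * (t * (s ^+ 2 * (s ^+ 2 / 2) * e)) = t * (h * (s ^+ 2 * e)) by rewrite /h; field.
    have : h * (h * e) <= 2^-1 * (t * (h * (s ^+ 2 * e))).
      have -> : 2^-1 * (t * (h * (s ^+ 2 * e))) = h * ((t * s ^+ 2 / 2) * e) by field.
      rewrite ler_wpM2l// ler_wpM2r ?(ltW e0)// /h.
      rewrite ler_wpM2r ?invr_ge0// ler_wpM2r ?(ltW s20)// expr2 ler_piMl// ltW//.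
    lra.
  by rewrite !mulrDr; lra.
apply: (@le_of_forall_small _ _ k _ d0) => t td.
have [t0 t1'] := andP td.
have t1 : t <= 1 by move: t1'; rewrite le_min => /andP[].
have /andP[H1 _] := expB _ (small _ td).
have t2 : 0 < t ^+ 2 by rewrite exprn_gt0.
rewrite -(ler_pM2l t2).
have H2 : 2 * (expR (t ^+ 2 * s ^+ 2 / 2) - 1) <= t ^+ 2 * v + t ^+ 3 * k.
  rewrite -coshE /v /k -!RintegralZl// -RintegralD//; [|exact: iZ..].
  apply: le_Rintegral => //; first by apply: iD; exact: iZ.
  move=> w _; have /andP[_] := cosh_taylor (t * X w).
  rewrite normrM (ger0_norm (ltW t0)) !exprMn mulNr => /le_trans; apply.
  rewrite lerD2l -mulrA; apply: ler_wpM2l; first by rewrite exprn_ge0// ltW.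
  apply: ler_wpM2l; first by rewrite exprn_ge0.
  by rewrite ler_expR ler_piMl.
have -> : t ^+ 2 * (v + t * k) = t ^+ 2 * v + t ^+ 3 * k by ring.
apply: le_trans H2; lra.
Qed.

(** Scaling: |X| / s has an exponential moment bounded by 2 e^(1/2) whatever s is, so the constant
    does not involve s. The factor q^q comes from comparing the power with the exponential. *)
Lemma normal_abs_moment X s q : 0 < s -> measurable_fun setT X ->
  (forall U, measurable U -> P (X @^-1` U) = normal_prob 0 s U) -> 0 < q ->
  (\int[P]_w (`|X w| `^ q))%R <= q `^ q * (2 * expR 1) * s `^ q.
Proof.
move=> s0 mX law q0; have [aX iE EE] := all_moments_normal s0 mX law.
have iaX := all_moments_powR (ltW q0) (fun w => normr_ge0 (X w)) (all_moments_norm aX).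
have iS : P.-integrable setT (EFin \o (fun w => expR (s^-1 * X w) + expR (- s^-1 * X w))).
  by apply: integrable_RD; exact: iE.
have iZ (c : R) := integrable_RZl c iS.
apply: (@le_trans _ _ (\int[P]_w ((q `^ q * s `^ q) * (expR (s^-1 * X w) + expR (- s^-1 * X w))))%R).
  apply: le_Rintegral => //; first exact: all_moments_integrable.
  move=> w _; have XE : `|X w| = s * `|s^-1 * X w|.
    by rewrite normrM gtr0_norm ?invr_gt0// mulrA divff ?mul1r// gt_eqF.
  rewrite XE powRM ?(ltW s0)//.
  have := powR_le_expR q0 (normr_ge0 (s^-1 * X w)).
  have := expR_norm_le (s^-1 * X w); rewrite -mulNr.
  move=> /(ler_wpM2l (powR_ge0 q q)) H1 /le_trans/(_ H1)/(ler_wpM2l (powR_ge0 s q)).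
  by rewrite mulrA [s `^ q * q `^ q]mulrC.
rewrite RintegralZl// RintegralD//; last 2 first.
  exact: iE.
  exact: iE.
rewrite !EE sqrrN exprVn mulVf ?expf_neq0 ?gt_eqF//.
have H : expR (1 / 2) <= expR 1 :> R by rewrite ler_expR; lra.
have := ler_wpM2l (mulr_ge0 (powR_ge0 q q) (powR_ge0 s q)) H; lra.
Qed.

Lemma indep_Rintegral_mul X Y : all_moments X -> all_moments Y ->
  (forall U W : set R, measurable U -> measurable W ->
    P (X @^-1` U `&` Y @^-1` W) = (P (X @^-1` U) * P (Y @^-1` W))%E) ->
  (\int[P]_w (X w * Y w))%R = (\int[P]_w X w)%R * (\int[P]_w Y w)%R.
Proof.
move=> aX aY ind; have [mX _] := aX; have [mY _] := aY.
pose X' : {mfun Omega >-> measurableTypeR R} := HB.pack (X : Omega -> measurableTypeR R)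
    (isMeasurableFun.Build _ _ _ (measurableTypeR R) X mX).
pose Y' : {mfun Omega >-> measurableTypeR R} := HB.pack (Y : Omega -> measurableTypeR R)
    (isMeasurableFun.Build _ _ _ (measurableTypeR R) Y mY).
have mXY : measurable_fun setT (fun w => (X w, Y w) : measurableTypeR R * measurableTypeR R).
  exact: measurable_fun_pair.
pose XY : {mfun Omega >-> (measurableTypeR R * measurableTypeR R)%type} :=
  HB.pack (fun w => (X w, Y w) : measurableTypeR R * measurableTypeR R)
    (isMeasurableFun.Build _ _ _ _ _ mXY).
(* Independence is the product formula on rectangles, which identifies the joint law with the
   product of the marginals; Fubini's theorem then splits the integral. *)
have prodE := @product_measure_unique _ _ _ _ R (distribution P X') (distribution P Y')
  (distribution P XY) (fun U W mU mW => ind U W mU mW).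
pose f (u : measurableTypeR R * measurableTypeR R) : \bar R := (u.1 * u.2)%:E.
have mf : measurable_fun setT f.
  by apply/measurable_EFinP; apply: measurable_funM.
have iXY := all_moments_integrable (all_momentsM aX aY).
have [iX iY] := (all_moments_integrable aX, all_moments_integrable aY).
have E1 : (\int[P]_w (X w * Y w)%:E = \int[distribution P X' \x distribution P Y']_u f u)%E.
  rewrite -(integral_distribution (X := XY) mf iXY).
  by apply: eq_measure_integral => A mA _; rewrite -prodE.
have idX : (distribution P X').-integrable setT EFin.
  by apply: integrable_pushforward.
have idY : (distribution P Y').-integrable setT EFin.
  by apply: integrable_pushforward.
have EX : (\int[distribution P X']_x x%:E = \int[P]_w (X w)%:E)%E.
  by rewrite (integral_distribution (X := X')).
have EY : (\int[distribution P Y']_x x%:E = \int[P]_w (Y w)%:E)%E.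
  by rewrite (integral_distribution (X := Y')).
have intf : (distribution P X' \x distribution P Y')%E.-integrable setT f.
  apply/integrable12ltyP => //.
  have Hx (x : R) : (\int[distribution P Y']_y `|f (x, y)| =
      `|x|%:E * \int[distribution P Y']_y `|y|%:E)%E.
    rewrite -ge0_integralZl//.
    - by apply: eq_integral => y _; rewrite /f /= normrM EFinM.
    - by apply/measurable_EFinP; exact: normr_measurable.
  under eq_integral do rewrite Hx.
  rewrite /= ge0_integralZr//.
  - by rewrite lte_mul_pinfty ?integral_ge0// ?ge0_fin_numE ?integral_ge0//;
      [case/integrableP : idX|case/integrableP : idY].
  - by apply/measurable_EFinP; exact: normr_measurable.
  - by apply: integral_ge0.
rewrite /Rintegral E1 -(integral12_prod_meas1 intf) /fubini_F /f /=.
under eq_integral.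
  move=> x _; under eq_integral do rewrite EFinM.
  rewrite integralZl// EY; over.
rewrite /= -fineM ?integrable_fin_num//.
have -> : (\int[P]_w (Y w)%:E)%E = (fine (\int[P]_w (Y w)%:E)%E)%:E.
  by rewrite fineK// integrable_fin_num.
by rewrite integralZr// EX.
Qed.

End Moments.

(** * Brownian increments *)

Section MeasurableWrt.
Context {R : realType} {dO : measure_display} {Omega : measurableType dO}.
Implicit Types (G H : set (set Omega)) (X Y : Omega -> R).

Lemma measurable_wrt_sub G H X : G `<=` H -> measurable_wrt G X -> measurable_wrt H X.
Proof. by move=> GH mX _ U mU; apply: (sub_sigma_algebra2 GH); exact: mX. Qed.

Lemma measurable_wrt_measurable G X : G `<=` measurable ->
  measurable_wrt G X -> measurable_fun setT X.
Proof.
move=> GH mX _ U mU; have := mX measurableT _ mU.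
apply: smallest_sub; last exact: GH.
exact: sigma_algebra_measurable.
Qed.

Lemma measurable_wrt_preimage G X (U : set R) : sigma_algebra setT G ->
  measurable_wrt G X -> measurable U -> G (X @^-1` U).
Proof.
move=> sG mX mU; have := mX measurableT _ mU.
by rewrite setTI /= => H; rewrite -(sigma_algebra_id sG).
Qed.

Lemma measurable_wrt_gen G X :
  (forall U, measurable U -> G (X @^-1` U)) -> measurable_wrt G X.
Proof. by move=> H _ U mU; rewrite setTI; apply: sub_sigma_algebra; exact: H. Qed.

End MeasurableWrt.

Section BrownianIncrements.
Context {R : realType} {dO : measure_display} {Omega : measurableType dO}.
Context (P : probability Omega R) (T : R) (d : nat).
Context (B : R -> Omega -> 'rV[R]_d).
Local Notation F := (brownian_filtration P B).
Hypothesis hB : is_brownian_motion P T B.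
Hypothesis P_complete : measure_is_complete P.

Lemma filtration_sigma t : sigma_algebra setT (F t).
Proof. exact: smallest_sigma_algebra. Qed.

Lemma filtrationS s t : s <= t -> F s `<=` F t.
Proof.
move=> st; apply: sub_sigma_algebra2; apply: setSU => A [u /= us H].
by exists u => //=; move: us; rewrite !in_itv/= => /andP[-> /le_trans ->].
Qed.

Lemma filtration_negligible t : P.-negligible `<=` F t.
Proof. by move=> A NA; apply: sub_sigma_algebra; right. Qed.

Lemma history_measurable t : t <= T -> <<s history_generators B t >> `<=` measurable.
Proof.
move=> tT; apply: smallest_sub; first exact: sigma_algebra_measurable.
move=> A [s /= st] [i _] [U mU <-]; have [mB _ _ _ _] := hB.
apply: mB => //; move: st; rewrite in_itv/= => /andP[-> /le_trans]; exact.
Qed.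

Lemma filtration_measurable t : t <= T -> F t `<=` measurable.
Proof.
move=> tT; apply: smallest_sub; first exact: sigma_algebra_measurable.
move=> A [hA|/P_complete//].
by apply: (history_measurable tT); exact: sub_sigma_algebra.
Qed.

Lemma brownian_adapted t i : 0 <= t -> measurable_wrt (F t) (fun w => B t w 0 i).
Proof.
move=> t0; apply: measurable_wrt_gen => U mU; apply: sub_sigma_algebra; left.
exists t => /=; first by rewrite in_itv/= t0 lexx.
by exists i => //; exists U => //; rewrite setTI.
Qed.

(** Independence of increments is stated for the uncompleted history; this carries it to the
    completed filtration. The sets that admit such an approximation form a sigma-algebra containing
    both kinds of generators. *)
Lemma filtration_approx t A : F t A -> exists2 C, <<s history_generators B t >> C &
  P.-negligible (A `\` C) /\ P.-negligible (C `\` A).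
Proof.
pose G := [set A | exists2 C, <<s history_generators B t >> C &
  P.-negligible (A `\` C) /\ P.-negligible (C `\` A)].
suff : F t `<=` G by apply.
apply: smallest_sub.
  split.
  - exists set0; first exact: sigma_algebra0.
    by rewrite setD0; split; exact: negligible_set0.
  - move=> D [C hC [N1 N2]]; exists (~` C).
      by rewrite -setTD; exact: sigma_algebraCD.
    rewrite setTD; split.
      by apply: negligibleS N2 => w [/= ? /contrapT].
    by apply: negligibleS N1 => w [/= ? /contrapT].
  - move=> D HD; have {HD}/choice[C HC] : forall n, exists C,
      <<s history_generators B t >> C /\
      (P.-negligible (D n `\` C) /\ P.-negligible (C `\` D n)).
      by move=> n; have [C ? ?] := HD n; exists C.
    exists (\bigcup_n C n); first by apply: sigma_algebra_bigcup => n; case: (HC n).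
    split.
      have sub : \bigcup_k D k `\` \bigcup_n C n `<=` \bigcup_n (D n `\` C n).
        move=> w [[n _ Dn] nC]; exists n => //; split => // Cn.
        by apply: nC; exists n.
      apply: (negligibleS sub).
      by apply: negligible_bigcup => n; case: (HC n) => _ [].
    have sub : \bigcup_n C n `\` \bigcup_k D k `<=` \bigcup_n (C n `\` D n).
      move=> w [[n _ Dn] nC]; exists n => //; split => // Cn.
      by apply: nC; exists n.
    apply: (negligibleS sub).
    by apply: negligible_bigcup => n; case: (HC n) => _ [].
move=> {}A [hA|NA].
  exists A; first exact: sub_sigma_algebra.
  by rewrite setDv; split; exact: negligible_set0.
exists set0; first exact: sigma_algebra0.
by rewrite setD0 set0D; split => //; exact: negligible_set0.
Qed.

Lemma measure_eq_negligible A C : measurable A -> measurable C ->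
  P.-negligible (A `\` C) -> P.-negligible (C `\` A) -> P A = P C.
Proof.
move=> mA mC.
move=> /(negligibleP _ (measurableD mA mC)) N1 /(negligibleP _ (measurableD mC mA)) N2.
rewrite -(setUIDK A C) measureU//; last 3 first.
- exact: measurableI.
- exact: measurableD.
- by apply/seteqP; split => w // [[? ?] []].
rewrite N1 adde0 setIC -[in RHS](setUIDK C A) measureU// ?N2 ?adde0//.
- exact: measurableI.
- exact: measurableD.
- by apply/seteqP; split => w // [[? ?] []].
Qed.

Lemma measurable_increment s t i : 0 <= s -> s <= t -> t <= T ->
  measurable_fun setT (fun w => B t w 0 i - B s w 0 i).
Proof.
move=> s0 st tT; have [mB _ _ _ _] := hB.
apply: measurable_funB; apply: mB; first by rewrite (le_trans s0).
by rewrite s0 (le_trans st).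
Qed.

Local Notation incr s t := (g_sigma_preimage (fun i w => B t w 0 i - B s w 0 i)).

Lemma increment_sigma_measurable s t : 0 <= s -> s <= t -> t <= T ->
  incr s t `<=` measurable.
Proof.
move=> s0 st tT; apply: smallest_sub; first exact: sigma_algebra_measurable.
apply: (big_ind (fun S => S `<=` measurable)).
- by [].
- by move=> X Y HX HY A [/HX|/HY].
- by move=> i _ A [U mU <-]; apply: measurable_increment.
Qed.

Lemma increment_wrt s t i : measurable_wrt (incr s t) (fun w => B t w 0 i - B s w 0 i).
Proof.
apply: measurable_wrt_gen => U mU; apply: sub_sigma_algebra.
rewrite -bigcup_mkord_ord || rewrite -bigcup_seq.
by exists i => //=; [rewrite mem_index_enum|exists U => //; rewrite setTI].
Qed.

Lemma increment_indep s t A C : 0 <= s -> s < t -> t <= T ->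
  F s A -> incr s t C -> P (A `&` C) = (P A * P C)%E.
Proof.
move=> s0 st tT FA iC; have [_ _ _ ind _] := hB.
have [A' hA' [N1 N2]] := filtration_approx FA.
have sT : s <= T by rewrite (le_trans (ltW st)).
have mA := filtration_measurable sT FA.
have mA' := history_measurable sT hA'.
have mC : measurable C by apply: (increment_sigma_measurable s0 (ltW st) tT).
rewrite (measure_eq_negligible mA mA')// -(ind s t s0 st tT _ _ hA' iC).
apply: measure_eq_negligible; try exact: measurableI.
- by apply: negligibleS N1 => w [[? ?] h]; split => // ?; apply: h.
- by apply: negligibleS N2 => w [[? ?] h]; split => // ?; apply: h.
Qed.

Lemma Rintegral_mul_increment s t (X D : Omega -> R) : 0 <= s -> s < t -> t <= T ->
  measurable_wrt (F s) X -> measurable_wrt (incr s t) D ->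
  all_moments P X -> all_moments P D ->
  (\int[P]_w (X w * D w))%R = (\int[P]_w X w)%R * (\int[P]_w D w)%R.
Proof.
move=> s0 st tT mX mD aX aD; apply: indep_Rintegral_mul => // U W mU mW.
apply: (@increment_indep s t) => //.
- exact: measurable_wrt_preimage (filtration_sigma s) mX mU.
- by apply: measurable_wrt_preimage mW => //; exact: smallest_sigma_algebra.
Qed.

Lemma increment_law s t i (U : set R) : 0 <= s -> s < t -> t <= T -> measurable U ->
  P ((fun w => B t w 0 i - B s w 0 i) @^-1` U) = normal_prob 0 (Num.sqrt (t - s)) U.
Proof.
move=> s0 st tT mU; have [_ _ _ _ law] := hB.
have := law s t s0 st tT (fun j => if j == i then U else setT).
have m j : measurable (if j == i then U else setT) by case: ifP.
move=> /(_ m); rewrite (bigD1 i)//= eqxx big1 ?mule1; last first.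
  by move=> j /negbTE ->; rewrite probability_setT.
move=> <-; congr (P _); apply/seteqP; split => w /=.
- by move=> Uw j; case: ifPn => // /eqP ->.
- by move=> /(_ i); rewrite eqxx.
Qed.

Lemma increment_law2 s t i j (U W : set R) : 0 <= s -> s < t -> t <= T -> i != j ->
  measurable U -> measurable W ->
  P ((fun w => B t w 0 i - B s w 0 i) @^-1` U `&`
     (fun w => B t w 0 j - B s w 0 j) @^-1` W) =
  (P ((fun w => B t w 0%R i - B s w 0%R i)%R @^-1` U) *
   P ((fun w => B t w 0%R j - B s w 0%R j)%R @^-1` W))%E.
Proof.
move=> s0 st tT ij mU mW; rewrite !increment_law//; have [_ _ _ _ law] := hB.
have := law s t s0 st tT (fun k => if k == i then U else if k == j then W else setT).
have m k : measurable (if k == i then U else if k == j then W else setT).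
  by do 2 case: ifP => // _.
move=> /(_ m); rewrite (bigD1 i)//= eqxx (bigD1 j)/=; last by rewrite eq_sym.
rewrite eq_sym (negbTE ij) eqxx big1 ?mule1; last first.
  by move=> k /andP[/negbTE -> /negbTE ->]; rewrite probability_setT.
move=> <-; congr (P _); apply/seteqP; split => w /=.
- move=> [Uw Ww] k; case: ifPn => [/eqP -> //|ki]; case: ifPn => // /eqP -> //.
- move=> H; split; first by have := H i; rewrite eqxx.
  by have := H j; rewrite eq_sym (negbTE ij) eqxx.
Qed.

Lemma increment_all_moments s t i : 0 <= s -> s <= t -> t <= T ->
  all_moments P (fun w => B t w 0 i - B s w 0 i).
Proof.
move=> s0; rewrite le_eqVlt => /predU1P[->|st] tT.
  under eq_fun do rewrite subrr; exact: all_moments_cst.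
have st0 : 0 < Num.sqrt (t - s) by rewrite sqrtr_gt0 subr_gt0.
have law (U : set R) : measurable U ->
    P ((fun w => B t w 0 i - B s w 0 i) @^-1` U) = normal_prob 0 (Num.sqrt (t - s)) U.
  by move=> mU; apply: increment_law.
by have [] := all_moments_normal st0 (measurable_increment i s0 (ltW st) tT) law.
Qed.

Lemma increment_mean_variance s t i : 0 <= s -> s < t -> t <= T ->
  (\int[P]_w (B t w 0 i - B s w 0 i))%R = 0 /\
  (\int[P]_w ((B t w 0 i - B s w 0 i) ^+ 2))%R = t - s.
Proof.
move=> s0 st tT.
have st0 : 0 < Num.sqrt (t - s) by rewrite sqrtr_gt0 subr_gt0.
have law (U : set R) : measurable U ->
    P ((fun w => B t w 0 i - B s w 0 i) @^-1` U) = normal_prob 0 (Num.sqrt (t - s)) U.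
  by move=> mU; apply: increment_law.
have [-> ->] := normal_mean_variance st0 (measurable_increment i s0 (ltW st) tT) law.
by rewrite sqr_sqrtr ?subr_ge0 ?(ltW st).
Qed.

(** Testing against every weight X measurable for [F s] stands in for conditioning on [F s]; the
    discrete computations never form a conditional expectation. Equal times are allowed because
    grids may repeat points. *)
Lemma Rintegral_increment s t i (X : Omega -> R) : 0 <= s -> s <= t -> t <= T ->
  measurable_wrt (F s) X -> all_moments P X ->
  (\int[P]_w (X w * (B t w 0 i - B s w 0 i)))%R = 0.
Proof.
move=> s0; rewrite le_eqVlt => /predU1P[->|st] tT mX aX.
  under eq_Rintegral do rewrite subrr mulr0; exact: Rintegral_cst_prob.
have aD := increment_all_moments i s0 (ltW st) tT.
rewrite (Rintegral_mul_increment s0 st tT mX (@increment_wrt s t i) aX aD).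
by have [-> _] := increment_mean_variance i s0 st tT; rewrite mulr0.
Qed.

Lemma Rintegral_increment2 s t i j (X : Omega -> R) : 0 <= s -> s <= t -> t <= T ->
  measurable_wrt (F s) X -> all_moments P X ->
  (\int[P]_w (X w * ((B t w 0 i - B s w 0 i) * (B t w 0 j - B s w 0 j))))%R =
  (\int[P]_w X w)%R * ((t - s) *+ (i == j)).
Proof.
move=> s0; rewrite le_eqVlt => /predU1P[->|st] tT mX aX.
  under eq_Rintegral do rewrite !subrr !mulr0.
  by rewrite Rintegral_cst_prob subrr mul0rn mulr0.
have aD k := increment_all_moments k s0 (ltW st) tT.
have mDD : measurable_wrt (incr s t)
    (fun w => (B t w 0 i - B s w 0 i) * (B t w 0 j - B s w 0 j)).
  by apply: measurable_funM; exact: increment_wrt.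
rewrite (Rintegral_mul_increment s0 st tT mX mDD aX (all_momentsM (aD i) (aD j))).
congr (_ * _); have [->|ij] := eqVneq i j.
  by have [_] := increment_mean_variance j s0 st tT.
rewrite (indep_Rintegral_mul (aD i) (aD j)); last first.
  by move=> U W mU mW; exact: increment_law2.
by have [-> _] := increment_mean_variance i s0 st tT; rewrite mul0r mulr0n.
Qed.

Lemma Rintegral_increment_abs q : 0 < q -> exists2 C, 0 <= C &
  forall s t i (X : Omega -> R), 0 <= s -> s <= t -> t <= T ->
  measurable_wrt (F s) X -> all_moments P X -> (forall w, 0 <= X w) ->
  (\int[P]_w (X w * `|B t w 0 i - B s w 0 i| `^ q))%R <=
  C * (t - s) `^ (q / 2) * (\int[P]_w X w)%R.
Proof.
move=> q0; exists (q `^ q * (2 * expR 1)); first by rewrite !mulr_ge0 ?powR_ge0 ?expR_ge0.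
move=> s t i X s0; rewrite le_eqVlt => /predU1P[->|st] tT mX aX X0.
  under eq_Rintegral do rewrite subrr normr0 powR0 ?gt_eqF// mulr0.
  rewrite Rintegral_cst_prob subrr !mulr_ge0 ?powR_ge0 ?expR_ge0//.
  exact: Rintegral_ge0.
have st0 : 0 < Num.sqrt (t - s) by rewrite sqrtr_gt0 subr_gt0.
have aD := increment_all_moments i s0 (ltW st) tT.
have aDq := all_moments_powR (ltW q0) (fun w => normr_ge0 _) (all_moments_norm aD).
have mDq : measurable_wrt (incr s t) (fun w => `|B t w 0 i - B s w 0 i| `^ q).
  apply: (measurableT_comp (measurable_powR _)) => //.
  by apply: measurableT_comp => //; exact: increment_wrt.
rewrite (Rintegral_mul_increment s0 st tT mX mDq aX aDq) mulrC.
rewrite ler_wpM2r ?Rintegral_ge0//.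
have -> : (t - s) `^ (q / 2) = Num.sqrt (t - s) `^ q.
  by rewrite -powR12_sqrt ?subr_ge0 ?(ltW st)// -powRrM mulrC.
apply: normal_abs_moment => //; first exact: measurable_increment (ltW st) _.
by move=> U mU; apply: increment_law.
Qed.

End BrownianIncrements.

(** * Discrete stochastic integrals *)

Section AdaptedMoments.
Context {R : realType} {dO : measure_display} {Omega : measurableType dO}.
Context (P : probability Omega R).
Implicit Types (G H : set (set Omega)) (X Y : Omega -> R).

Definition adapted_moments G X := measurable_wrt G X /\ all_moments P X.

Lemma adm_sub G H X : G `<=` H -> adapted_moments G X -> adapted_moments H X.
Proof. by move=> GH [mX aX]; split => //; exact: measurable_wrt_sub mX. Qed.

Lemma adm_cst G (c : R) : adapted_moments G (fun=> c).
Proof. by split; [exact: measurable_cst|exact: all_moments_cst]. Qed.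

Lemma admD G X Y : adapted_moments G X -> adapted_moments G Y ->
  adapted_moments G (fun w => X w + Y w).
Proof.
by move=> [? ?] [? ?]; split; [exact: measurable_funD|exact: all_momentsD].
Qed.

Lemma admM G X Y : adapted_moments G X -> adapted_moments G Y ->
  adapted_moments G (fun w => X w * Y w).
Proof.
by move=> [? ?] [? ?]; split; [exact: measurable_funM|exact: all_momentsM].
Qed.

Lemma admZ G (c : R) X : adapted_moments G X -> adapted_moments G (fun w => c * X w).
Proof. by move=> aX; apply: admM => //; exact: adm_cst. Qed.

Lemma admB G X Y : adapted_moments G X -> adapted_moments G Y ->
  adapted_moments G (fun w => X w - Y w).
Proof.
move=> aX aY; apply: admD => //.
by under eq_fun do rewrite -mulN1r; exact: admZ.
Qed.

Lemma adm_norm G X : adapted_moments G X -> adapted_moments G (fun w => `|X w|).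
Proof.
by move=> [mX aX]; split; [exact: measurableT_comp|exact: all_moments_norm].
Qed.

Lemma adm_sum G (I : Type) (r : seq I) (Q : pred I) (X : I -> Omega -> R) :
  (forall i, Q i -> adapted_moments G (X i)) ->
  adapted_moments G (fun w => \sum_(i <- r | Q i) X i w).
Proof.
move=> H; elim: r => [|i r IH].
  by under eq_fun do rewrite big_nil; exact: adm_cst.
under eq_fun do rewrite big_cons.
by case Qi : (Q i) => //; apply: admD => //; exact: H.
Qed.

Lemma adm_powR G X q : 0 <= q -> (forall w, 0 <= X w) -> adapted_moments G X ->
  adapted_moments G (fun w => X w `^ q).
Proof.
move=> q0 X0 [mX aX]; split; last exact: all_moments_powR.
exact: (measurableT_comp (measurable_powR _)).
Qed.

(** The lower bound 1 keeps negative powers bounded; it is the reason for the shift 1 + [disc_quad]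
    in the Burkholder estimates. *)
Lemma adm_powRN G X q : q <= 0 -> (forall w, 1 <= X w) -> G `<=` measurable ->
  adapted_moments G X -> adapted_moments G (fun w => X w `^ q).
Proof.
move=> q0 X0 Gm [mX aX].
have m : measurable_wrt G (fun w => X w `^ q) by exact: (measurableT_comp (measurable_powR _)).
split => //; apply: (@all_moments_bounded _ _ _ _ _ 1).
  exact: measurable_wrt_measurable m.
move=> w; rewrite ger0_norm ?powR_ge0//.
by have := powR_antimono q0 ltr01 (X0 w); rewrite powR1.
Qed.

Lemma adm_sqrt G X : (forall w, 0 <= X w) -> adapted_moments G X ->
  adapted_moments G (fun w => Num.sqrt (X w)).
Proof.
move=> X0 aX; have -> : (fun w => Num.sqrt (X w)) = (fun w => X w `^ 2^-1).
  by apply/funext => w; rewrite powR12_sqrt.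
exact: adm_powR.
Qed.

Lemma adm_int G X : adapted_moments G X -> P.-integrable setT (EFin \o X).
Proof. by move=> [_ aX]; exact: all_moments_integrable. Qed.

End AdaptedMoments.

(** The sum is bounded by the number of terms times the largest one. The summand [(q == 0)%:R]
    covers the empty sum, since zero to the power zero is 1. *)
Lemma powR_sum_le {R : realType} (d : nat) (a : 'I_d -> R) (q : R) : 0 <= q ->
  (forall i, 0 <= a i) -> (\sum_i a i) `^ q <= (d.+1%:R `^ q) * \sum_i a i `^ q + (q == 0)%:R.
Proof.
move=> q0 a0; have [->|qn0] := eqVneq q 0.
  by rewrite powRr0 lerDr mulr_ge0 ?powR_ge0// sumr_ge0// => i _; rewrite powR_ge0.
rewrite addr0.
have S0 : 0 <= \sum_i a i by rewrite sumr_ge0.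
case: d a a0 S0 => [|d] a a0 S0; first by rewrite !big_ord0 mulr0 powR0.
have [j _ jP] := @arg_maxP _ R _ (ord0 : 'I_d.+1) xpredT a isT.
have H1 : \sum_i a i <= d.+2%:R * a j.
  apply: (@le_trans _ _ (d.+1%:R * a j)); last by rewrite ler_wpM2r// ler_nat.
  have := @ler_sum R _ (index_enum 'I_d.+1) xpredT a (fun=> a j) (fun i _ => jP i isT).
  by rewrite sumr_const card_ord mulr_natl.
apply: (le_trans (le_powR2r q0 S0 H1)).
rewrite powRM ?ler0n// ler_wpM2l ?powR_ge0// (bigD1 j)//= lerDl sumr_ge0//.
by move=> i _; rewrite powR_ge0.
Qed.

Section DiscreteIntegral.
Context {R : realType} {dO : measure_display} {Omega : measurableType dO} {d : nat}.
Context (B : R -> Omega -> 'rV[R]_d) (u : nat -> R) (h : nat -> Omega -> 'rV[R]_d).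

Definition disc_incr (k : nat) (w : Omega) : R :=
  \sum_(i < d) h k w 0 i * (B (u k.+1) w 0 i - B (u k) w 0 i).

Definition disc_int (n : nat) (w : Omega) : R := \sum_(k < n) disc_incr k w.

Definition disc_dquad (k : nat) (w : Omega) : R :=
  enorm (h k w) ^+ 2 * (u k.+1 - u k).

Definition disc_quad (n : nat) (w : Omega) : R := \sum_(k < n) disc_dquad k w.

End DiscreteIntegral.

Lemma enorm_sqr {R : realType} (d : nat) (z : 'rV[R]_d) :
  enorm z ^+ 2 = \sum_i z 0 i ^+ 2.
Proof. by rewrite /enorm sqr_sqrtr// sumr_ge0// => i _; rewrite sqr_ge0. Qed.

Lemma enorm_ge0 {R : realType} (d : nat) (z : 'rV[R]_d) : 0 <= enorm z.
Proof. exact: sqrtr_ge0. Qed.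

Lemma enorm_coord {R : realType} (d : nat) (z : 'rV[R]_d) i : `|z 0 i| <= enorm z.
Proof.
rewrite -ler_sqr ?nnegrE ?enorm_ge0// real_normK ?num_real// enorm_sqr.
by rewrite (bigD1 i)//= lerDl sumr_ge0// => j _; rewrite sqr_ge0.
Qed.

Section DiscreteMartingale.
Context {R : realType} {dO : measure_display} {Omega : measurableType dO}.
Context (P : probability Omega R) (T : R) (d : nat) (B : R -> Omega -> 'rV[R]_d).
Local Notation F := (brownian_filtration P B).
Hypothesis hB : is_brownian_motion P T B.
Hypothesis P_complete : measure_is_complete P.

(** The grid is an infinite nondecreasing sequence with repetitions allowed: a finite grid becomes
    constant at T, where increments vanish. Bounded coefficients against Gaussian increments have
    all moments. *)
Definition disc_admissible (u : nat -> R) (h : nat -> Omega -> 'rV[R]_d) :=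
  [/\ forall k, 0 <= u k <= T, forall k, u k <= u k.+1,
      forall k i, measurable_wrt (F (u k)) (fun w => h k w 0 i) &
      forall k, exists C, forall i w, `|h k w 0 i| <= C].

Section Fixed.
Context (u : nat -> R) (h : nat -> Omega -> 'rV[R]_d).
Hypothesis adm : disc_admissible u h.
Local Notation dM := (disc_incr B u h).
Local Notation M := (disc_int B u h).
Local Notation dA := (disc_dquad u h).
Local Notation A := (disc_quad u h).

Lemma grid_ge0 k : 0 <= u k. Proof. by have [/(_ k)/andP[]] := adm. Qed.
Lemma grid_le k : u k <= T. Proof. by have [/(_ k)/andP[]] := adm. Qed.
Lemma grid_mono j k : (j <= k)%N -> u j <= u k.
Proof. apply: (@homo_leq _ u (fun x y => x <= y)) => //; first exact: le_trans.
by case: adm. Qed.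
Lemma grid_step_ge0 k : 0 <= u k.+1 - u k.
Proof. by rewrite subr_ge0 grid_mono. Qed.
Lemma grid_measurable k : F (u k) `<=` measurable.
Proof. exact: (filtration_measurable hB P_complete (grid_le k)). Qed.

Lemma disc_coef_adm k i : adapted_moments P (F (u k)) (fun w => h k w 0 i).
Proof.
have [_ _ mh bh] := adm; split; first exact: mh.
have [C HC] := bh k; apply: (@all_moments_bounded _ _ _ _ _ C) => //.
exact: measurable_wrt_measurable (@grid_measurable k) (mh k i).
Qed.

Lemma disc_incr_adm k : adapted_moments P (F (u k.+1)) (dM k).
Proof.
apply: adm_sum => i _; apply: admM.
  by apply: adm_sub (disc_coef_adm k i); apply: filtrationS; exact: grid_mono.
split; last by apply: (increment_all_moments hB); rewrite ?grid_ge0 ?grid_mono ?grid_le.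
apply: measurable_funB; first by apply: brownian_adapted; exact: grid_ge0.
apply: (measurable_wrt_sub (@filtrationS _ _ _ P _ B (u k) _ _)); first exact: grid_mono.
by apply: brownian_adapted; exact: grid_ge0.
Qed.

Lemma disc_int_adm n : adapted_moments P (F (u n)) (M n).
Proof.
apply: adm_sum => -[k kn] _; apply: adm_sub (disc_incr_adm k).
by apply: filtrationS; exact: grid_mono.
Qed.

Lemma disc_dquad_ge0 k w : 0 <= dA k w.
Proof. by rewrite mulr_ge0 ?sqr_ge0 ?grid_step_ge0. Qed.

Lemma disc_quad_ge0 n w : 0 <= A n w.
Proof. by rewrite sumr_ge0// => k _; exact: disc_dquad_ge0. Qed.

Lemma disc_dquad_adm k : adapted_moments P (F (u k)) (dA k).
Proof.
apply: admM; last exact: adm_cst.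
under eq_fun do rewrite enorm_sqr.
by apply: adm_sum => i _; apply: admM; exact: disc_coef_adm.
Qed.

Lemma disc_quad_adm n : adapted_moments P (F (u n)) (A n).
Proof.
apply: adm_sum => -[k kn] _; apply: adm_sub (disc_dquad_adm k).
by apply: filtrationS; apply: grid_mono; exact: ltnW.
Qed.

Lemma disc_intS n w : M n.+1 w = M n w + dM n w.
Proof. by rewrite /disc_int big_ord_recr. Qed.

Lemma disc_quadS n w : A n.+1 w = A n w + dA n w.
Proof. by rewrite /disc_quad big_ord_recr. Qed.

Lemma Rintegral_disc_incr n X : adapted_moments P (F (u n)) X ->
  (\int[P]_w (X w * dM n w))%R = 0.
Proof.
move=> aX.
have aXh i : adapted_moments P (F (u n)) (fun w => X w * h n w 0 i).
  by apply: admM => //; exact: disc_coef_adm.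
have E i : (\int[P]_w (X w * h n w 0 i * (B (u n.+1) w 0 i - B (u n) w 0 i)))%R = 0.
  have [mX aX'] := aXh i.
  by apply: (Rintegral_increment hB); rewrite ?grid_ge0 ?grid_mono ?grid_le.
have iE i : P.-integrable setT (EFin \o (fun w => X w * h n w 0 i * (B (u n.+1) w 0 i - B (u n) w 0 i))).
  apply: all_moments_integrable; apply: all_momentsM; first by case: (aXh i).
  by apply: (increment_all_moments hB); rewrite ?grid_ge0 ?grid_mono ?grid_le.
rewrite /Rintegral /disc_incr.
under eq_integral do rewrite mulr_sumr -sumEFin.
rewrite integral_sum//=; last by move=> i; under eq_fun do rewrite mulrA; exact: iE.
rewrite big1//= => i _; under eq_integral do rewrite mulrA.
by rewrite -[LHS]fineK ?integrable_fin_num//; [rewrite -/(Rintegral _ _ _) E|exact: iE].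
Qed.

(** Distinct coordinates of a Brownian increment are independent and centred, so only the diagonal
    terms of the squared sum survive. *)
Lemma Rintegral_disc_incr2 n X : adapted_moments P (F (u n)) X ->
  (\int[P]_w (X w * dM n w ^+ 2))%R = (\int[P]_w (X w * dA n w))%R.
Proof.
move=> aX.
have aXh i j : adapted_moments P (F (u n)) (fun w => X w * (h n w 0 i * h n w 0 j)).
  by apply: admM => //; apply: admM; exact: disc_coef_adm.
pose D i w := B (u n.+1) w 0 i - B (u n) w 0 i.
have aD i : all_moments P (D i).
  by apply: (increment_all_moments hB); rewrite ?grid_ge0 ?grid_mono ?grid_le.
pose f (ij : 'I_d * 'I_d) w := X w * (h n w 0 ij.1 * h n w 0 ij.2) * (D ij.1 w * D ij.2 w).
have E ij : (\int[P]_w f ij w)%R =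
    (\int[P]_w ((u n.+1 - u n) *+ (ij.1 == ij.2) * (X w * (h n w 0 ij.1 * h n w 0 ij.2))))%R.
  have [mX aX'] := aXh ij.1 ij.2.
  rewrite /f (Rintegral_increment2 hB _ _ _ _ _ _ mX aX') ?grid_ge0 ?grid_mono ?grid_le//.
  by rewrite RintegralZl// 1?mulrC//; exact: all_moments_integrable.
have if_ ij : P.-integrable setT (EFin \o f ij).
  apply: all_moments_integrable; apply: all_momentsM; first by case: (aXh ij.1 ij.2).
  exact: all_momentsM.
have ig ij : P.-integrable setT (EFin \o (fun w => (u n.+1 - u n) *+ (ij.1 == ij.2) *
     (X w * (h n w 0 ij.1 * h n w 0 ij.2)))).
  by apply: integrable_RZl; apply: (adm_int (aXh ij.1 ij.2)).
rewrite /Rintegral.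
have -> : (\int[P]_w (X w * dM n w ^+ 2)%:E = \int[P]_w (\sum_ij (f ij w)%:E))%E.
  apply: eq_integral => w _; rewrite sumEFin; congr EFin.
  rewrite expr2 /disc_incr mulr_suml mulr_sumr /f -(pair_bigA _ (fun i j =>
    X w * (h n w 0 i * h n w 0 j) * (D i w * D j w)))/=.
  apply: eq_bigr => i _; rewrite mulr_sumr mulr_sumr; apply: eq_bigr => j _.
  rewrite /D; ring.
have -> : (\int[P]_w (X w * dA n w)%:E = \int[P]_w (\sum_ij ((u n.+1 - u n) *+ (ij.1 == ij.2) *
     (X w * (h n w 0 ij.1 * h n w 0 ij.2)))%:E))%E.
  apply: eq_integral => w _; rewrite sumEFin; congr EFin.
  rewrite /disc_dquad enorm_sqr -(pair_bigA _ (fun i j : 'I_d => (u n.+1 - u n) *+ (i == j) *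
     (X w * (h n w 0 i * h n w 0 j))))/= mulr_suml mulr_sumr.
  apply: eq_bigr => i _; rewrite (bigD1 i)//= eqxx big1 ?addr0.
    by rewrite mulr1n; ring.
  by move=> j; rewrite eq_sym => /negbTE ->; rewrite mulr0n mul0r.
rewrite !integral_sum//=; congr fine; apply: eq_bigr => ij _.
have /(congr1 (@EFin R)) := E ij; rewrite /Rintegral.
by rewrite !fineK//; apply: integrable_fin_num => //; [exact: ig|exact: if_].
Qed.

End Fixed.

(** This controls the |y|^p part of the Taylor error when p >= 2. From |sum h_i D_i| <= |h| sum
    |D_i| the estimate reduces to absolute moments of the Gaussian coordinates. *)
Lemma Rintegral_disc_incr_abs q : 0 < q -> exists2 C, 0 <= C &
  forall u h, disc_admissible u h ->
  forall n X, adapted_moments P (F (u n)) X -> (forall w, 0 <= X w) ->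
  (\int[P]_w (X w * `|disc_incr B u h n w| `^ q))%R <=
  C * (\int[P]_w (X w * disc_dquad u h n w `^ (q / 2)))%R.
Proof.
move=> q0; have [C C0 HC] := Rintegral_increment_abs hB P_complete q0.
exists (d.+1%:R `^ q * \sum_(i < d) C).
  by rewrite mulr_ge0 ?powR_ge0// sumr_ge0.
move=> u h adm n X aX X0.
pose D i w := B (u n.+1) w 0 i - B (u n) w 0 i.
have aD i : all_moments P (D i).
  by apply: (increment_all_moments hB); rewrite ?(grid_ge0 adm) ?(grid_mono adm) ?(grid_le adm).
have aDq i : all_moments P (fun w => `|D i w| `^ q).
  by apply: all_moments_powR; [exact: ltW| |exact: all_moments_norm].
have ae : adapted_moments P (F (u n)) (fun w => X w * enorm (h n w) `^ q).
  apply: admM => //; apply: adm_powR; [exact: ltW|by move=> w; exact: enorm_ge0|].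
  apply: adm_sqrt; first by move=> w; rewrite sumr_ge0// => i _; rewrite sqr_ge0.
  by apply: adm_sum => i _; apply: admM; exact: disc_coef_adm.
have [mXe aXe] := ae.
have Xe0 w : 0 <= X w * enorm (h n w) `^ q by rewrite mulr_ge0 ?powR_ge0.
have aT i : all_moments P (fun w => (X w * enorm (h n w) `^ q) * `|D i w| `^ q).
  exact: all_momentsM.
have aS : all_moments P (fun w => \sum_i ((X w * enorm (h n w) `^ q) * `|D i w| `^ q)).
  exact: all_moments_sum.
have qq : (q == 0) = false by rewrite gt_eqF.
apply: (@le_trans _ _ (\int[P]_w (d.+1%:R `^ q * \sum_i ((X w * enorm (h n w) `^ q) * `|D i w| `^ q)))%R).
  apply: le_Rintegral => //.
  - apply: all_moments_integrable; apply: all_momentsM; first by case: aX.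
    apply: all_moments_powR; [exact: ltW|by []|].
    by apply: all_moments_norm; case: (disc_incr_adm adm n).
  - exact: integrable_RZl (all_moments_integrable aS).
  - move=> w _; rewrite -mulr_sumr.
    rewrite [leRHS](_ : _ = X w * (enorm (h n w) `^ q * (d.+1%:R `^ q * \sum_i `|D i w| `^ q))); last by ring.
    rewrite ler_wpM2l//.
    have H : `|disc_incr B u h n w| <= enorm (h n w) * \sum_i `|D i w|.
      apply: (le_trans (ler_norm_sum _ _ _)); rewrite mulr_sumr.
      by apply: ler_sum => i _; rewrite normrM ler_wpM2r// enorm_coord.
    apply: (le_trans (le_powR2r (ltW q0) (normr_ge0 _) H)).
    rewrite powRM ?enorm_ge0//; last by rewrite sumr_ge0.
    rewrite ler_wpM2l ?powR_ge0//.
    by have := powR_sum_le (ltW q0) (fun i => normr_ge0 (D i w)); rewrite qq addr0.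
rewrite RintegralZl//; last exact: all_moments_integrable.
rewrite -mulrA ler_wpM2l ?powR_ge0//.
have -> : (\int[P]_w (\sum_i ((X w * enorm (h n w) `^ q) * `|D i w| `^ q)))%R =
    \sum_i (\int[P]_w ((X w * enorm (h n w) `^ q) * `|D i w| `^ q))%R.
  rewrite /Rintegral; under eq_integral do rewrite -sumEFin.
  rewrite integral_sum//=; last by move=> i; exact: all_moments_integrable.
  rewrite sum_fine// => i _.
  by apply: integrable_fin_num => //; exact: all_moments_integrable.
rewrite mulr_suml; apply: ler_sum => i _.
have := HC (u n) (u n.+1) i _ (grid_ge0 adm n) (grid_mono adm (leqnSn n)) (grid_le adm n.+1) mXe aXe Xe0.
move=> /le_trans; apply; rewrite -mulrA ler_wpM2l//.
rewrite -RintegralZl//; last exact: all_moments_integrable.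
rewrite le_eqVlt; apply/orP; left; apply/eqP; apply: eq_Rintegral => w _.
rewrite /disc_dquad powRM ?sqr_ge0 ?(grid_step_ge0 adm)//.
have -> : (enorm (h n w) ^+ 2) `^ (q / 2) = enorm (h n w) `^ q.
  by rewrite -powR_mulrn ?enorm_ge0// -powRrM; congr powR; field.
ring.
Qed.

Lemma disc_martingale u h : disc_admissible u h -> forall j n X, (j <= n)%N ->
  adapted_moments P (F (u j)) X ->
  (\int[P]_w (X w * disc_int B u h n w))%R = (\int[P]_w (X w * disc_int B u h j w))%R.
Proof.
move=> adm j n X; elim: n => [|n IH]; first by rewrite leqn0 => /eqP ->.
rewrite leq_eqVlt => /predU1P[->//|]; rewrite ltnS => jn aX; rewrite -IH//.
have aXn : adapted_moments P (F (u n)) X.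
  by apply: adm_sub aX; apply: filtrationS; exact: grid_mono adm _ _ jn.
have aXM := admM aXn (disc_int_adm adm n).
have aXd : all_moments P (fun w => X w * disc_incr B u h n w).
  by apply: all_momentsM; [case: aX|case: (disc_incr_adm adm n)].
under eq_Rintegral do rewrite disc_intS mulrDr.
rewrite RintegralD//; [|exact: (adm_int aXM)|exact: all_moments_integrable].
by rewrite (Rintegral_disc_incr adm aXn) addr0.
Qed.

Lemma disc_bracket u h : disc_admissible u h -> forall j n X, (j <= n)%N ->
  adapted_moments P (F (u j)) X ->
  (\int[P]_w (X w * (disc_int B u h n w ^+ 2 - disc_quad u h n w)))%R =
  (\int[P]_w (X w * (disc_int B u h j w ^+ 2 - disc_quad u h j w)))%R.
Proof.
move=> adm j n X; elim: n => [|n IH]; first by rewrite leqn0 => /eqP ->.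
rewrite leq_eqVlt => /predU1P[->//|]; rewrite ltnS => jn aX; rewrite -IH//.
have aXn : adapted_moments P (F (u n)) X.
  by apply: adm_sub aX; apply: filtrationS; exact: grid_mono adm _ _ jn.
have [_ aX0] := aXn.
have aM := disc_int_adm adm n.
have aXM : adapted_moments P (F (u n)) (fun w => X w * (2 * disc_int B u h n w)).
  by apply: admM => //; exact: admZ.
have aXMA : adapted_moments P (F (u n))
    (fun w => X w * (disc_int B u h n w ^+ 2 - disc_quad u h n w)).
  by apply: admM => //; apply: admB; [exact: admM|exact: disc_quad_adm].
have [_ ad] := disc_incr_adm adm n.
have aXA := admM aXn (disc_dquad_adm adm n).
have aXMd : all_moments P (fun w => X w * (2 * disc_int B u h n w) * disc_incr B u h n w).
  by apply: all_momentsM => //; case: aXM.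
have aXd2 : all_moments P (fun w => X w * disc_incr B u h n w ^+ 2).
  by apply: all_momentsM => //; exact: all_momentsM.
transitivity (\int[P]_w ((X w * (disc_int B u h n w ^+ 2 - disc_quad u h n w) +
    X w * (2 * disc_int B u h n w) * disc_incr B u h n w) +
    (X w * disc_incr B u h n w ^+ 2 - X w * disc_dquad u h n w)))%R.
  apply: eq_Rintegral => w _; rewrite disc_intS disc_quadS; ring.
have i1 := adm_int aXMA; have i2 := all_moments_integrable aXMd.
have i3 := all_moments_integrable aXd2; have i4 := adm_int aXA.
rewrite RintegralD//; last 2 first.
- exact: integrable_RD.
- have := integrable_RD i3 (integrable_RZl (-1) i4).
  by under [X in EFin \o X]eq_fun do rewrite mulN1r.
rewrite RintegralD// RintegralB//.
by rewrite (Rintegral_disc_incr adm aXM) (Rintegral_disc_incr2 adm aXn) subrr !addr0.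
Qed.

Lemma disc_bdg_small p u h : 0 < p <= 2 -> disc_admissible u h -> forall n,
  (\int[P]_w (`|disc_int B u h n w| `^ p))%R <=
  2 * (\int[P]_w ((1 + disc_quad u h n w) `^ (p / 2)))%R.
Proof.
move=> p02 adm n; have [p0 p2] := andP p02.
pose a n w := 1 + disc_quad u h n w.
have a1 k w : 1 <= a k w by rewrite lerDl; exact: disc_quad_ge0 adm _ _.
have a0 k w : 0 < a k w by exact: lt_le_trans (a1 k w).
have aa k : adapted_moments P (F (u k)) (a k).
  by apply: admD; [exact: adm_cst|exact: disc_quad_adm].
have aM k := disc_int_adm adm k.
have aM2 k : adapted_moments P (F (u k)) (fun w => disc_int B u h k w ^+ 2 + a k w).
  by apply: admD => //; exact: admM.
have M0 k w : 0 <= disc_int B u h k w ^+ 2 + a k w.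
  by rewrite addr_ge0 ?sqr_ge0// ltW.
have r0 : 0 <= p / 2 by lra.
have aW k : adapted_moments P (F (u k)) (fun w => (disc_int B u h k w ^+ 2 + a k w) `^ (p / 2)).
  exact: adm_powR.
have aar k : adapted_moments P (F (u k)) (fun w => a k w `^ (p / 2)).
  by apply: adm_powR => // w; exact: ltW.
pose U k w := bdg_small p (disc_int B u h k w) (a k w).
have aU k : adapted_moments P (F (u k)) (U k).
  by apply: admB => //; exact: admZ.
have Udec k : (\int[P]_w U k.+1 w)%R <= (\int[P]_w U k w)%R.
  pose v w := disc_int B u h k w ^+ 2 + a k w + disc_dquad u h k w.
  have v1 w : 1 <= v w.
    apply: (le_trans (a1 k w)); rewrite /v -addrA addrCA lerDl addr_ge0 ?sqr_ge0//.
    exact: disc_dquad_ge0 adm _ _.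
  have avr : adapted_moments P (F (u k)) (fun w => v w `^ (p / 2 - 1)).
    apply: adm_powRN => //; first lra; first exact: (grid_measurable adm).
    by apply: admD => //; exact: disc_dquad_adm.
  pose c1 w := p * disc_int B u h k w * v w `^ (p / 2 - 1).
  pose c2 w := p / 2 * v w `^ (p / 2 - 1).
  have ac1 : adapted_moments P (F (u k)) c1 by apply: admM => //; exact: admZ.
  have ac2 : adapted_moments P (F (u k)) c2 by exact: admZ.
  have [_ ad] := disc_incr_adm adm k.
  have i1 : P.-integrable setT (EFin \o (fun w => c1 w * disc_incr B u h k w)).
    by apply: all_moments_integrable; apply: all_momentsM => //; case: ac1.
  have i2 : P.-integrable setT (EFin \o (fun w => c2 w * disc_incr B u h k w ^+ 2)).
    apply: all_moments_integrable; apply: all_momentsM; first by case: ac2.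
    exact: all_momentsM.
  have i3 := adm_int (admM ac2 (disc_dquad_adm adm k)).
  have i23 : P.-integrable setT (EFin \o (fun w => c2 w * disc_incr B u h k w ^+ 2 +
      -1 * (c2 w * disc_dquad u h k w))).
    exact: integrable_RD i2 (integrable_RZl (-1) i3).
  apply: (@le_trans _ _ (\int[P]_w (U k w + (c1 w * disc_incr B u h k w +
     (c2 w * disc_incr B u h k w ^+ 2 + -1 * (c2 w * disc_dquad u h k w))))))%R.
    apply: le_Rintegral => //; first exact: adm_int (aU _).
      by apply: integrable_RD; [exact: adm_int (aU _)|exact: integrable_RD].
    move=> w _; rewrite /U /a disc_intS disc_quadS addrA -/(a k w).
    apply: (le_trans (bdg_small_step _ _ p02 (a0 k w) (disc_dquad_ge0 adm k w))).
    by rewrite -/(v w) /c1 /c2 le_eqVlt; apply/orP; left; apply/eqP; ring.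
  rewrite (RintegralD measurableT (adm_int (aU k)) (integrable_RD i1 i23)).
  rewrite (RintegralD measurableT i1 i23).
  rewrite (RintegralD measurableT i2 (integrable_RZl (-1) i3)) RintegralZl// (Rintegral_disc_incr adm ac1) (Rintegral_disc_incr2 adm ac2).
  by rewrite mulN1r subrr !addr0.
(* The initial value is [bdg_small p 0 1], that is 1 - 2 = -1. *)
have Un : (\int[P]_w U n w)%R <= 0.
  elim: n => [|n IH]; last exact: le_trans (Udec n) IH.
  under eq_Rintegral do rewrite /U /a /disc_int /disc_quad !big_ord0 /bdg_small expr0n/= add0r addr0 powR1.
  by rewrite Rintegral_cst_prob; lra.
apply: (@le_trans _ _ (\int[P]_w (U n w + 2 * a n w `^ (p / 2)))%R); last first.
  rewrite RintegralD//; [|exact: adm_int (aU _)|exact: integrable_RZl (adm_int (aar _))].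
  by rewrite RintegralZl ?gerDr//; exact: adm_int (aar _).
apply: le_Rintegral => //.
- apply: (@adm_int _ _ _ _ (F (u n))); apply: adm_powR => //; [exact: ltW|exact: adm_norm].
- by apply: integrable_RD; [exact: adm_int (aU _)|exact: integrable_RZl (adm_int (aar _))].
- move=> w _; rewrite /U /bdg_small subrK.
  rewrite [X in X `^ p <= _](_ : _ = (disc_int B u h n w ^+ 2) `^ 2^-1).
    by rewrite -powRrM [2^-1 * p]mulrC le_powR2r ?sqr_ge0// lerDl ltW.
  by rewrite powR12_sqrt ?sqr_ge0// sqrtr_sqr.
Qed.

Lemma disc_bdg_large p : 2 <= p -> exists2 C, 0 <= C &
  forall u h, disc_admissible u h -> forall n,
  (\int[P]_w (`|disc_int B u h n w| `^ p))%R <=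
  C * (\int[P]_w ((1 + disc_quad u h n w) `^ (p / 2)))%R.
Proof.
move=> p2; have p0 : 0 < p by lra.
have [C C0 HC] := @bdg_large_step R p p2.
have [Cq Cq0 HCq] := Rintegral_disc_incr_abs p0.
(* A share C absorbs the quadratic part of the Taylor error, whose mean is that of v^(p-2) s; the
   share C Cq absorbs the p-th power, whose mean is at most Cq times that of s^(p/2). *)
pose K := C * (1 + Cq).
have K0 : 0 <= K by rewrite mulr_ge0// addr_ge0.
pose K2 := 2 * ((p + 2 * K) * (2 * (p + 2 * K)) `^ (p - 1) + K).
exists K2; first by rewrite !(mulr_ge0, addr_ge0, powR_ge0)//; lra.
move=> u h adm n.
pose a n w := 1 + disc_quad u h n w.
have a1 k w : 1 <= a k w by rewrite lerDl; exact: disc_quad_ge0 adm _ _.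
have a0 k w : 0 < a k w by exact: lt_le_trans (a1 k w).
have aa k : adapted_moments P (F (u k)) (a k).
  by apply: admD; [exact: adm_cst|exact: disc_quad_adm].
have aM k := disc_int_adm adm k.
have aM2 k : adapted_moments P (F (u k)) (fun w => disc_int B u h k w ^+ 2 + a k w).
  by apply: admD => //; exact: admM.
have M0 k w : 0 <= disc_int B u h k w ^+ 2 + a k w.
  by rewrite addr_ge0 ?sqr_ge0// ltW.
have aW k q : 0 <= q -> adapted_moments P (F (u k))
    (fun w => Num.sqrt (disc_int B u h k w ^+ 2 + a k w) `^ q).
  move=> q0; apply: adm_powR => //; exact: adm_sqrt.
have asa k : adapted_moments P (F (u k)) (fun w => Num.sqrt (a k w)).
  by apply: adm_sqrt => // w; exact: ltW.
have aar k : adapted_moments P (F (u k)) (fun w => a k w `^ (p / 2)).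
  by apply: adm_powR => //; [lra|move=> w; exact: ltW].
pose U k w := bdg_large p K (disc_int B u h k w) (a k w).
have aU k : adapted_moments P (F (u k)) (U k).
  apply: admB; last by apply: admZ; apply: adm_powR => //; lra.
  apply: admB; first by apply: aW; lra.
  by apply: admM => //; apply: admZ; apply: aW; lra.
have Udec k : (\int[P]_w U k.+1 w)%R <= (\int[P]_w U k w)%R.
  pose v w := Num.sqrt (disc_int B u h k w ^+ 2 + (a k w + disc_dquad u h k w)).
  have as1 w : 1 <= a k w + disc_dquad u h k w.
    by apply: (le_trans (a1 k w)); rewrite lerDl; exact: disc_dquad_ge0 adm _ _.
  have v1 w : 1 <= v w.
    have /ler_wsqrtr : 1 <= disc_int B u h k w ^+ 2 + (a k w + disc_dquad u h k w).
      by apply: (le_trans (as1 w)); rewrite lerDr sqr_ge0.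
    by rewrite sqrtr1.
  have aas : adapted_moments P (F (u k)) (fun w => a k w + disc_dquad u h k w).
    by apply: admD => //; exact: disc_dquad_adm.
  have as0 w : 0 <= a k w + disc_dquad u h k w by exact: le_trans (as1 w).
  have av : adapted_moments P (F (u k)) v.
    apply: adm_sqrt; first by move=> w; rewrite addr_ge0 ?sqr_ge0.
    by apply: admD => //; exact: admM.
  have v0 w : 0 <= v w by exact: sqrtr_ge0.
  have avp : adapted_moments P (F (u k)) (fun w => v w `^ (p - 2)).
    by apply: adm_powR => //; lra.
  have avi : adapted_moments P (F (u k)) (fun w => (v w)^-1).
    under eq_fun do rewrite -powR_inv1//.
    by apply: adm_powRN => //; exact: (grid_measurable adm).
  pose c1 w := p * v w `^ (p - 2) * disc_int B u h k w
       - (p + 2 * K) * Num.sqrt (a k w + disc_dquad u h k w) * (p - 1) *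
         (v w `^ (p - 2) / v w) * disc_int B u h k w.
  have ac1 : adapted_moments P (F (u k)) c1.
    apply: admB; first by apply: admM => //; exact: admZ.
    apply: admM => //; apply: admM; last exact: admM.
    apply: admM; last exact: adm_cst.
    by apply: admZ; exact: adm_sqrt.
  have [_ ad] := disc_incr_adm adm k.
  have i1 : P.-integrable setT (EFin \o (fun w => c1 w * disc_incr B u h k w)).
    by apply: all_moments_integrable; apply: all_momentsM => //; case: ac1.
  have i2 : P.-integrable setT (EFin \o (fun w => v w `^ (p - 2) * disc_incr B u h k w ^+ 2)).
    apply: all_moments_integrable; apply: all_momentsM; first by case: avp.
    exact: all_momentsM.
  have i3 := adm_int (admM avp (disc_dquad_adm adm k)).
  have i4 : P.-integrable setT (EFin \o (fun w => 1 * `|disc_incr B u h k w| `^ p)).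
    apply: integrable_RZl; apply: all_moments_integrable.
    by apply: all_moments_powR => //; [exact: ltW|exact: all_moments_norm].
  have i5 : P.-integrable setT (EFin \o (fun w => 1 * disc_dquad u h k w `^ (p / 2))).
    apply: integrable_RZl; apply: (@adm_int _ _ _ _ (F (u k))).
    apply: adm_powR; [lra|by move=> w; exact: disc_dquad_ge0 adm _ _|exact: disc_dquad_adm].
  apply: (@le_trans _ _ (\int[P]_w (U k w + (c1 w * disc_incr B u h k w +
     ((C * (v w `^ (p - 2) * disc_incr B u h k w ^+ 2) +
       C * (1 * `|disc_incr B u h k w| `^ p)) +
     ((- K) * (v w `^ (p - 2) * disc_dquad u h k w) +
       (- K) * (1 * disc_dquad u h k w `^ (p / 2)))))))%R).
    apply: le_Rintegral => //; first exact: adm_int (aU _).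
      apply: integrable_RD; first exact: adm_int (aU _).
      apply: integrable_RD => //.
      by apply: integrable_RD; apply: integrable_RD; exact: integrable_RZl.
    move=> w _; rewrite /U {1}/a disc_intS disc_quadS addrA -/(a k w).
    have := HC K (disc_int B u h k w) (a k w) (disc_dquad u h k w)
      (disc_incr B u h k w) K0 (a0 k w) (disc_dquad_ge0 adm k w) (v w) erefl.
    move=> /le_trans; apply.
    rewrite /c1 le_eqVlt; apply/orP; left; apply/eqP.
    set X1 := `|_| `^ p; set X2 := disc_dquad _ _ _ _ `^ _; set X3 := _ `^ (p - 2).
    set X4 := X3 / v w; set X5 := Num.sqrt _; set X6 := bdg_large _ _ _ _; ring.
  have j1 := integrable_RZl C i2; have j2 := integrable_RZl C i4.
  have j3 := integrable_RZl (- K) i3; have j4 := integrable_RZl (- K) i5.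
  have j12 := integrable_RD j1 j2; have j34 := integrable_RD j3 j4.
  have j14 := integrable_RD j12 j34.
  rewrite (RintegralD measurableT (adm_int (aU k)) (integrable_RD i1 j14)).
  rewrite (RintegralD measurableT i1 j14) (RintegralD measurableT j12 j34).
  rewrite (RintegralD measurableT j1 j2) (RintegralD measurableT j3 j4).
  rewrite (RintegralZl _ measurableT i2) (RintegralZl _ measurableT i4).
  rewrite (RintegralZl _ measurableT i3) (RintegralZl _ measurableT i5).
  rewrite (Rintegral_disc_incr adm ac1) (Rintegral_disc_incr2 adm avp) add0r.
  have a1' := @adm_cst _ _ _ P (F (u k)) 1.
  have := HCq u h adm k _ a1' (fun=> ler01).
  set Y1 := (\int[P]_w (1 * `|_| `^ p))%R; set Y2 := (\int[P]_w (1 * _ `^ (p / 2)))%R.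
  set Y3 := (\int[P]_w (_ * _))%R; set Y0 := (\int[P]_w U k w)%R => H.
  have Y30 : 0 <= Y3.
    by apply: Rintegral_ge0 => w _; rewrite mulr_ge0 ?powR_ge0//; exact: disc_dquad_ge0 adm _ _.
  have Y20 : 0 <= Y2.
    by apply: Rintegral_ge0 => w _; rewrite mulr_ge0 ?powR_ge0//.
  have := ler_wpM2l C0 H; have := mulr_ge0 C0 Y20.
  have := mulr_ge0 (mulr_ge0 C0 Cq0) Y30.
  rewrite /K; clear; lra.
have Un : (\int[P]_w U n w)%R <= 0.
  elim: n => [|n IH]; last exact: le_trans (Udec n) IH.
  under eq_Rintegral do rewrite /U /a /disc_int /disc_quad !big_ord0 /bdg_large expr0n/= add0r addr0 sqrtr1 !powR1 !mulr1.
  by rewrite Rintegral_cst_prob; lra.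
have K20 : (\int[P]_w (2 * U n w))%R <= 0.
  by rewrite RintegralZl//; [lra|exact: adm_int (aU n)].
apply: (@le_trans _ _ (\int[P]_w (2 * U n w + K2 * a n w `^ (p / 2)))%R); last first.
  rewrite RintegralD//; [|exact: integrable_RZl (adm_int (aU _))|exact: integrable_RZl (adm_int (aar _))].
  by rewrite (RintegralZl _ _ (adm_int (aar n)))// gerDr.
apply: le_Rintegral => //.
- apply: (@adm_int _ _ _ _ (F (u n))); apply: adm_powR => //; [exact: ltW|exact: adm_norm].
- by apply: integrable_RD; [exact: integrable_RZl (adm_int (aU _))|exact: integrable_RZl (adm_int (aar _))].
- by move=> w _; exact: bdg_large_ge.
Qed.

Lemma disc_bdg p : 0 < p -> exists2 C, 0 <= C &
  forall u h, disc_admissible u h -> forall n,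
  (\int[P]_w (`|disc_int B u h n w| `^ p))%R <=
  C * (\int[P]_w ((1 + disc_quad u h n w) `^ (p / 2)))%R.
Proof.
move=> p0; have [p2|/ltW p2] := leP p 2; last exact: disc_bdg_large.
by exists 2 => // u h adm n; apply: disc_bdg_small => //; rewrite p0.
Qed.

End DiscreteMartingale.

(** * Time grids, refinement and truncation of simple processes *)

Section Grid.
Context {R : realType}.
Implicit Types (u : nat -> R) (T x : R).

Definition is_grid T u n := [/\ forall k, 0 <= u k <= T, forall k, u k <= u k.+1,
  u 0%N = 0 & forall k, (n <= k)%N -> u k = T].

Definition on_grid u n x := exists2 k, (k <= n)%N & u k = x.

Lemma is_grid_mono T u n : is_grid T u n -> forall j k, (j <= k)%N -> u j <= u k.
Proof.
move=> [_ um _ _]; apply: (@homo_leq _ u (fun x y => x <= y)) => //.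
exact: le_trans.
Qed.

Lemma on_grid_lt T u n x k : is_grid T u n -> on_grid u n x ->
  x < u k.+1 -> x <= u k.
Proof.
move=> g [j jn <-]; case: (leqP j k) => [jk _|kj]; first exact: (is_grid_mono g).
by rewrite ltNge (is_grid_mono g kj).
Qed.

Lemma exists_grid T (s : seq R) : 0 <= T -> all (fun x => 0 <= x <= T) s ->
  exists u n, is_grid T u n /\ forall x, x \in s -> on_grid u n x.
Proof.
move=> T0 sT; pose g := sort <=%R [:: 0, T & s].
have gmem x : (x \in g) = (x \in [:: 0, T & s]) by rewrite mem_sort.
have gT x : x \in g -> 0 <= x <= T.
  rewrite gmem !inE => /or3P[/eqP ->|/eqP ->|xs]; rewrite ?lexx ?T0//.
  by have /allP := sT; apply.
have sg : sorted <=%R g by apply: sort_sorted; exact: le_total.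
have szg : size g = (size s).+2 by rewrite size_sort.
have gsort : {in [pred n | (n < size g)%N] &, {homo nth T g : i j / (i <= j)%N >-> i <= j}}.
  by apply: sorted_leq_nth => //; exact: le_trans.
have nthT k : (size g <= k)%N -> nth T g k = T by move=> ?; rewrite nth_default.
have lastT : nth T g (size s).+1 = T.
  have Tg : T \in g by rewrite gmem !inE eqxx orbT.
  have := gT (nth T g (size s).+1); rewrite mem_nth ?szg//.
  move=> /(_ isT)/andP[_ H]; apply/eqP; rewrite eq_le H /=.
  rewrite -{1}(nth_index T Tg); apply: gsort; rewrite ?inE ?index_mem ?szg//.
  by rewrite -ltnS -szg index_mem.
exists (nth T g), (size s).+1; split.
  split.
  - move=> k; have [kg|kg] := ltnP k (size g); first by apply: gT; rewrite mem_nth.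
    by rewrite nthT// T0 lexx.
  - move=> k; have [kg|kg] := ltnP k.+1 (size g).
      by apply: gsort; rewrite ?inE// (ltn_trans _ kg).
    rewrite (nthT k.+1)//; have [kg'|kg'] := ltnP k (size g); last by rewrite nthT.
    by have := gT (nth T g k); rewrite mem_nth// => /(_ isT)/andP[].
  - have zg : 0 \in g by rewrite gmem !inE eqxx.
    have := gT (nth T g 0); rewrite mem_nth ?szg// => /(_ isT)/andP[H _].
    apply/eqP; rewrite eq_le H andbT -[leRHS](nth_index T zg).
    by apply: gsort; rewrite ?inE ?index_mem ?szg.
  - move=> k; rewrite leq_eqVlt => /predU1P[<-//|sk]; apply: nthT.
    by rewrite szg.
move=> x xs; have xg : x \in g by rewrite gmem !inE xs !orbT.
exists (index x g); last exact: nth_index.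
by rewrite -ltnS -szg index_mem.
Qed.

Lemma exists_fine_grid T (s : seq R) N : 0 < T -> all (fun x => 0 <= x <= T) s ->
  exists u n, [/\ is_grid T u n, forall x, x \in s -> on_grid u n x &
    forall k, u k.+1 - u k <= T / N.+1%:R].
Proof.
move=> T0 sT; have N0 : (0 : R) < N.+1%:R by rewrite ltr0n.
pose m := [seq i%:R * (T / N.+1%:R) | i <- iota 0 N.+2].
have e0 : 0 < T / N.+1%:R by rewrite divr_gt0.
have mT : all (fun x => 0 <= x <= T) (s ++ m).
  rewrite all_cat sT; apply/allP => x /mapP[i]; rewrite mem_iota add0n => /andP[_ iN] ->.
  rewrite mulr_ge0 ?(ltW e0)//= mulrA ler_pdivrMr// mulrC ler_pM2l// ler_nat.
  by rewrite -ltnS.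
have [u [n [g us]]] := exists_grid (ltW T0) mT.
exists u, n; split => //; first by move=> x xs; apply: us; rewrite mem_cat xs.
move=> k; have [u0T um u00 uT] := g.
have /andP[uk0 ukT] := u0T k.
(* With i the index of the uniform cell containing u k, the multiple i + 1 of T / (N + 1) is a grid
   point beyond u k as long as i <= N, so u k.+1 cannot pass it. *)
have /truncn_itv/andP[] : 0 <= u k / (T / N.+1%:R) by rewrite divr_ge0// ltW.
set i := Num.truncn _; rewrite ler_pdivlMr// ltr_pdivrMr// => i1 i2.
have [iN|Ni] := leqP i.+1 N.+1.
  have xg : on_grid u n (i.+1%:R * (T / N.+1%:R)).
    apply: us; rewrite mem_cat; apply/orP; right; apply/mapP; exists i.+1 => //.
    by rewrite mem_iota add0n.
  have := @on_grid_lt T u n _ k g xg.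
  have [H|H] := ltP (i.+1%:R * (T / N.+1%:R)) (u k.+1).
    by move=> /(_ isT)/(lt_le_trans i2); rewrite ltxx.
  move=> _; rewrite lerBlDr (le_trans H)// -natr1 mulrDl mul1r addrC lerD2l//.
have : T <= u k.
  apply: le_trans i1; rewrite mulrA ler_pdivlMr// mulrC ler_pM2r// ler_nat.
  by rewrite -ltnS.
have /andP[_ H] := u0T k.+1 => H2.
by apply: (@le_trans _ _ 0); [rewrite subr_le0 (le_trans H)|exact: ltW].
Qed.

(** Since a and b are grid points, every cell lies entirely inside or outside ]a, b]. This rewrites
    one step of a simple process as a sum over the cells of a finer grid, stopped at u m. *)
Lemma grid_telescope T u n (f : R -> R) a b m : is_grid T u n ->
  on_grid u n a -> on_grid u n b -> a <= b ->
  \sum_(k < m) (a < u k.+1 <= b)%R%:R * (f (u k.+1) - f (u k)) =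
  f (Num.min b (u m)) - f (Num.min a (u m)).
Proof.
move=> g ga gb ab; elim: m => [|m IH].
  rewrite big_ord0; have [u0T _ u00 _] := g; rewrite u00.
  have H x : on_grid u n x -> 0 <= x by move=> [k _ <-]; have /andP[] := u0T k.
  by rewrite !min_r ?H// subrr.
rewrite big_ord_recr /= IH.
have um : u m <= u m.+1 by exact: (is_grid_mono g).
have [H|H] := leP (u m.+1) a.
  rewrite /= mul0r addr0 (min_r (le_trans H ab)) (min_r (le_trans um H)).
  by rewrite (min_r (le_trans um (le_trans H ab))) !subrr.
have am := on_grid_lt g ga H; rewrite (min_l am).
have [H'|H'] := leP (u m.+1) b.
  by rewrite /= mul1r (min_r (le_trans um H')); ring.
have bm := on_grid_lt g gb H'.
by rewrite /= mul0r addr0 (min_l bm).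
Qed.

Lemma truncation_index (b : nat -> bool) m : (forall k, b k.+1 -> b k) ->
  exists2 j, (j <= m)%N & [/\ forall k, (k < m)%N -> b k = (k < j)%N,
    (j = 0%N) \/ b j.-1 & j = m \/ ~~ b j].
Proof.
move=> bd; elim: m => [|m [j jm [H1 H2 H3]]].
  by exists 0%N => //; split => //; left.
have [jE|jlt] := eqVneq j m; last first.
  have jm' : (j < m)%N by rewrite ltn_neqAle jlt.
  have bj : ~~ b j by case: H3 => // /eqP; rewrite (negbTE jlt).
  have bk k : (j <= k)%N -> ~~ b k.
    elim: k => [|k IH]; first by rewrite leqn0 => /eqP <-.
    rewrite leq_eqVlt => /predU1P[<-//|]; rewrite ltnS => /IH; apply: contra; exact: bd.
  exists j; first exact: leqW; split => //; last by right.
  move=> k; rewrite ltnS leq_eqVlt => /predU1P[->|/H1//].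
  by rewrite ltnNge jm/=; apply/negbTE/bk.
case bm : (b m).
  exists m.+1 => //; split => //; [|by right|by left].
  have bk k : (k <= m)%N -> b k.
    have : b m by []; elim: (m) k => [|m' IH] k; first by rewrite leqn0 => ? /eqP ->.
    by move=> /[dup] bm1 /bd/IH H; rewrite leq_eqVlt ltnS => /predU1P[->|/H].
  by move=> k km; rewrite km bk.
exists m; first exact: leqW; split.
- move=> k; rewrite ltnS leq_eqVlt => /predU1P[->|km]; first by rewrite ltnn.
  by rewrite H1// jE.
- by rewrite -jE.
- by right; rewrite bm.
Qed.

End Grid.

Section RefineSimple.
Context {R : realType} {dO : measure_display} {Omega : measurableType dO}.
Context (P : probability Omega R) (T : R) (d : nat) (B : R -> Omega -> 'rV[R]_d).
Local Notation F := (brownian_filtration P B).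
Local Notation leb := (@lebesgue_measure R).
Implicit Types H : simple_process R Omega d.

Definition refines H (u : nat -> R) (n : nat) :=
  is_grid T u n /\ forall k, (k <= sp_size H)%N -> on_grid u n (sp_time H k).

(** A simple process is constant on the cell ]u k, u k.+1], so its value at the right end is already
    known at time u k. *)
Definition refined_coef H (u : nat -> R) (k : nat) (w : Omega) := sp_eval H (u k.+1) w.

Lemma refined_admissible H u n : simple_predictable T F H -> refines H u n ->
  disc_admissible P T B u (refined_coef H u).
Proof.
move=> [tT tm mv [C HC]] [g ong]; have [u0T um _ _] := g; split => //.
  move=> k i; rewrite /refined_coef /sp_eval.
  under eq_fun do rewrite summxE big_mkcond/=.
  apply: measurable_sum => -[j jH] /=.
  case E : (_ < _ <= _); last exact: measurable_cst.
  have [H1 _] := andP E.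
  apply: measurable_wrt_sub (mv j i jH); apply: filtrationS.
  by apply: (on_grid_lt g) => //; apply: ong; exact: ltnW.
move=> k; exists (\sum_(j < sp_size H) `|C|) => i w; rewrite /refined_coef /sp_eval summxE.
apply: (le_trans (ler_norm_sum _ _ _)); rewrite big_mkcond/=; apply: ler_sum => j _.
by case: ifP => // _; apply: (le_trans (HC _ _ _ _) (ler_norm _)).
Qed.

Lemma sp_eval_refined H u n : refines H u n -> forall k t w,
  u k < t <= u k.+1 -> sp_eval H t w = refined_coef H u k w.
Proof.
move=> [g ong] k t w /andP[ut tu]; apply: eq_bigl => -[j jH] /=.
have E x : on_grid u n x -> (x < t) = (x < u k.+1).
  move=> xg; apply/idP/idP => [xt|]; first exact: lt_le_trans tu.
  by move=> /(on_grid_lt g xg) xu; exact: le_lt_trans ut.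
by rewrite !leNgt !E//; apply: ong => //; exact: ltnW.
Qed.

Lemma sp_int_refined H u n : simple_predictable T F H -> refines H u n -> forall m w,
  sp_int B H (u m) w = disc_int B u (refined_coef H u) m w.
Proof.
move=> [tT tm mv _] [g ong] m w.
rewrite /sp_int /disc_int /disc_incr /refined_coef /sp_eval.
rewrite [RHS]exchange_big/= exchange_big/=; apply: eq_bigr => i _.
under [RHS]eq_bigr do rewrite summxE mulr_suml big_mkcond/=.
rewrite [RHS]exchange_big/=; apply: eq_bigr => -[j jH] _ /=.
have gj : on_grid u n (sp_time H j) by apply: ong; exact: ltnW.
have gj1 : on_grid u n (sp_time H j.+1) by exact: ong.
rewrite -(grid_telescope (fun x => B x w 0 i) m g gj gj1 (tm j jH)) mulr_sumr.
by apply: eq_bigr => k _; case: ifP => _; rewrite ?mul1r ?mul0r ?mulr0.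
Qed.

Lemma sp_eval_measurable H w i :
  measurable_fun setT (fun t => sp_eval H t w 0 i).
Proof.
rewrite /sp_eval; under eq_fun do rewrite summxE big_mkcond/=.
apply: measurable_sum => j.
apply: measurable_fun_ifT; last exact: measurable_cst; last exact: measurable_cst.
rewrite [X in measurable_fun _ X](_ : _ = (fun t => t \in `]sp_time H j, sp_time H j.+1])).
  by apply: measurable_fun_bool; rewrite setTI /= /preimage/=; exact: measurable_itv.
by apply/funext => t; rewrite in_itv.
Qed.

Lemma integral_sp_eval H u n : refines H u n -> forall m w,
  (\int[leb]_(t in `[0%R, u m]) (enorm (sp_eval H t w) ^+ 2)%:E =
   (disc_quad u (refined_coef H u) m w)%:E)%E.
Proof.
move=> r m w; have [g _] := r; have [u0T um u00 _] := g.
have mE : measurable_fun setT (fun t => (enorm (sp_eval H t w) ^+ 2)%:E).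
  apply/measurable_EFinP; under eq_fun do rewrite enorm_sqr.
  by apply: measurable_sum => i; apply: measurable_funX; exact: sp_eval_measurable.
elim: m => [|m IH].
  by rewrite u00 set_itv1 integral_set1 /disc_quad big_ord0.
have um1 := um m; have /andP[um0 _] := u0T m.
have -> : `[0, u m.+1]%classic = `[0, u m]%classic `|` `]u m, u m.+1]%classic.
  by rewrite -itv_bndbnd_setU ?bnd_simp.
rewrite ge0_integral_setU//=; last 3 first.
- exact: measurable_funTS.
- by move=> x _; rewrite lee_fin sqr_ge0.
- apply/disj_setPS => x []/=; rewrite !in_itv/= => /andP[_ H1] /andP[H2 _].
  by move: (le_lt_trans H1 H2); rewrite ltxx.
rewrite IH /disc_quad big_ord_recr/= EFinD; congr (_ + _)%E.
transitivity (\int[leb]_(t in `]u m, u m.+1]) (enorm (refined_coef H u m w) ^+ 2)%:E)%E.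
  apply: eq_integral => t; rewrite inE/= in_itv/= => tu.
  by rewrite (sp_eval_refined r w tu).
rewrite integral_cst//= lebesgue_measure_itv/= lte_fin /disc_dquad.
have [lt|H'] := ltP (u m) (u m.+1); first by rewrite -EFinD -!EFinM.
rewrite mule0 (_ : u m.+1 - u m = 0) ?mulr0//.
by apply/eqP; rewrite subr_eq0 eq_le H' um1.
Qed.

(* The value disc_quad u h k.+1 is already F (u k)-measurable, so that truncation stays
   adapted and keeps the quadratic variation below c without overshoot. *)
Definition truncated_coef (u : nat -> R) (h : nat -> Omega -> 'rV[R]_d) (c : R)
    (k : nat) (w : Omega) : 'rV[R]_d :=
  if disc_quad u h k.+1 w + u k.+1 <= c then h k w else 0.

Section Truncate.
Context (hB : is_brownian_motion P T B) (P_complete : measure_is_complete P).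
Context (u : nat -> R) (h : nat -> Omega -> 'rV[R]_d).
Hypothesis adm : disc_admissible P T B u h.

Lemma disc_quad_wrt k : measurable_wrt (F (u k)) (disc_quad u h k.+1).
Proof.
have [mA _] := disc_quad_adm hB P_complete adm k.
have [mD _] := disc_dquad_adm hB P_complete adm k.
rewrite (_ : disc_quad _ _ _ = fun w => disc_quad u h k w + disc_dquad u h k w).
  exact: measurable_funD.
by apply/funext => w; rewrite disc_quadS.
Qed.

Lemma disc_quad_mono j k w : (j <= k)%N -> disc_quad u h j w <= disc_quad u h k w.
Proof.
apply: (@homo_leq _ (fun i => disc_quad u h i w) (fun x y => x <= y)) => //.
  exact: le_trans.
by move=> i; rewrite disc_quadS lerDl; exact: disc_dquad_ge0 adm _ _.
Qed.

Lemma truncated_admissible c : disc_admissible P T B u (truncated_coef u h c).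
Proof.
have [u0T um mh bh] := adm; split => //.
  move=> k i; rewrite /truncated_coef.
  rewrite (_ : (fun w => _) = (fun w => if (fun w => disc_quad u h k.+1 w + u k.+1 <= c) w
     then h k w 0 i else 0)); last by apply/funext => w; case: ifP; rewrite ?mxE.
  apply: measurable_fun_ifT; last exact: measurable_cst; last exact: mh.
  apply: measurable_fun_ler; last exact: measurable_cst.
  by apply: measurable_funD; [exact: disc_quad_wrt|exact: measurable_cst].
move=> k; have [C HC] := bh k; exists `|C| => i w; rewrite /truncated_coef.
case: ifP => _; last by rewrite mxE normr0.
exact: le_trans (HC _ _) (ler_norm _).
Qed.

(** Truncation freezes the path at an index j depending on w. The last two clauses enclose c between
    the discrete clocks at u j and at u j.+1, which is what locates u j near the hitting time of
    c. *)
Lemma truncated_sums c m w : exists2 j, (j <= m)%N &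
  [/\ disc_int B u (truncated_coef u h c) m w = disc_int B u h j w,
      disc_quad u (truncated_coef u h c) m w = disc_quad u h j w,
      j = 0%N \/ disc_quad u h j w + u j <= c &
      j = m \/ c < disc_quad u h j.+1 w + u j.+1].
Proof.
pose b k := disc_quad u h k.+1 w + u k.+1 <= c.
have bd k : b k.+1 -> b k.
  apply: le_trans; rewrite lerD ?disc_quad_mono//; by have [_ + _ _] := adm; apply.
have [j jm [bE j0 jE]] := truncation_index m bd.
have sumE (f : nat -> R) : \sum_(k < m) (if b k then f k else 0) = \sum_(k < j) f k.
  rewrite -big_mkcond/= (eq_bigl (fun k : 'I_m => (k < j)%N)).
    by rewrite -(big_ord_widen _ f jm).
  by move=> k; rewrite /= bE.
exists j => //; split.
- rewrite /disc_int -(sumE (fun k => disc_incr B u h k w)); apply: eq_bigr => k _.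
  rewrite /disc_incr /truncated_coef -/(b k); case: ifP => // _.
  by rewrite big1// => i _; rewrite mxE mul0r.
- rewrite /disc_quad -(sumE (fun k => disc_dquad u h k w)); apply: eq_bigr => k _.
  rewrite /disc_dquad /truncated_coef -/(b k); case: ifP => // _.
  by rewrite enorm_sqr big1 ?mul0r// => i _; rewrite mxE expr0n.
- by case: j0 => [|bj]; [left|case: (j) bj => [|j' bj']; [left|right]].
- by case: jE => [|bj]; [left|right; rewrite ltNge].
Qed.

Lemma truncated_quad_le c m w : 0 <= c -> disc_quad u (truncated_coef u h c) m w <= c.
Proof.
move=> c0; have [j _ [_ -> [->|H] _]] := truncated_sums c m w.
  by rewrite /disc_quad big_ord0.
by apply: le_trans H; rewrite lerDl; exact: grid_ge0 adm _.
Qed.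

Section Weights.
Context (p : nat -> nat) (e : nat -> Omega -> R) (m : nat).
Hypothesis p_lt : forall i, (i < m)%N -> (p i < p i.+1)%N.
Hypothesis e_meas : forall i, (i < m)%N -> measurable_wrt (F (u (p i))) (e i).
Hypothesis e_le1 : forall i w, (i < m)%N -> `|e i w| <= 1.

(** A weight e i known at a coarse time is spread over the fine cells p i <= k < p i.+1. A sum of
    the e i against coarse increments is thus a discrete integral on the fine grid, to which the
    Burkholder inequality applies. *)
Definition step_weight k w := \sum_(i < m) (p i <= k < p i.+1)%N%:R * e i w.

Lemma step_weight_le1 k w : `|step_weight k w| <= 1.
Proof.
(* The strengthened bound records that the weight vanishes from index p m on, so the next block of
   the induction meets no earlier one. *)
suff : `|step_weight k w| <= (k < p m)%N%:R by move=> /le_trans; apply; case: (_ < _)%N.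
rewrite /step_weight; elim: m p_lt e_le1 => [|m' IH] plt ele.
  by rewrite big_ord0 normr0.
rewrite big_ord_recr/=.
have {IH} := IH (fun i im => plt i (ltnW im)) (fun i w im => ele i w (ltnW im)).
have pm := plt m' (ltnSn m').
have [km|mk] := ltnP k (p m'); first by rewrite mul0r addr0 (ltn_trans km).
rewrite normr_le0 => /eqP ->; rewrite add0r.
by case: (k < p m'.+1)%N; rewrite ?mul0r ?normr0// mul1r ele.
Qed.

Lemma weighted_admissible :
  disc_admissible P T B u (fun k w => step_weight k w *: h k w).
Proof.
have [u0T um mh bh] := adm; split => //.
  move=> k i; under eq_fun do rewrite mxE.
  apply: measurable_funM; last exact: mh.
  apply: measurable_sum => -[j jm] /=.
  case E : (_ <= _ < _)%N; last by under eq_fun do rewrite mul0r; exact: measurable_cst.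
  under eq_fun do rewrite mul1r.
  apply: measurable_wrt_sub (e_meas jm); apply: filtrationS.
  by apply: (grid_mono adm); case/andP : E.
move=> k; have [C HC] := bh k; exists `|C| => i w; rewrite mxE normrM.
apply: (@le_trans _ _ (1 * `|h k w 0 i|)); first by rewrite ler_wpM2r// step_weight_le1.
by rewrite mul1r; apply: le_trans (HC _ _) (ler_norm _).
Qed.

Lemma weighted_quad_le n w :
  disc_quad u (fun k w => step_weight k w *: h k w) n w <= disc_quad u h n w.
Proof.
apply: ler_sum => k _; rewrite /disc_dquad ler_wpM2r ?(grid_step_ge0 adm)//.
rewrite !enorm_sqr; apply: ler_sum => i _; rewrite mxE exprMn.
rewrite -[leRHS]mul1r ler_wpM2r ?sqr_ge0//.
by rewrite -real_normK ?num_real// exprn_ile1// step_weight_le1.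
Qed.

Lemma weighted_int n w : (p m <= n)%N ->
  disc_int B u (fun k w => step_weight k w *: h k w) n w =
  \sum_(i < m) e i w * (disc_int B u h (p i.+1) w - disc_int B u h (p i) w).
Proof.
move=> pmn.
have pn i : (i <= m)%N -> (p i <= n)%N.
  move=> im; apply: leq_trans pmn; move: im.
  have : forall i, (i < m)%N -> (p i <= p i.+1)%N by move=> j /p_lt/ltnW.
  elim: (m) => [|m' IH] H; first by rewrite leqn0 => /eqP ->.
  rewrite leq_eqVlt => /predU1P[->//|]; rewrite ltnS => im.
  by apply: (leq_trans _ (H m' (ltnSn m'))); apply: IH => // j jm; apply: H; exact: ltnW.
transitivity (\sum_(k < n) \sum_(i < m) (p i <= k < p i.+1)%N%:R * e i w * disc_incr B u h k w).
  apply: eq_bigr => k _; rewrite -mulr_suml -/(step_weight k w) /disc_incr mulr_sumr.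
  by apply: eq_bigr => i _; rewrite mxE mulrA.
rewrite exchange_big/=; apply: eq_bigr => -[i im] _ /=.
under eq_bigr do rewrite mulrAC mulrC; rewrite -mulr_sumr; congr (_ * _).
rewrite /disc_int -!(big_mkord xpredT (fun k => disc_incr B u h k w)).
rewrite (big_cat_nat (n := p i) (leq0n _) (ltnW (p_lt im)))//= [X in _ = X - _]addrC addrK.
rewrite -(big_mkord xpredT (fun k => (p i <= k < p i.+1)%N%:R * disc_incr B u h k w)).
rewrite (big_cat_nat (n := p i.+1))//=; last exact: pn.
rewrite (big_cat_nat (n := p i))//=; last exact: ltnW (p_lt im).
rewrite big_nat_cond big1 ?add0r; last first.
  by move=> k /andP[/andP[_ kp] _]; rewrite leqNgt kp mul0r.
rewrite [X in _ + X]big_nat_cond [X in _ + X]big1 ?addr0; last first.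
  by move=> k /andP[/andP[kp _] _]; rewrite [(k < _)%N]ltnNge kp andbF mul0r.
by apply: eq_big_nat => k ->; rewrite mul1r.
Qed.

End Weights.
End Truncate.
End RefineSimple.

(** * Quadratic variation and stopping *)

Section Clock.
Context {R : realType}.
Implicit Types (T t c : R) (C f : R -> R).

Lemma within_continuous_eps T f : {within `[0, T], continuous f} <->
  forall x, 0 <= x <= T -> forall e, 0 < e -> exists2 dl, 0 < dl &
    forall y, 0 <= y <= T -> `|x - y| < dl -> `|f x - f y| < e.
Proof.
split.
  move=> /subspace_continuousP cf x xT e e0.
  have := cf x; rewrite /= in_itv/= xT => /(_ isT)/cvgrPdist_lt/(_ e e0).
  rewrite /within /= => -[dl /= dl0 H]; exists dl => // y yT xy.
  by apply: H => //=; rewrite in_itv.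
move=> H; apply/subspace_continuousP => x /=; rewrite in_itv/= => xT.
apply/cvgrPdist_lt => e e0; have [dl dl0 {}H] := H x xT e e0.
by exists dl => //= y xy; rewrite in_itv/=; move=> yT; apply: H.
Qed.

(** For a strictly increasing continuous C with C 0 <= c this is the time at which C reaches c, with
    default T when it does not. *)
Definition hitting T C c := sup [set s | 0 <= s <= T /\ C s <= c].

Context (T : R) (C : R -> R) (c : R).
Hypotheses (T0 : 0 < T) (C0c : C 0 <= c) (Ccont : {within `[0, T], continuous C}).
Hypothesis Cincr : forall s t, 0 <= s -> s < t -> t <= T -> C s < C t.

Local Notation S := [set s | 0 <= s <= T /\ C s <= c].
Local Notation tau := (hitting T C c).

Lemma hitting_has_sup : has_sup S.
Proof.
split; first by exists 0; rewrite /= lexx (ltW T0).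
by exists T => s [/andP[]].
Qed.

Lemma hitting_bounds : 0 <= tau <= T.
Proof.
apply/andP; split.
  by apply: ub_le_sup; [case: hitting_has_sup|rewrite /= lexx (ltW T0)].
by apply: ge_sup => [|s [/andP[]]//]; case: hitting_has_sup.
Qed.

Lemma hitting_gt s : tau < s -> s <= T -> c < C s.
Proof.
move=> ts sT; rewrite ltNge; apply/negP => Csc.
have : s <= tau.
  apply: ub_le_sup; first by case: hitting_has_sup.
  split => //; rewrite sT andbT; have /andP[t0 _] := hitting_bounds.
  by rewrite (le_trans t0)// ltW.
by move=> /(lt_le_trans ts); rewrite ltxx.
Qed.

Lemma clock_le s t : 0 <= s -> s <= t -> t <= T -> C s <= C t.
Proof. by move=> s0; rewrite le_eqVlt => /predU1P[->//|st tT]; rewrite ltW// Cincr. Qed.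

Lemma hitting_le : C tau <= c.
Proof.
rewrite leNgt; apply/negP => cC.
have e0 : 0 < C tau - c by rewrite subr_gt0.
have [dl dl0 H] := (within_continuous_eps T C).1 Ccont tau hitting_bounds _ e0.
have [s [sT Csc] ts] := sup_adherent dl0 hitting_has_sup.
have st : s <= tau by apply: ub_le_sup => //; case: hitting_has_sup.
have := H s sT; rewrite ger0_norm ?subr_ge0// ltrBlDr addrC -ltrBlDr => /(_ ts).
by move=> /(le_lt_trans (ler_norm _)); rewrite ltrD2l ltrN2 ltNge Csc.
Qed.

(** It turns the event tau <= t into one about the clock at time t, hence adaptedness. At t = T the
    equivalence fails, since tau is T when the level is not reached. *)
Lemma hitting_leE t : 0 <= t < T -> (tau <= t) = (c <= C t).
Proof.
move=> /andP[t0 tT]; apply/idP/idP => [tt|cC].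
  rewrite leNgt; apply/negP => Cc.
  have e0 : 0 < c - C t by rewrite subr_gt0.
  have tT' : 0 <= t <= T by rewrite t0 ltW.
  have [dl dl0 H] := (within_continuous_eps T C).1 Ccont t tT' _ e0.
  pose s := Num.min T (t + dl / 2).
  have ts : t < s by rewrite lt_min tT ltrDl divr_gt0.
  have sT : s <= T by rewrite ge_min lexx.
  have sd : s <= t + dl / 2 by rewrite ge_min lexx orbT.
  have := hitting_gt (le_lt_trans tt ts) sT.
  have := H s; rewrite sT (le_trans t0 (ltW ts)) distrC ger0_norm ?subr_ge0 ?(ltW ts)//.
  move=> /(_ isT) H1.
  have {}H1 : `|C t - C s| < c - C t by apply: H1; lra.
  by move: H1; rewrite distrC => /(le_lt_trans (ler_norm _)); lra.
rewrite leNgt; apply/negP => tt; have /andP[_ tauT] := hitting_bounds.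
have := Cincr t0 tt tauT; rewrite ltNge => /negP; apply.
exact: le_trans hitting_le cC.
Qed.

(** Strict monotonicity turns closeness of clock values into closeness of times. The time s n cannot
    lie far to the right because its clock is at most c + e, nor far to the left because, unless it
    equals t, a time v just after it has clock at least c - e. *)
Lemma hitting_converge (t : R) (s : nat -> R) : 0 <= t <= T ->
  (forall n, 0 <= s n <= t) ->
  (forall e, 0 < e -> \forall n \near \oo, C (s n) <= c + e) ->
  (forall e, 0 < e -> \forall n \near \oo, s n = t \/
    exists v, [/\ s n <= v, v <= T, v <= s n + e & c - e <= C v]) ->
  forall e, 0 < e -> \forall n \near \oo, `|s n - Num.min t tau| < e.
Proof.
move=> /andP[t0 tT] st sdel sv e e0.
have /andP[tau0 tauT] := hitting_bounds.
set m := Num.min t tau.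
have m0 : 0 <= m by rewrite le_min t0.
have mt : m <= t by rewrite ge_min lexx.
have mtau : m <= tau by rewrite ge_min lexx orbT.
have up : \forall n \near \oo, s n < m + e.
  have [H|H] := leP (m + e) t; last first.
    by apply: nearW => n; have /andP[_ sn] := st n; exact: le_lt_trans sn H.
  have mE : m = tau.
    by apply/min_idPr; rewrite leNgt; apply/negP => /ltW/min_idPl; rewrite -/m => h; move: H; rewrite h; lra.
  have cC : 0 < C (m + e) - c.
    rewrite subr_gt0; apply: hitting_gt; first by rewrite -mE ltrDl.
    exact: le_trans tT.
  apply: filterS (sdel _ (divr_gt0 cC (ltr0Sn R 1))) => n dn.
  rewrite ltNge; apply/negP => sn.
  have : C (m + e) <= C (s n).
    apply: clock_le => //; first by rewrite addr_ge0// ltW.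
    by have /andP[_ /le_trans] := st n; apply.
  by move: dn cC; clear; lra.
have lo : \forall n \near \oo, m - e < s n.
  have [H|H] := ltP (m - e) 0.
    by apply: nearW => n; have /andP[sn _] := st n; exact: lt_le_trans H sn.
  have cC : 0 < c - C (m - e / 2).
    rewrite subr_gt0; apply: lt_le_trans hitting_le.
    apply: Cincr => //; move: e0 H mtau; clear; lra.
  pose e' := Num.min (e / 2) ((c - C (m - e / 2)) / 2).
  have e'0 : 0 < e' by rewrite lt_min !divr_gt0.
  have e'1 : e' <= e / 2 by rewrite ge_min lexx.
  have e'2 : e' <= (c - C (m - e / 2)) / 2 by rewrite ge_min lexx orbT.
  apply: filterS (sv _ e'0) => n svn; rewrite ltNge; apply/negP => sn.
  case: svn => [E|[v [snv vT vs cv]]].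
    by move: sn mt e0; rewrite E; clear; lra.
  have /andP[sn0 _] := st n.
  have : C v <= C (m - e / 2).
    by apply: clock_le; move: sn vs e'1 sn0 snv mtau tauT e0 H; clear; lra.
  by move: e'2 cv cC; clear; lra.
apply: filterS2 up lo => n H1 H2.
by rewrite ltr_norml; move: H1 H2; clear => H1 H2; apply/andP; split; lra.
Qed.

End Clock.

(** * Progressive processes and the clock of the quadratic variation *)

Section Progressive.
Context {R : realType} {dO : measure_display} {Omega : measurableType dO}.
Context (T : R) (F : R -> set (set Omega)).
Implicit Types X : R -> Omega -> R.

(** Extension by 0 gives a function measurable on the whole product, to which sections, random times
    and Tonelli's theorem apply. *)
Lemma progressive_restrict X t : progressive T F X -> 0 <= t <= T ->
  measurable_fun [set: R * g_sigma_algebraType (F t)]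
    (fun u => if u.1 \in `[0, t] then X u.1 u.2 else 0).
Proof.
move=> pX tT.
have mb : measurable_fun [set: R * g_sigma_algebraType (F t)] (fun u => u.1 \in `[0, t]).
  apply: (@measurable_fun_bool _ _ _ _ true).
  rewrite setTI (_ : _ @^-1` _ = fst @^-1` `[0, t]%classic)//.
  by rewrite -[_ @^-1` _]setTI; apply: measurable_fst.
apply: measurable_fun_if => //.
rewrite setTI (_ : _ @^-1` _ = `[0, t]%classic `*` setT); first exact: pX.
by apply/seteqP; split => u /=; [move=> ->|case=> ->].
Qed.

Lemma progressive_section X s t : progressive T F X -> 0 <= s -> s <= t -> t <= T ->
  measurable_wrt (F t) (X s).
Proof.
move=> pX s0 st tT; have t0 : 0 <= t <= T by rewrite (le_trans s0).
have := measurable_fun_pair2 s (progressive_restrict pX t0).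
by rewrite /= in_itv/= s0 st.
Qed.

Lemma progressive_path X w : progressive T F X -> 0 <= T ->
  measurable_fun `[0, T] (X ^~ w).
Proof.
move=> pX T0; have TT : 0 <= T <= T by rewrite T0 lexx.
have := measurable_fun_pair1 (w : g_sigma_algebraType (F T)) (progressive_restrict pX TT).
move=> /(measurable_funS measurableT (@subsetT _ `[0, T]%classic)).
by apply: eq_measurable_fun => s; rewrite inE/= => ->.
Qed.

Lemma progressive_random_time X (tau : Omega -> R) t : progressive T F X ->
  0 <= t <= T -> (forall w, 0 <= tau w <= t) -> measurable_wrt (F t) tau ->
  measurable_wrt (F t) (fun w => X (tau w) w).
Proof.
move=> pX tT tauT mtau.
have := measurableT_comp (progressive_restrict pX tT)
  (measurable_fun_pair mtau (@measurable_id _ (g_sigma_algebraType (F t)) setT)).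
by apply: eq_measurable_fun => w _ /=; rewrite in_itv/= tauT.
Qed.

Lemma progressive_integral (X : R -> Omega -> R) t : progressive T F X -> 0 <= t <= T ->
  (forall s w, 0 <= X s w) ->
  measurable_fun (`[0, t]%classic `*` [set: g_sigma_algebraType (F t)])
    (fun u : R * g_sigma_algebraType (F t) =>
       (\int[lebesgue_measure]_(s in `[0%R, u.1]) (X s u.2)%:E)%E).
Proof.
move=> pX tT X0.
(* The upper limit of integration becomes an indicator inside the integrand, so that Tonelli's
   theorem in the last variable gives joint measurability in the limit and in w. *)
pose f (x : (R * g_sigma_algebraType (F t)) * R) : \bar R :=
  (if x.2 <= x.1.1 then (if x.2 \in `[0, t] then X x.2 x.1.2 else 0) else 0)%:E.
have mf : measurable_fun setT f.
  apply/measurable_EFinP; apply: measurable_fun_ifT.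
  - by apply: measurable_fun_ler => //; exact: measurableT_comp.
  - pose sw (x : (R * g_sigma_algebraType (F t)) * R) : R * g_sigma_algebraType (F t) :=
      (x.2, x.1.2).
    have msw : measurable_fun setT sw.
      by apply: measurable_fun_pair => //; exact: measurableT_comp.
    exact: (measurableT_comp (progressive_restrict pX tT) msw).
  - exact: measurable_cst.
have f0 x : (0 <= f x)%E.
  by rewrite /f lee_fin; case: ifP => // _; case: ifP => // _; exact: X0.
have : measurable_fun setT (fubini_F lebesgue_measure f).
  exact: measurable_fun_fubini_tonelli_F.
move=> /(measurable_funS measurableT
  (@subsetT _ (`[0, t]%classic `*` [set: g_sigma_algebraType (F t)]))).
apply: eq_measurable_fun => -[s w]; rewrite inE/= in_itv/= => -[/andP[s0 st] _].
rewrite /fubini_F [RHS]integral_mkcond; apply: eq_integral => r _.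
rewrite /f patchE /=; case: ifPn => [rs|rs].
  case: ifPn; rewrite in_itv/=.
    move=> /andP[r0 _]; rewrite ifT//; apply/mem_set.
    by rewrite /= in_itv/= r0.
  rewrite negb_and -ltNge => r0; rewrite ifF//; apply/negbTE/negP.
  rewrite inE/= in_itv/= => /andP[r0' _]; move: r0.
  by rewrite ltNge r0'/= (le_trans rs).
by rewrite ifF//; apply/negbTE/negP; rewrite inE/= in_itv/= (negbTE rs) andbF.
Qed.

End Progressive.

Section QuadraticVariation.
Context {R : realType} {dO : measure_display} {Omega : measurableType dO}.
Context (P : probability Omega R) (T : R) (F : R -> set (set Omega)) (d : nat).
Context (Z : R -> Omega -> 'rV[R]_d).
Local Notation leb := (@lebesgue_measure R).
Hypotheses (T0 : 0 < T) (pZ : progressive_vec T F Z).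
Hypothesis F_sigma : forall t, sigma_algebra setT (F t).
Hypothesis F_mono : forall s t, s <= t -> F s `<=` F t.
Hypothesis F_negligible : forall t, P.-negligible `<=` F t.

Definition qvar_ext t w : \bar R :=
  (\int[leb]_(s in `[0%R, t]) (enorm (Z s w) ^+ 2)%:E)%E.

(* Paths of infinite energy form a null set, on which the process is set to 0
   so that it is continuous everywhere. *)
Definition qvar t w : R :=
  if (qvar_ext T w < +oo)%E then fine (qvar_ext t w) else 0.

Hypothesis qvar_fin : {ae P, forall w, (qvar_ext T w < +oo)%E}.

Lemma progressive_enorm : progressive T F (fun t w => enorm (Z t w) ^+ 2).
Proof.
move=> t tT.
rewrite [X in measurable_fun _ X](_ : _ =
  (fun u : R * g_sigma_algebraType (F t) => \sum_i Z u.1 u.2 0 i ^+ 2)).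
  by apply: measurable_sum => i; apply: measurable_funX; exact: (pZ i tT).
by apply/funext => u; rewrite enorm_sqr.
Qed.

Lemma qvar_path w : measurable_fun `[0, T] (fun t => enorm (Z t w) ^+ 2).
Proof. exact: progressive_path progressive_enorm (ltW T0). Qed.

Lemma qvar_integrable w : (qvar_ext T w < +oo)%E ->
  leb.-integrable `[0, T] (EFin \o (fun t => enorm (Z t w) ^+ 2)).
Proof.
move=> H; apply/integrableP; split; first by apply/measurable_EFinP; exact: qvar_path.
by under eq_integral do rewrite /= ger0_norm ?sqr_ge0//.
Qed.

Lemma qvar_ext_le s t w : s <= t -> t <= T -> (qvar_ext s w <= qvar_ext t w)%E.
Proof.
move=> st tT; apply: ge0_subset_integral => //=.
- apply/measurable_EFinP; apply: measurable_funS (qvar_path w) => //.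
  by apply: subset_itvl; rewrite bnd_simp.
- by move=> r _; rewrite lee_fin sqr_ge0.
- by apply: subset_itvl; rewrite bnd_simp.
Qed.

Lemma qvar_ext_ge0 t w : (0 <= qvar_ext t w)%E.
Proof. by apply: integral_ge0 => s _; rewrite lee_fin sqr_ge0. Qed.

Lemma qvarE t w : (qvar_ext T w < +oo)%E -> t <= T -> (qvar t w)%:E = qvar_ext t w.
Proof.
move=> H tT; rewrite /qvar H fineK// ge0_fin_numE ?qvar_ext_ge0//.
exact: le_lt_trans (qvar_ext_le _ _ _) H.
Qed.

Lemma qvar_ge0 t w : 0 <= qvar t w.
Proof. by rewrite /qvar; case: ifP => // _; rewrite fine_ge0// qvar_ext_ge0. Qed.

Lemma qvar0 w : qvar 0 w = 0.
Proof. by rewrite /qvar; case: ifP => // _; rewrite /qvar_ext set_itv1 integral_set1. Qed.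

Lemma qvar_le s t w : s <= t -> t <= T -> qvar s w <= qvar t w.
Proof.
move=> st tT; case H : (qvar_ext T w < +oo)%E.
  by rewrite -lee_fin !qvarE//; [exact: qvar_ext_le|exact: le_trans st tT].
by rewrite /qvar H.
Qed.

Lemma qvar_continuous w : {within `[0, T], continuous (qvar ^~ w)}.
Proof.
rewrite /qvar; case H : (qvar_ext T w < +oo)%E.
  exact: (parameterized_integral_continuous (ltW T0) (qvar_integrable H)).
by apply/within_continuous_eps => x _ e e0; exists 1 => // y _ _; rewrite subrr normr0.
Qed.

Lemma qvar_progressive : progressive T F qvar.
Proof.
move=> t tT.
have mI : measurable_fun (`[0, t]%classic `*` [set: g_sigma_algebraType (F t)])
    (fun u : R * g_sigma_algebraType (F t) => fine (qvar_ext u.1 u.2)).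
  apply: (measurableT_comp (fine_measurable measurableT)).
  apply: (progressive_integral progressive_enorm tT).
  by move=> s w; exact: sqr_ge0.
have mD : measurable (`[0, t]%classic `*` [set: g_sigma_algebraType (F t)]).
  by apply: measurableX.
(* Finite energy up to T looks into the future of t, but the complement is null and so belongs to
   every [F t]. *)
have mG : measurable ([set w | (qvar_ext T w < +oo)%E] : set (g_sigma_algebraType (F t))).
  rewrite -[X in measurable X]setCK; apply: measurableC.
  apply: sub_sigma_algebra; by apply: F_negligible; exact: qvar_fin.
apply: measurable_fun_if => //.
- apply: (@measurable_fun_bool _ _ _ _ true).
  rewrite (_ : _ `&` _ = `[0, t]%classic `*` [set w | (qvar_ext T w < +oo)%E]).
    exact: measurableX.
  by apply/seteqP; split => -[s w] /=; [case=> -[? _] ?|case=> ? ?].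
- by apply: measurable_funS mI => // u [].
Qed.

(* Adding t makes the clock strictly increasing, hence its hitting times stable under
   uniform convergence. *)
Definition clock t w := qvar t w + t.

Lemma clock_incr w s t : 0 <= s -> s < t -> t <= T -> clock s w < clock t w.
Proof. by move=> s0 st tT; rewrite /clock ler_ltD// qvar_le// ltW. Qed.

Lemma clock_continuous w : {within `[0, T], continuous (clock ^~ w)}.
Proof.
apply/within_continuous_eps => x xT e e0; have e20 : 0 < e / 2 by rewrite divr_gt0.
have [dl dl0 H] := (within_continuous_eps T _).1 (@qvar_continuous w) x xT _ e20.
exists (Num.min dl (e / 2)); first by rewrite lt_min dl0.
move=> y yT; rewrite lt_min => /andP[/(H y yT) H1 H2].
have -> : clock x w - clock y w = (qvar x w - qvar y w) + (x - y) by rewrite /clock; ring.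
by apply: (le_lt_trans (ler_normD _ _)); lra.
Qed.

Definition stop_at c w := hitting T (clock ^~ w) c.

Lemma stop_at_bounds c w : 0 <= c -> 0 <= stop_at c w <= T.
Proof. by move=> c0; apply: hitting_bounds => //; rewrite /clock qvar0 addr0. Qed.

Lemma clock_wrt t : 0 <= t <= T -> measurable_wrt (F t) (clock t).
Proof.
move=> /andP[t0 tT]; apply: measurable_funD; last exact: measurable_cst.
exact: progressive_section qvar_progressive t0 (lexx _) tT.
Qed.

Lemma stop_at_stopping c : 0 <= c -> stopping_time T F (stop_at c).
Proof.
move=> c0; split; first by move=> w; exact: stop_at_bounds.
move=> t /andP[t0]; rewrite le_eqVlt => /predU1P[->|tT].
  rewrite (_ : [set w | _] = setT).
    by have [h0 hC _] := F_sigma T; have := hC _ h0; rewrite setD0.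
  by apply/seteqP; split => w //= _; have /andP[] := stop_at_bounds w c0.
rewrite (_ : [set w | _] = clock t @^-1` `[c, +oo[%classic).
  apply: measurable_wrt_preimage => //; apply: clock_wrt.
  by rewrite t0 ltW.
apply/seteqP; split => w /=; rewrite in_itv/= andbT /stop_at;
  rewrite (@hitting_leE _ T (clock ^~ w) c T0) ?t0 ?tT//.
- by rewrite /clock qvar0 addr0.
- exact: clock_continuous.
- by move=> ? ?; exact: clock_incr.
- by rewrite /clock qvar0 addr0.
- exact: clock_continuous.
- by move=> ? ?; exact: clock_incr.
Qed.

Lemma stop_at_min_wrt c t : 0 <= c -> 0 <= t <= T ->
  measurable_wrt (F t) (fun w => Num.min t (stop_at c w)).
Proof.
move=> c0 /andP[t0 tT]; have [_ st] := stop_at_stopping c0.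
apply: (@measurability _ _ (g_sigma_algebraType (F t)) (measurableTypeR R) setT _ _ (RGenOInfty.measurableE R)).
move=> _ [_ [x ->] <-]; rewrite setTI.
have [tx|xt] := leP t x.
  rewrite (_ : _ @^-1` _ = set0); first exact: measurable0.
  apply/seteqP; split => w //=; rewrite in_itv/= andbT => /lt_le_trans.
  by move=> /(_ t); rewrite ge_min lexx => /(_ isT); rewrite ltNge tx.
have [x0|x0] := ltP x 0.
  rewrite (_ : _ @^-1` _ = setT); first exact: measurableT.
  apply/seteqP; split => w //= _; rewrite in_itv/= andbT lt_min xt.
  by have /andP[+ _] := stop_at_bounds w c0; exact: lt_le_trans.
rewrite (_ : _ @^-1` _ = ~` [set w | stop_at c w <= x]).
  apply: (measurableC (T := g_sigma_algebraType (F t))); apply: sub_sigma_algebra.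
  apply: (F_mono (ltW xt)); apply: st; rewrite x0/=.
  by rewrite (le_trans (ltW xt)).
apply/seteqP; split => w /=; rewrite in_itv/= andbT lt_min xt/=.
  by move=> h; apply/negP; rewrite -ltNge.
by move=> /negP; rewrite -ltNge.
Qed.


End QuadraticVariation.

(** * Limits under bounded moments *)

Section LimitTheorems.
Context {R : realType} {dO : measure_display} {Omega : measurableType dO}.
Context (P : probability Omega R).
Implicit Types (X Y : Omega -> R).

Definition ae_cvg (X_ : nat -> Omega -> R) X :=
  {ae P, forall w, forall e, 0 < e -> \forall n \near \oo, `|X_ n w - X w| < e}.

Lemma ae_cvgP (X_ : nat -> Omega -> R) X : ae_cvg X_ X ->
  {ae P, forall w, X_ n w @[n --> \oo] --> X w}.
Proof.
apply: filterS => w H; apply/cvgrPdist_lt => e e0.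
by apply: filterS (H e e0) => n; rewrite distrC.
Qed.

Lemma ae_cvg_intro (X_ : nat -> Omega -> R) X :
  {ae P, forall w, X_ n w @[n --> \oo] --> X w} -> ae_cvg X_ X.
Proof.
apply: filterS => w /cvgrPdist_lt H e e0.
by apply: filterS (H e e0) => n; rewrite distrC.
Qed.

(** The bound is required only eventually and up to e, because in the Burkholder estimate K is
    itself a limit of the bounds for the approximants. *)
Lemma fatou_ae (f_ : nat -> Omega -> \bar R) (f : Omega -> \bar R) (K : \bar R) :
  (forall n, measurable_fun setT (f_ n)) -> measurable_fun setT f ->
  (forall n w, 0 <= f_ n w)%E -> (forall w, 0 <= f w)%E ->
  {ae P, forall w, f_ n w @[n --> \oo] --> f w} ->
  (forall e : R, 0 < e -> \forall n \near \oo, (\int[P]_w f_ n w <= K + e%:E)%E) ->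
  (\int[P]_w f w <= K)%E.
Proof.
move=> mf_ mf f0_ f0 ff HK.
have mlim : measurable_fun setT (fun w => limn_einf (f_^~ w)).
  rewrite /limn_einf; apply: measurableT_comp => //.
  by apply: measurable_fun_limn_esup => n; exact: measurableT_comp.
have -> : (\int[P]_w f w = \int[P]_w limn_einf (f_^~ w))%E.
  apply: ae_eq_integral => //; apply: filterS ff => w fw _.
  by have [-> _] := cvg_limn_einf_sup fw.
apply: (le_trans (fatou P measurableT mf_ (fun n w _ => f0_ n w))).
apply/lee_addgt0Pr => e e0; have [N _ HN] := HK e e0.
rewrite limn_einf_lim; apply: lime_le; first exact: is_cvg_einfs.
exists N => // n /= Nn; apply: le_trans (HN n Nn).
by apply: ereal_inf_lbound; exists n => /=.
Qed.

Lemma fatou_powR (X_ : nat -> Omega -> R) X q (K : \bar R) : 0 < q ->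
  (forall n, measurable_fun setT (X_ n)) -> measurable_fun setT X -> ae_cvg X_ X ->
  (forall e : R, 0 < e -> \forall n \near \oo,
     (\int[P]_w (`|X_ n w| `^ q)%:E <= K + e%:E)%E) ->
  (\int[P]_w (`|X w| `^ q)%:E <= K)%E.
Proof.
move=> q0 mX_ mX XX HK; apply: (fatou_ae _ _ _ _ _ HK).
- move=> n; apply/measurable_EFinP; apply: (measurableT_comp (measurable_powR _)) => //.
  exact: measurableT_comp.
- apply/measurable_EFinP; apply: (measurableT_comp (measurable_powR _)) => //.
  exact: measurableT_comp.
- by move=> n w; rewrite lee_fin powR_ge0.
- by move=> w; rewrite lee_fin powR_ge0.
- apply: filterS (ae_cvgP XX) => w Xw; apply: cvg_EFin; first exact: nearW.
  have -> : fine \o (fun n => (`|X_ n w| `^ q)%:E) = (fun n => `|X_ n w| `^ q) by [].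
  (* Continuity of x^q is deduced from its derivative, available only for x > 0; the limit 0 is
     treated by hand. *)
  have [X0|X0] := eqVneq (X w) 0.
    rewrite X0 normr0 powR0 ?gt_eqF//; apply/cvgrPdist_lt => e e0.
    have d0 : 0 < e `^ q^-1 by rewrite powR_gt0.
    move/cvgrPdist_lt : Xw => /(_ _ d0); rewrite X0; apply: filterS => n.
    rewrite !sub0r !normrN (ger0_norm (powR_ge0 _ _)) => h.
    have : `|X_ n w| `^ q < (e `^ q^-1) `^ q.
      by apply: gt0_ltr_powR => //; rewrite nnegrE ?powR_ge0.
    by rewrite -powRrM mulVf ?gt_eqF// powRr1// ltW.
  have aX : 0 < `|X w| by rewrite normr_gt0.
  have c : {for `|X w|, continuous (fun x : R => x `^ q)}.
    apply: differentiable_continuous; apply/derivable1_diffP.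
    by apply: derivable_powR; rewrite in_itv/= aX.
  apply: (continuous_cvg _ c); exact: cvg_norm Xw.
Qed.

Lemma powR_integrable_measurable X q : 0 < q -> measurable_fun setT X ->
  measurable_fun setT (fun w => (`|X w| `^ q)%:E).
Proof.
move=> q0 mX; apply/measurable_EFinP; apply: (measurableT_comp (measurable_powR _)) => //.
exact: measurableT_comp.
Qed.

Lemma powR_integrable X q (K : R) : 1 <= q -> measurable_fun setT X ->
  (\int[P]_w (`|X w| `^ q)%:E <= K%:E)%E ->
  P.-integrable setT (EFin \o (fun w => `|X w| `^ q)) /\
  P.-integrable setT (EFin \o X).
Proof.
move=> q1 mX H; have q0 : 0 < q by exact: lt_le_trans q1.
have i1 : P.-integrable setT (EFin \o (fun w => `|X w| `^ q)).
  apply/integrableP; split; first exact: powR_integrable_measurable.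
  under eq_integral do rewrite /= ger0_norm ?powR_ge0//.
  exact: le_lt_trans H (ltry _).
split => //; apply: (@le_integrable _ _ _ P _ measurableT _
    (EFin \o (fun w => 1 + `|X w| `^ q))) => //.
- exact/measurable_EFinP.
- move=> w _; rewrite /= lee_fin; apply: le_trans (ler_norm _).
  have [X1|/ltW X1] := leP `|X w| 1; first by rewrite (le_trans X1)// lerDl powR_ge0.
  by rewrite (le_trans (le1r_powR X1 q1))// lerDr.
- apply: integrable_RD => //; exact: finite_measure_integrable_cst.
Qed.

Definition clip (N x : R) := Num.max (- N) (Num.min N x).

Lemma clip_norm N x : 0 <= N -> `|clip N x| <= N.
Proof.
move=> N0; rewrite /clip ler_norml; apply/andP; split; first by rewrite le_max lexx.
by rewrite ge_max ge_min lexx /=; lra.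
Qed.

Lemma clip_lip N x y : `|clip N x - clip N y| <= `|x - y|.
Proof.
wlog xy : x y / x <= y.
  by move=> H; have [/H//|/ltW/H] := leP x y; rewrite distrC [`|y - x|]distrC.
rewrite distrC [`|x - y|]distrC /clip.
have h1 : Num.min N x <= Num.min N y by rewrite le_min !ge_min lexx xy !orbT.
have h2 : Num.min N y - Num.min N x <= y - x.
  rewrite /Num.min; case: ltP => ? ; case: ltP => ?; lra.
rewrite ger0_norm ?ger0_norm ?subr_ge0//; last first.
  by rewrite ge_max !le_max lexx h1 !orbT.
apply: le_trans h2; move: h1; rewrite /Num.max.
by case: ltP => ?; case: ltP => ?; lra.
Qed.

Lemma clip_tail N q x : 0 < N -> 1 < q -> `|x - clip N x| <= `|x| `^ q / N `^ (q - 1).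
Proof.
move=> N0 q1; have q0 : 0 < q by exact: lt_trans q1.
have [xN|Nx] := leP `|x| N.
  have -> : clip N x = x.
    move: xN; rewrite ler_norml => /andP[a b].
    by rewrite /clip (min_idPr b) (max_idPr a).
  by rewrite subrr normr0 divr_ge0 ?powR_ge0.
have H1 : `|x - clip N x| <= `|x|.
  rewrite /clip; have [x0|x0] := leP 0 x.
    move: Nx; rewrite ger0_norm// => Nx; rewrite (min_idPl (ltW Nx)).
    rewrite (max_idPr _); last lra.
    by rewrite ger0_norm; lra.
  move: Nx; rewrite ltr0_norm// => Nx.
  rewrite (min_idPr _); last lra.
  rewrite (max_idPl _); last lra.
  by rewrite opprK ltr0_norm; lra.
apply: (le_trans H1); rewrite ler_pdivlMr ?powR_gt0//.
rewrite -(mulr_powRB1 (normr_ge0 x) q0) ler_wpM2l//.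
by apply: le_powR2r; [rewrite subr_ge0 ltW|exact: ltW|exact: ltW].
Qed.

Lemma bounded_cvg (Y_ : nat -> Omega -> R) (Y : Omega -> R) (M : R) :
  (forall n, measurable_fun setT (Y_ n)) -> measurable_fun setT Y ->
  (forall n w, `|Y_ n w| <= M) -> ae_cvg Y_ Y ->
  (\int[P]_w Y_ n w)%R @[n --> \oo] --> (\int[P]_w Y w)%R.
Proof.
move=> mY_ mY Yb YY.
have iM : P.-integrable setT (cst M%:E) by exact: finite_measure_integrable_cst.
have mE_ n : measurable_fun setT (EFin \o Y_ n) by exact/measurable_EFinP.
have mE : measurable_fun setT (EFin \o Y) by exact/measurable_EFinP.
have cE : {ae P, forall w, setT w -> (EFin \o Y_ n) w @[n --> \oo] --> (EFin \o Y) w}.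
  by apply: filterS (ae_cvgP YY) => w H _; apply: cvg_EFin => //; exact: nearW.
have bE : {ae P, forall w n, setT w -> (`|(EFin \o Y_ n) w| <= cst M%:E w)%E}.
  by apply: aeW => w n _; rewrite /= lee_fin.
have [iY _ cY] := @dominated_convergence _ _ _ P setT measurableT
  (fun n => EFin \o Y_ n) (EFin \o Y) (cst M%:E) mE_ mE cE iM bE.
rewrite /Rintegral; apply: fine_cvg; rewrite fineK//.
exact: integrable_fin_num.
Qed.

(* Uniform integrability follows from boundedness in L^q: the tails beyond level N
   are of order N^(1-q). *)
Lemma ui_cvg (X_ : nat -> Omega -> R) X q (K : R) : 1 < q ->
  (forall n, measurable_fun setT (X_ n)) -> measurable_fun setT X -> ae_cvg X_ X ->
  (forall n, \int[P]_w (`|X_ n w| `^ q)%:E <= K%:E)%E ->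
  forall D, measurable D ->
  (\int[P]_(w in D) X_ n w)%R @[n --> \oo] --> (\int[P]_(w in D) X w)%R.
Proof.
move=> q1 mX_ mX XX HK D mD; have q0 : 0 < q by exact: lt_trans q1.
have HX : (\int[P]_w (`|X w| `^ q)%:E <= K%:E)%E.
  apply: (fatou_powR q0 mX_ mX XX) => e e0; apply: nearW => n.
  by apply: (le_trans (HK n)); rewrite -EFinD lee_fin lerDl ltW.
have K0 : 0 <= K.
  by rewrite -lee_fin; apply: le_trans HX; apply: integral_ge0 => w _; rewrite lee_fin powR_ge0.
have [iXq iX] := powR_integrable (ltW q1) mX HX.
have iX_ n := powR_integrable (ltW q1) (mX_ n) (HK n).
apply/cvgrPdist_lt => e e0.
(* The tails of X and of [X_ n] beyond N cost at most K / N^(q-1) each; the other e/2 is kept for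
   the clipped difference. *)
have [N N0 HN] : exists2 N : R, 0 < N & 2 * K / N `^ (q - 1) < e / 2.
  pose a := 4 * K / e + 1; have a0 : 0 < a.
    by rewrite /a ltr_wpDl// divr_ge0 ?mulr_ge0// ltW.
  exists (a `^ (q - 1)^-1); first by rewrite powR_gt0.
  rewrite -powRrM mulVf ?gt_eqF ?subr_gt0// powRr1 ?(ltW a0)// ltr_pdivrMr//.
  have : e / 2 * a = 2 * K + e / 2 by rewrite /a; field; rewrite gt_eqF.
  by move=> ->; rewrite ltrDl divr_gt0.
pose Y_ n w := `|clip N (X_ n w) - clip N (X w)|.
have mclip (f : Omega -> R) : measurable_fun setT f -> measurable_fun setT (fun w => clip N (f w)).
  by move=> mf; apply: measurable_maxr => //; exact: measurable_minr.
have mY n : measurable_fun setT (Y_ n).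
  by apply: measurableT_comp => //; apply: measurable_funB; exact: mclip.
have Yb n w : `|Y_ n w| <= 2 * N.
  rewrite normr_id; apply: (le_trans (ler_normB _ _)).
  have := clip_norm (X_ n w) (ltW N0); have := clip_norm (X w) (ltW N0); lra.
have iY n : P.-integrable setT (EFin \o Y_ n).
  apply: (@le_integrable _ _ _ P _ measurableT _ (cst (2 * N)%:E)) => //.
  - exact/measurable_EFinP.
  - by move=> w _; rewrite /= lee_fin (le_trans (Yb n w))// ler_norm.
  - exact: finite_measure_integrable_cst.
have cY : (\int[P]_w Y_ n w)%R @[n --> \oo] --> (\int[P]_(w in setT) (0 : R))%R.
  apply: (@bounded_cvg _ _ (2 * N)) => //.
  apply: filterS XX => w H e' e'0; apply: filterS (H e' e'0) => n Hn.
  by rewrite subr0 normr_id (le_lt_trans (clip_lip _ _ _)).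
rewrite Rintegral_cst_prob in cY.
move/cvgrPdist_lt : cY => /(_ _ (divr_gt0 e0 (ltr0Sn R 1))); apply: filterS => n Hn.
have iXD : P.-integrable D (EFin \o X) by exact: integrableS iX.
have iX_D : P.-integrable D (EFin \o X_ n) by apply: integrableS (iX_ n).2.
have iB : P.-integrable setT (EFin \o (fun w => X w - X_ n w)).
  have := integrable_RD iX (integrable_RZl (-1) (iX_ n).2).
  by under [X in EFin \o X]eq_fun do rewrite mulN1r.
have iNB : P.-integrable setT (EFin \o (fun w => `|X w - X_ n w|)).
  exact: integrable_norm iB.
rewrite -RintegralB//; apply: (@le_lt_trans _ _ (\int[P]_w `|X w - X_ n w|)%R).
  apply: le_trans (le_normr_Rintegral mD _) _.
    exact: (integrableS measurableT mD (@subsetT _ _) iB).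
  rewrite /Rintegral; apply: fine_le.
  - apply: integrable_fin_num => //; exact: (integrableS measurableT mD (@subsetT _ _) iNB).
  - exact: integrable_fin_num.
  - by apply: ge0_subset_integral => //; case/integrableP : iNB.
pose M := N `^ (q - 1).
have M0 : 0 < M by rewrite powR_gt0.
have j1 : P.-integrable setT (EFin \o (fun w => M^-1 * (`|X w| `^ q + `|X_ n w| `^ q))).
  by apply: integrable_RZl; apply: integrable_RD => //; exact: (iX_ n).1.
apply: (@le_lt_trans _ _ (\int[P]_w (M^-1 * (`|X w| `^ q + `|X_ n w| `^ q) + Y_ n w))%R).
  apply: le_Rintegral => //; first exact: integrable_RD j1 (iY n).
  move=> w _.
  have := clip_tail (X w) N0 q1; have := clip_tail (X_ n w) N0 q1; rewrite -/M.
  rewrite mulrDr ![M^-1 * _]mulrC => H1 H2.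
  have -> : X w - X_ n w = (X w - clip N (X w)) - (X_ n w - clip N (X_ n w)) -
     (clip N (X_ n w) - clip N (X w)) by ring.
  apply: (le_trans (ler_normB _ _)); rewrite lerD2r.
  by apply: (le_trans (ler_normB _ _)); rewrite lerD.
rewrite RintegralD// RintegralZl//; last by apply: integrable_RD => //; exact: (iX_ n).1.
rewrite RintegralD//; last exact: (iX_ n).1.
have H1 : (\int[P]_w (`|X w| `^ q))%R <= K.
  by rewrite -lee_fin /Rintegral fineK//; exact: integrable_fin_num.
have H2 : (\int[P]_w (`|X_ n w| `^ q))%R <= K.
  by rewrite -lee_fin /Rintegral fineK; [exact: HK|exact: integrable_fin_num (iX_ n).1].
have H3 : M^-1 * ((\int[P]_w (`|X w| `^ q))%R + (\int[P]_w (`|X_ n w| `^ q))%R) < e / 2.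
  apply: le_lt_trans HN; rewrite [2 * K / _]mulrC -/M ler_wpM2l ?invr_ge0 ?(ltW M0)//.
  have -> : 2 * K = K + K by ring.
  exact: lerD.
have H4 : (\int[P]_w Y_ n w)%R < e / 2.
  by move: Hn; rewrite sub0r normrN => /(le_lt_trans (ler_norm _)).
by move: (ltrD H3 H4); rewrite -splitr.
Qed.

(** Path properties hold only almost surely; on a complete space, an event that agrees with a
    measurable one wherever such a property holds is still measurable. *)
Lemma complete_measurable (good : Omega -> Prop) (A S : set Omega) :
  measure_is_complete P -> {ae P, forall w, good w} -> measurable A ->
  (forall w, good w -> S w <-> A w) -> measurable S.
Proof.
move=> cP [N [mN N0 sN]] mA SA.
have good_out w : ~ N w -> good w.
  by move=> nN; apply: contrapT => ng; apply: nN; apply: sN.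
have -> : S = (A `\` N) `|` (S `&` N).
  apply/seteqP; split => w.
    move=> Sw; have [Nw|nN] := pselect (N w); first by right.
    by left; split => //; apply/SA => //; exact: good_out.
  by move=> [[Aw nN]|[]//]; apply/SA => //; exact: good_out.
apply: measurableU; first exact: measurableD.
by apply: cP; exists N; split => // w [].
Qed.

(** Borel-Cantelli, along indices at which the probability of exceeding 2^-n is below 2^-n for both
    sequences. One common subsequence is needed because integrands and integrals must converge
    together. *)
Lemma cvg_in_prob_subseq (X Y : nat -> Omega -> \bar R) :
  (forall (e : R) k, 0 < e -> measurable [set w | (e%:E <= X k w)%E]) ->
  (forall (e : R) k, 0 < e -> measurable [set w | (e%:E <= Y k w)%E]) ->
  cvg_in_prob0 P X -> cvg_in_prob0 P Y ->
  exists phi : nat -> nat, {ae P, forall w, forall e : R, 0 < e ->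
    \forall n \near \oo, (X (phi n) w < e%:E)%E /\ (Y (phi n) w < e%:E)%E}.
Proof.
move=> mX mY cX cY.
pose dl (n : nat) : R := (2 ^+ n)^-1.
have dl0 n : 0 < dl n by rewrite invr_gt0 exprn_gt0.
have H (Z : nat -> Omega -> \bar R) : cvg_in_prob0 P Z -> forall n, \forall k \near \oo,
    (P [set w | (dl n)%:E <= Z k w]%E < (dl n)%:E)%E.
  move=> cZ n; have /fine_cvgP[F C] := cZ _ (dl0 n).
  move/cvgrPdist_lt : C => /(_ _ (dl0 n)); apply: filterS2 F => k Fk.
  rewrite /= sub0r normrN => h.
  by rewrite -(fineK Fk) lte_fin; apply: (le_lt_trans (ler_norm _)).
have /choice[phi Hphi] n : exists k, (P [set w | (dl n)%:E <= X k w]%E < (dl n)%:E)%E /\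
    (P [set w | (dl n)%:E <= Y k w]%E < (dl n)%:E)%E.
  by have [k] := filter_ex (filterI (H X cX n) (H Y cY n)); exists k.
exists phi.
pose E n := [set w | ((dl n)%:E <= X (phi n) w)%E] `|` [set w | ((dl n)%:E <= Y (phi n) w)%E].
have mE n : measurable (E n) by apply: measurableU; [exact: mX|exact: mY].
(* Twice 2^-n, written as 4 / 2^(n+1) to match the geometric series used for the sum. *)
have PE n : (P (E n) <= (4 / (2 ^ (n + 1))%:R)%:E)%E.
  apply: (le_trans (measureU2 _ _ _)); [exact: mX|exact: mY|].
  have [H1 H2] := Hphi n; apply: (le_trans (leeD (ltW H1) (ltW H2))).
  rewrite -EFinD lee_fin /dl addn1 expnS natrM natrX; set x := 2 ^+ n.
  have x0 : 0 < x by rewrite exprn_gt0.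
  by rewrite [leRHS](_ : _ = x^-1 + x^-1)//; field; rewrite gt_eqF.
have sumE : (\sum_(n <oo) P (E n) < +oo)%E.
  have H1 := @cvg_geometric_eseries_half R 4 0.
  apply: (@le_lt_trans _ _ (4 / 2 ^+ 0)%:E); last exact: ltry.
  rewrite -(cvg_lim _ H1)//; apply: lee_nneseries => // n _.
have := @lim_sup_set_cvg0 _ _ _ P _ mE sumE; set N := lim_sup_set E => N0.
have mN : measurable N by apply: bigcap_measurable => // n _; apply: bigcup_measurable.
exists N; split => // w /= nH; apply: contrapT => nN; apply: nH => e e0.
have [n0 Hn0] : exists n0, forall n, (n0 <= n)%N -> ~ E n w.
  apply: contrapT => /forallNP h; apply: nN => n _.
  have /existsNP[j /not_implyP[nj /contrapT Ej]] := h n.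
  by exists j.
have [n1 Hn1] : exists n1, forall n, (n1 <= n)%N -> dl n <= e.
  have := cvg_geometric (1 : R) (_ : `|2^-1 : R| < 1); rewrite ger0_norm// invf_lt1// ltr1n.
  move=> /(_ isT)/cvgrPdist_lt/(_ e e0)[n1 _ h]; exists n1 => n nn.
  have := h n nn; rewrite sub0r normrN /geometric/= mul1r exprVn => /ltW.
  by rewrite ger0_norm// invr_ge0 exprn_ge0.
exists (maxn n0 n1) => // n /=; rewrite geq_max => /andP[h0 h1].
have := Hn0 n h0 => /not_orP[/negP + /negP]; rewrite -!ltNge => H1 H2.
by split; [apply: lt_le_trans H1 _|apply: lt_le_trans H2 _]; rewrite lee_fin Hn1.
Qed.

End LimitTheorems.

(** * Continuity and measurability of simple integrals *)

Section WithinContinuous.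
Context {R : realType}.
Implicit Types (T a : R) (f g : R -> R).

Lemma within_continuous_sum T (I : Type) (r : seq I) (f : I -> R -> R) :
  (forall i, {within `[0, T], continuous f i}) ->
  {within `[0, T], continuous (fun t => \sum_(i <- r) f i t)}.
Proof.
move=> H; elim: r => [|i r IH].
  rewrite (_ : (fun t => _) = fun=> 0); first by move=> x; exact: cvg_cst.
  by apply/funext => t; rewrite big_nil.
rewrite (_ : (fun t => _) = fun t => f i t + \sum_(j <- r) f j t).
  by move=> x; apply: cvgD; [exact: H|exact: IH].
by apply/funext => t; rewrite big_cons.
Qed.

Lemma within_continuous_min T a f : 0 <= a <= T -> {within `[0, T], continuous f} ->
  {within `[0, T], continuous (fun t => f (Num.min a t))}.
Proof.
move=> /andP[a0 aT] /within_continuous_eps H; apply/within_continuous_eps => x /andP[x0 xT] e e0.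
have minT y : 0 <= y -> 0 <= Num.min a y <= T by move=> y0; rewrite le_min a0 y0 ge_min aT.
have [dl dl0 {}H] := H _ (minT x x0) e e0; exists dl => // y /andP[y0 yT] xy.
apply: H; first exact: minT.
apply: le_lt_trans xy; rewrite /Num.min; case: ltP => ax; case: ltP => ay //.
- by rewrite subrr normr0.
- by rewrite ger0_norm ?subr_ge0//; apply: le_trans (ler_norm _); rewrite lerD2r ltW.
- rewrite distrC ger0_norm ?subr_ge0// distrC; apply: le_trans (ler_norm _).
  by rewrite lerD2r ltW.
Qed.

End WithinContinuous.

Section SupPath.
Context {R : realType} {dO : measure_display} {Omega : measurableType dO}.
Context (P : probability Omega R) (T : R) (P_complete : measure_is_complete P).

(** A continuous path approaches its supremum along the countably many times min(T, k/(j+1)) but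
    need not attain it there, whence the strict thresholds e - 1/(m+1) under an intersection. *)
Lemma sup_path_measurable (X : R -> Omega -> R) (e : R) : 0 <= T ->
  (forall t, 0 <= t <= T -> measurable_fun setT (X t)) -> as_continuous P T X ->
  measurable [set w | (e%:E <= ereal_sup [set `|X t w|%:E | t in `[0%R, T]])%E].
Proof.
move=> T0 mX cX.
pose q j k : R := Num.min T (k%:R / j.+1%:R).
have qT j k : 0 <= q j k <= T by rewrite le_min T0 divr_ge0//= ge_min lexx.
apply: (@complete_measurable _ _ _ P _
  (\bigcap_m \bigcup_j \bigcup_k [set w | e - m.+1%:R^-1 < `|X (q j k) w|]) _ P_complete cX).
  apply: bigcapT_measurable => m; apply: bigcupT_measurable => j; apply: bigcupT_measurable => k.
  have mA : measurable_fun setT (fun w => `|X (q j k) w|).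
    by apply: measurableT_comp => //; exact: mX.
  rewrite (_ : [set w | _] = (fun w => `|X (q j k) w|) @^-1` `]e - m.+1%:R^-1, +oo[%classic).
    by rewrite -[_ @^-1` _]setTI; exact: mA.
  by apply/seteqP; split => w /=; rewrite in_itv/= andbT.
move=> w /within_continuous_eps cw; split => /=.
  move=> eS m _.
  have : ((e - m.+1%:R^-1)%:E < ereal_sup [set `|X t w|%:E | t in `[0%R, T]])%E.
    by apply: lt_le_trans eS; rewrite lte_fin ltrBlDr ltrDl invr_gt0.
  move=> /ereal_sup_gt[_ [t /= tT <-]]; rewrite lte_fin => lt.
  rewrite in_itv/= in tT; have /andP[t0 tT'] := tT.
  have dd0 : 0 < `|X t w| - (e - m.+1%:R^-1) by rewrite subr_gt0.
  have [dl dl0 H] := cw t tT _ dd0.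
  have [j _ Hj] := near_infty_natSinv_lt (PosNum dl0).
  have {Hj} /= jdl := Hj j (leqnn j).
  have t0' : 0 <= t * j.+1%:R by rewrite mulr_ge0.
  pose k := Num.truncn (t * j.+1%:R).
  have /andP[k1 k2] := truncn_itv t0'; rewrite -/k in k1 k2.
  have k1' : k%:R / j.+1%:R <= t by rewrite ler_pdivrMr.
  have qE : q j k = k%:R / j.+1%:R by rewrite /q; apply/min_idPr; exact: le_trans k1' _.
  exists j => //; exists k => //=.
  have tq : `|t - q j k| < dl.
    rewrite qE ger0_norm ?subr_ge0//; apply: lt_trans jdl.
    by rewrite ltrBlDr -[X in X + _]mul1r -mulrDl ltr_pdivlMr// addrC natr1.
  have := H _ (qT j k) tq => /(le_lt_trans (lerB_dist _ _)).
  by rewrite ltrD2l ltrN2.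
move=> H; apply/lee_addgt0Pr => eps eps0.
have [m _ Hm] := near_infty_natSinv_lt (PosNum eps0).
have {Hm} /= meps := Hm m (leqnn m).
have [j _ [k _ /= jk]] := H m I.
apply: (@le_trans _ _ (`|X (q j k) w|%:E + eps%:E)%E).
  by rewrite -EFinD lee_fin -lerBlDr ltW// (lt_trans _ jk)// ltrD2l ltrN2.
rewrite leeD2r//; apply: ereal_sup_ubound; exists (q j k) => //=.
by rewrite in_itv/= qT.
Qed.

End SupPath.

Section SimpleIntegral.
Context {R : realType} {dO : measure_display} {Omega : measurableType dO}.
Context (P : probability Omega R) (T : R) (d : nat) (B : R -> Omega -> 'rV[R]_d).
Local Notation F := (brownian_filtration P B).
Local Notation leb := (@lebesgue_measure R).
Hypotheses (hB : is_brownian_motion P T B) (P_complete : measure_is_complete P).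
Hypothesis T0 : 0 < T.
Implicit Types H : simple_process R Omega d.

Lemma sp_eval_progressive H : simple_predictable T F H -> progressive_vec T F (sp_eval H).
Proof.
move=> [tT tm mv _] i t t0T.
rewrite [X in measurable_fun _ X](_ : _ = fun u : R * g_sigma_algebraType (F t) =>
  \sum_(k < sp_size H) (if sp_time H k < u.1 <= sp_time H k.+1 then sp_val H k u.2 0 i else 0)).
  apply: measurable_sum => -[k kH] /=.
  (* When t < [sp_time H k] the coefficient need not be measurable for [F t], but its indicator
     vanishes on [0, t]. *)
  have [kt|tk] := leP (sp_time H k) t.
    apply: measurable_funTS; apply: measurable_fun_ifT; last exact: measurable_cst.
      rewrite [X in measurable_fun _ X](_ : _ =
        (fun u : R * g_sigma_algebraType (F t) => u.1 \in `]sp_time H k, sp_time H k.+1])).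
        apply: (@measurable_fun_bool _ _ _ _ true); rewrite setTI.
        rewrite (_ : _ @^-1` _ = fst @^-1` `]sp_time H k, sp_time H k.+1]%classic)//.
        by rewrite -[_ @^-1` _]setTI; apply: measurable_fst.
      by apply/funext => u; rewrite in_itv.
    have mv' : measurable_wrt (F t) (fun w => sp_val H k w 0 i).
      by apply: measurable_wrt_sub (mv k i kH); exact: filtrationS.
    exact: (measurableT_comp mv' measurable_snd).
  have : measurable_fun (`[0, t]%classic `*` [set: g_sigma_algebraType (F t)])
    (fun=> 0 : R) by exact: measurable_cst.
  apply: eq_measurable_fun => -[s w]; rewrite inE/= in_itv/= => -[/andP[s0 st] _].
  by rewrite ltNge (le_trans st (ltW tk)).
by apply/funext => u; rewrite /sp_eval summxE big_mkcond.
Qed.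

Lemma sp_int_measurable H t : simple_predictable T F H -> 0 <= t <= T ->
  measurable_fun setT (sp_int B H t).
Proof.
move=> [tT tm mv _] /andP[t0 tT']; have [mB _ _ _ _] := hB.
have minT k : (k <= sp_size H)%N -> 0 <= Num.min (sp_time H k) t <= T.
  by move=> /tT/andP[k0 kT]; rewrite le_min k0 t0 ge_min kT.
apply: measurable_sum => -[k kH]; apply: measurable_sum => i /=.
apply: measurable_funM.
  apply: measurable_wrt_measurable (mv k i kH).
  by apply: (filtration_measurable hB P_complete); have /andP[] := tT k (ltnW kH).
by apply: measurable_funB; apply: mB; apply: minT => //; exact: ltnW.
Qed.

Lemma sp_int_continuous H w : simple_predictable T F H ->
  (forall i, {within `[0, T], continuous (fun t => B t w 0 i)}) ->
  {within `[0, T], continuous (fun t => sp_int B H t w)}.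
Proof.
move=> [tT _ _ _] cB; apply: within_continuous_sum => -[k kH].
apply: within_continuous_sum => i /= x; apply: cvgMr.
by apply: cvgB; apply: (@within_continuous_min _ T _ (fun t => B t w 0 i)) => //;
  apply: tT => //; exact: ltnW.
Qed.

Lemma sp_int_sup_measurable H (I : R -> Omega -> R) (e : R) :
  simple_predictable T F H -> in_S P T F I ->
  measurable [set w | (e%:E <=
    ereal_sup [set `|sp_int B H t w - I t w|%:E | t in `[0%R, T]])%E].
Proof.
move=> sH [pI cI]; have [_ _ cB _ _] := hB.
apply: (@sup_path_measurable _ _ _ P T P_complete (fun t w => sp_int B H t w - I t w)).
- exact: ltW.
- move=> t tT; have /andP[t0 tT'] := tT; apply: measurable_funB; first exact: sp_int_measurable.
  apply: measurable_wrt_measurable (progressive_section pI t0 (lexx _) tT').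
  exact: (filtration_measurable hB P_complete).
- apply: filterS2 cB cI => w cB cI x; apply: cvgB; last exact: cI.
  exact: (sp_int_continuous sH cB).
Qed.

Lemma sp_dist_measurable H (Z : R -> Omega -> 'rV[R]_d) (e : R) :
  simple_predictable T F H -> progressive_vec T F Z ->
  measurable [set w | (e%:E <=
    \int[leb]_(t in `[0%R, T]) (enorm (sp_eval H t w - Z t w) ^+ 2)%:E)%E].
Proof.
move=> sH pZ; have pD : progressive_vec T F (fun t w => sp_eval H t w - Z t w).
  move=> i t tT; rewrite (_ : (fun u => _) = (fun u : R * g_sigma_algebraType (F t) =>
    sp_eval H u.1 u.2 0 i - Z u.1 u.2 0 i)); last by apply/funext => u; rewrite !mxE.
  by apply: measurable_funB; [exact: sp_eval_progressive|exact: pZ].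
have TT : 0 <= T <= T by rewrite (ltW T0) lexx.
have mI := progressive_integral (progressive_enorm pD) TT (fun s w => sqr_ge0 _).
have mw : measurable_fun [set: g_sigma_algebraType (F T)]
    (fun w => \int[leb]_(t in `[0%R, T]) (enorm (sp_eval H t w - Z t w) ^+ 2)%:E)%E.
  apply: (measurable_comp _ _ mI (measurable_fun_pair (@measurable_cst _ _ _ _ setT T)
    (@measurable_id _ (g_sigma_algebraType (F T)) setT))).
    exact: measurableX.
  by move=> _ [w _ <-]; split => //=; rewrite in_itv/= (ltW T0) lexx.
have := emeasurable_fun_c_infty measurableT mw e%:E; rewrite setTI => m.
apply: (filtration_measurable hB P_complete (lexx T)).
by rewrite -(sigma_algebra_id (filtration_sigma P B T)).
Qed.

End SimpleIntegral.

(** * Approximation of the Ito integral *)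

Section Energy.
Context {R : realType}.
Local Notation leb := (@lebesgue_measure R).

(** Young's inequality. In both directions the small factor eta multiplies b, the fixed limit
    integrand, so the energies of the approximants need no prior bound. *)
Lemma enorm_sqr_le (d : nat) (a b : 'rV[R]_d) (eta : R) : 0 < eta ->
  enorm a ^+ 2 <= enorm b ^+ 2 + ((1 + eta^-1) * enorm (a - b) ^+ 2 + eta * enorm b ^+ 2) /\
  enorm b ^+ 2 <= enorm a ^+ 2 + ((1 + eta^-1) * enorm (a - b) ^+ 2 + eta * enorm b ^+ 2).
Proof.
move=> eta0; have etai : 0 < eta^-1 by rewrite invr_gt0.
have en : eta != 0 by rewrite gt_eqF.
rewrite !enorm_sqr !mulr_sumr -!big_split/=; split; apply: ler_sum => i _; rewrite !mxE.
- rewrite -subr_ge0 [X in 0 <= X](_ : _ = eta^-1 * (eta * b 0 i - (a 0 i - b 0 i)) ^+ 2).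
    by rewrite mulr_ge0 ?sqr_ge0 ?(ltW etai).
  by field.
- rewrite -subr_ge0 [X in 0 <= X](_ : _ =
    eta^-1 * (eta * b 0 i + (a 0 i - b 0 i)) ^+ 2 + 2 * (a 0 i - b 0 i) ^+ 2).
    by apply: addr_ge0; apply: mulr_ge0; rewrite ?sqr_ge0 ?(ltW etai).
  by field.
Qed.

Lemma integral_le_split (T t c1 c2 : R) (f g x y : R -> R) : t <= T -> 0 <= c1 -> 0 <= c2 ->
  measurable_fun `[0, T] f -> measurable_fun `[0, T] g ->
  measurable_fun `[0, T] x -> measurable_fun `[0, T] y ->
  (forall s, 0 <= f s) -> (forall s, 0 <= g s) -> (forall s, 0 <= x s) -> (forall s, 0 <= y s) ->
  (forall s, f s <= g s + (c1 * x s + c2 * y s)) ->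
  (\int[leb]_(s in `[0%R, t]) (f s)%:E <= \int[leb]_(s in `[0%R, t]) (g s)%:E +
    (c1%:E * \int[leb]_(s in `[0%R, T]) (x s)%:E + c2%:E * \int[leb]_(s in `[0%R, T]) (y s)%:E))%E.
Proof.
move=> tT c10 c20 mf mg mx my f0 g0 x0 y0 fg.
have sub : `[0, t]%classic `<=` `[0, T]%classic by apply: subset_itvl; rewrite bnd_simp.
have mt (h : R -> R) : measurable_fun `[0, T] h -> measurable_fun `[0, t] (fun s => (h s)%:E).
  by move=> mh; apply/measurable_EFinP; apply: measurable_funS mh.
have mT (h : R -> R) : measurable_fun `[0, T] h -> measurable_fun `[0, T] (fun s => (h s)%:E).
  by move=> mh; apply/measurable_EFinP.
have mz : measurable_fun `[0, T] (fun s => c1 * x s + c2 * y s).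
  by apply: measurable_funD; apply: measurable_funM.
have z0 s : 0 <= c1 * x s + c2 * y s by rewrite addr_ge0 ?mulr_ge0.
apply: (@le_trans _ _ (\int[leb]_(s in `[0%R, t]) ((g s)%:E + (c1 * x s + c2 * y s)%:E))%E).
  apply: ge0_le_integral => //=.
  - by move=> s _; rewrite lee_fin.
  - exact: mt.
  - by apply: emeasurable_funD; exact: mt.
  - by move=> s _; rewrite -EFinD lee_fin.
rewrite ge0_integralD//=; last 4 first.
- by move=> s _; rewrite lee_fin.
- exact: mt.
- by move=> s _; rewrite lee_fin.
- exact: mt.
rewrite leeD2l//.
apply: (@le_trans _ _ (\int[leb]_(s in `[0%R, T]) (c1 * x s + c2 * y s)%:E)%E).
  apply: ge0_subset_integral => //=; first exact: mT.
  by move=> s _; rewrite lee_fin.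
under eq_integral do rewrite EFinD !EFinM.
rewrite ge0_integralD//=; last 4 first.
- by move=> s _; rewrite -EFinM lee_fin mulr_ge0.
- by apply: (mT (fun s => c1 * x s)); exact: measurable_funM.
- by move=> s _; rewrite -EFinM lee_fin mulr_ge0.
- by apply: (mT (fun s => c2 * y s)); exact: measurable_funM.
rewrite ge0_integralZl_EFin//=; [|by move=> s _; rewrite lee_fin|exact: mT].
by rewrite ge0_integralZl_EFin//=; [move=> s _; rewrite lee_fin|exact: mT].
Qed.

End Energy.

Section ItoApproximation.
Context {R : realType} {dO : measure_display} {Omega : measurableType dO}.
Context (P : probability Omega R) (T : R) (d : nat) (B : R -> Omega -> 'rV[R]_d).
Local Notation F := (brownian_filtration P B).
Local Notation leb := (@lebesgue_measure R).
Hypotheses (hB : is_brownian_motion P T B) (P_complete : measure_is_complete P).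
Hypothesis T0 : 0 < T.
Context (Z : R -> Omega -> 'rV[R]_d) (I : R -> Omega -> R).
Hypotheses (pZ : progressive_vec T F Z) (SI : in_S P T F I).
Hypothesis qvar_fin : {ae P, forall w, (qvar_ext Z T w < +oo)%E}.
Context (H : nat -> simple_process R Omega d).
Hypothesis sH : forall n, simple_predictable T F (H n).
Hypothesis Hcvg : {ae P, forall w, forall e : R, 0 < e -> \forall n \near \oo,
  (\int[leb]_(t in `[0%R, T]) (enorm (sp_eval (H n) t w - Z t w) ^+ 2)%:E < e%:E)%E /\
  (ereal_sup [set `|sp_int B (H n) t w - I t w|%:E | t in `[0%R, T]] < e%:E)%E}.

(** The error is uniform in t because both error integrals are taken over all of [0, T]; this
    permits evaluation at grid times that depend on the path. *)
Lemma energy_cvg w : (qvar_ext Z T w < +oo)%E ->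
  (forall e : R, 0 < e -> \forall n \near \oo,
    (\int[leb]_(t in `[0%R, T]) (enorm (sp_eval (H n) t w - Z t w) ^+ 2)%:E < e%:E)%E) ->
  forall e, 0 < e -> \forall n \near \oo, forall t q, 0 <= t <= T ->
    (\int[leb]_(s in `[0%R, t]) (enorm (sp_eval (H n) s w) ^+ 2)%:E = q%:E)%E ->
    `|q - qvar T Z t w| <= e.
Proof.
move=> fin D e e0; pose A := qvar T Z T w.
have A0 : 0 <= A by exact: qvar_ge0.
have A1 : 0 < 2 * (A + 1) by rewrite mulr_gt0// ltr_wpDl.
(* This makes the Young term eta A at most e/2; the + 1 guards against A = 0. *)
pose eta := e / (2 * (A + 1)); have eta0 : 0 < eta by rewrite divr_gt0.
have etai : 0 < 1 + eta^-1 by rewrite addr_gt0// invr_gt0.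
have etaA : eta * A <= e / 2.
  rewrite /eta mulrAC ler_pdivrMr//.
  have -> : e / 2 * (2 * (A + 1)) = e * (A + 1) by field.
  by rewrite ler_pM2l// lerDl.
have dl0 : 0 < e / 2 / (1 + eta^-1) by rewrite !divr_gt0.
apply: filterS (D _ dl0) => n Dn t q tT Eq; have /andP[t0 tT'] := tT.
have mZ : measurable_fun `[0, T] (fun s => enorm (Z s w) ^+ 2) by exact: qvar_path T0 pZ w.
have mHi i : measurable_fun `[0, T] (fun s => sp_eval (H n) s w 0 i).
  by apply: measurable_funTS; exact: sp_eval_measurable.
have mH : measurable_fun `[0, T] (fun s => enorm (sp_eval (H n) s w) ^+ 2).
  rewrite [X in measurable_fun _ X](_ : _ = fun s => \sum_i sp_eval (H n) s w 0 i ^+ 2).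
    by apply: measurable_sum => i; apply: measurable_funX.
  by apply/funext => s; rewrite enorm_sqr.
have mD : measurable_fun `[0, T] (fun s => enorm (sp_eval (H n) s w - Z s w) ^+ 2).
  rewrite [X in measurable_fun _ X](_ : _ =
      fun s => \sum_i (sp_eval (H n) s w 0 i - Z s w 0 i) ^+ 2).
    apply: measurable_sum => i; apply: measurable_funX; apply: measurable_funB => //.
    exact: (progressive_path w (pZ i) (ltW T0)).
  by apply/funext => s; rewrite enorm_sqr; apply: eq_bigr => i _; rewrite !mxE.
have QE : (\int[leb]_(s in `[0%R, t]) (enorm (Z s w) ^+ 2)%:E)%E = (qvar T Z t w)%:E.
  by rewrite (qvarE T0 pZ fin tT').
have AE : (\int[leb]_(s in `[0%R, T]) (enorm (Z s w) ^+ 2)%:E)%E = A%:E.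
  by rewrite (qvarE T0 pZ fin).
have small : ((1 + eta^-1)%:E * \int[leb]_(s in `[0%R, T])
     (enorm (sp_eval (H n) s w - Z s w) ^+ 2)%:E +
   eta%:E * \int[leb]_(s in `[0%R, T]) (enorm (Z s w) ^+ 2)%:E <= e%:E)%E.
  rewrite AE (_ : e%:E = (e / 2)%:E + (e / 2)%:E)%E; last by rewrite -EFinD -splitr.
  apply: leeD; last by rewrite -EFinM lee_fin.
  apply: (@le_trans _ _ ((1 + eta^-1)%:E * (e / 2 / (1 + eta^-1))%:E)%E).
    by rewrite lee_pmul2l// ltW.
  by rewrite -EFinM lee_fin mulrC divfK// gt_eqF.
have sq (f : R -> 'rV[R]_d) s : 0 <= enorm (f s) ^+ 2 by exact: sqr_ge0.
have up := integral_le_split tT' (ltW etai) (ltW eta0) mH mZ mD mZ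
  (fun s => sqr_ge0 _) (fun s => sqr_ge0 _) (fun s => sqr_ge0 _) (fun s => sqr_ge0 _)
  (fun s => (enorm_sqr_le (sp_eval (H n) s w) (Z s w) eta0).1).
have lo := integral_le_split tT' (ltW etai) (ltW eta0) mZ mH mD mZ
  (fun s => sqr_ge0 _) (fun s => sqr_ge0 _) (fun s => sqr_ge0 _) (fun s => sqr_ge0 _)
  (fun s => (enorm_sqr_le (sp_eval (H n) s w) (Z s w) eta0).2).
have {}up := le_trans up (leeD2l _ small).
have {}lo := le_trans lo (leeD2l _ small).
rewrite Eq QE -EFinD lee_fin in up; rewrite Eq QE -EFinD lee_fin in lo.
by rewrite ler_distl lerBlDr lo up.
Qed.

(** The truncated sums are evaluated at a path-dependent grid time, which is harmless because the
    integrals of the simple processes converge uniformly in time. Continuity of I and [qvar] absorbs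
    the distance from that grid time to the stopping time. *)
Lemma ito_truncated_cvg (u : nat -> nat -> R) (N p : nat -> nat) (c t : R) :
  (forall n, refines T (H n) (u n) (N n)) ->
  (forall n k, u n k.+1 - u n k <= T / n.+1%:R) ->
  (forall n, u n (p n) = t) -> 0 <= t <= T -> 0 <= c ->
  let h n := truncated_coef (u n) (refined_coef (H n) (u n)) c in
  ae_cvg P (fun n w => disc_int B (u n) (h n) (p n) w)
           (fun w => I (Num.min t (stop_at T Z c w)) w) /\
  ae_cvg P (fun n w => disc_quad (u n) (h n) (p n) w)
           (fun w => qvar T Z (Num.min t (stop_at T Z c w)) w).
Proof.
move=> rf mesh upt tT c0 h; have [pI cI] := SI; have /andP[t0 tT'] := tT.
suff : {ae P, forall w, forall e, 0 < e -> \forall n \near \oo,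
    `|disc_int B (u n) (h n) (p n) w - I (Num.min t (stop_at T Z c w)) w| < e /\
    `|disc_quad (u n) (h n) (p n) w - qvar T Z (Num.min t (stop_at T Z c w)) w| < e}.
  by move=> K; split; apply: filterS K => w K e e0; apply: filterS (K e e0) => n [].
apply: (filterS3 _ _ qvar_fin Hcvg cI) => w fin HD cIw.
have D1 e : 0 < e -> \forall n \near \oo,
    (\int[leb]_(t in `[0%R, T]) (enorm (sp_eval (H n) t w - Z t w) ^+ 2)%:E < e%:E)%E.
  by move=> e0; apply: filterS (HD e e0) => n [].
have En := energy_cvg fin D1.
have adm n := refined_admissible (sH n) (rf n).
have /choice[j Hj] n := (exists2P _ _).1 (truncated_sums (adm n) c (p n) w).
pose s n := u n (j n).
have jp n : (j n <= p n)%N by case: (Hj n).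
have gT n k : 0 <= u n k <= T by have [[+ _ _ _] _] := rf n; exact.
have s0t n : 0 <= s n <= t.
  have [g _] := rf n; rewrite -(upt n) (is_grid_mono g (jp n)) andbT.
  by have /andP[] := gT n (j n).
have sT n : 0 <= s n <= T by exact: gT.
have C0c : clock T Z 0 w <= c by rewrite /clock qvar0 addr0.
have cont : {within `[0, T], continuous (clock T Z ^~ w)}.
  exact: (@clock_continuous _ _ _ _ _ _ _ T0 pZ w).
have incr := clock_incr T0 pZ w.
have quadE n k : (\int[leb]_(r in `[0%R, u n k]) (enorm (sp_eval (H n) r w) ^+ 2)%:E)%E =
    (disc_quad (u n) (refined_coef (H n) (u n)) k w)%:E.
  exact: (integral_sp_eval (rf n) k w).
have conv := @hitting_converge _ T (clock T Z ^~ w) c T0 C0c cont incr t s tT s0t.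
have {}conv : forall e, 0 < e -> \forall n \near \oo, `|s n - Num.min t (stop_at T Z c w)| < e.
  (* At the index where the path is frozen the discrete clock is at most c, and at the next grid
     point, at most one mesh away, it exceeds c unless t is already reached. [energy_cvg] exchanges
     the discrete clock for the limiting one. *)
  apply: conv.
    move=> e e0; apply: filterS (En e e0) => n Hn.
    have [_ [_ _ [j0|le] _]] := Hj n.
      have [[_ _ u0 _] _] := rf n; rewrite /s j0 u0.
      by rewrite (le_trans C0c)// lerDl ltW.
    have := Hn _ _ (sT n) (quadE n (j n)); rewrite ler_distl => /andP[H1 H2].
    by rewrite /clock (le_trans _ (lerD le (lexx e)))// [leRHS]addrAC lerD2r -lerBlDr.
  move=> e e0.
  have mesh0 : \forall n \near \oo, T / n.+1%:R < e.
    have := near_infty_natSinv_lt (PosNum (divr_gt0 e0 T0)); apply: filterS => n /=.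
    by rewrite ltr_pdivlMr// mulrC.
  apply: filterS2 mesh0 (En e e0) => n mn Hn.
  have [_ [_ _ _ [jE|gt]]] := Hj n; first by left; rewrite /s jE upt.
  right; exists (u n (j n).+1); have /andP[_ uT] := gT n (j n).+1; split => //.
  - by have [g _] := rf n; exact: (is_grid_mono g).
  - by rewrite -lerBlDl; apply: le_trans (mesh n (j n)) (ltW mn).
  - have := Hn _ _ (gT n (j n).+1) (quadE n (j n).+1); rewrite ler_distl => /andP[H1 H2].
    by rewrite /clock lerBlDr (le_trans (ltW gt))// [leRHS]addrAC lerD2r.
have /andP[st0 stT] := stop_at_bounds Z T0 w c0.
set m := Num.min t (stop_at T Z c w) in conv *.
have mT : 0 <= m <= T by rewrite /m le_min t0 st0 ge_min tT'.
move=> e e0; have e2 : 0 < e / 2 by rewrite divr_gt0.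
have [d1 d10 H1] := (within_continuous_eps T (I ^~ w)).1 cIw m mT _ e2.
have [d2 d20 H2] := (within_continuous_eps T (fun t => qvar T Z t w)).1
  (@qvar_continuous _ _ _ _ _ _ _ T0 pZ w) m mT _ e2.
have Hsup : \forall n \near \oo,
    (ereal_sup [set `|sp_int B (H n) t w - I t w|%:E | t in `[0%R, T]] < (e / 2)%:E)%E.
  by apply: filterS (HD _ e2) => n [].
have d0 : 0 < Num.min d1 d2 by rewrite lt_min d10.
apply: filterS3 (conv _ d0) Hsup (En _ e2) => n; rewrite distrC lt_min => /andP[c1 c2] supn En'.
have [_ [-> -> _ _]] := Hj n.
have {H1} I1 := H1 _ (sT n) c1; have {H2} I2 := H2 _ (sT n) c2.
split.
  rewrite -(sp_int_refined (sH n) (rf n)) -/(s n).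
  have S1 : `|sp_int B (H n) (s n) w - I (s n) w| < e / 2.
    rewrite -lte_fin; apply: le_lt_trans supn; apply: ereal_sup_ubound.
    by exists (s n) => //=; rewrite in_itv/= sT.
  rewrite (_ : _ - _ = (sp_int B (H n) (s n) w - I (s n) w) - (I m w - I (s n) w)); last by ring.
  by apply: (le_lt_trans (ler_normB _ _)); rewrite [ltRHS]splitr ltrD.
have S1 := En' _ _ (sT n) (quadE n (j n)).
rewrite (_ : _ - _ = (disc_quad (u n) (refined_coef (H n) (u n)) (j n) w - qvar T Z (s n) w) -
  (qvar T Z m w - qvar T Z (s n) w)); last by ring.
by apply: (le_lt_trans (ler_normB _ _)); rewrite [ltRHS]splitr ler_ltD.
Qed.

Lemma ito_approx (s : nat -> R) (m : nat) (c : R) :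
  (forall i, (i <= m)%N -> 0 <= s i <= T) -> (forall i, (i < m)%N -> s i < s i.+1) -> 0 <= c ->
  exists (u : nat -> nat -> R) (h : nat -> nat -> Omega -> 'rV[R]_d) (p : nat -> nat -> nat),
  [/\ forall n, disc_admissible P T B (u n) (h n),
      forall n i, (i <= m)%N -> u n (p n i) = s i,
      forall n i, (i < m)%N -> (p n i < p n i.+1)%N,
      forall n k w, disc_quad (u n) (h n) k w <= c &
      forall i, (i <= m)%N ->
        ae_cvg P (fun n w => disc_int B (u n) (h n) (p n i) w)
          (fun w => I (Num.min (s i) (stop_at T Z c w)) w) /\
        ae_cvg P (fun n w => disc_quad (u n) (h n) (p n i) w)
          (fun w => qvar T Z (Num.min (s i) (stop_at T Z c w)) w)].
Proof.
move=> sT slt c0.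
(* The jump times of [H n] make the discrete integral exact on the grid; the times s i keep weights
   adapted and martingale identities exact before the limit. The mesh T/(n+1) is added by
   [exists_fine_grid]. *)
pose l n := [seq sp_time (H n) k | k <- iota 0 (sp_size (H n)).+1] ++
  [seq s k | k <- iota 0 m.+1].
have lT n : all (fun x => 0 <= x <= T) (l n).
  rewrite all_cat; apply/andP; split; apply/allP => x /mapP[k]; rewrite mem_iota add0n ltnS /=.
    by move=> km ->; have [+ _ _ _] := sH n; exact.
  by move=> km ->; exact: sT.
have /choice[u Hu] n := exists_fine_grid n T0 (lT n).
have /choice[N HN] n := Hu n.
have rf n : refines T (H n) (u n) (N n).
  have [g og _] := HN n; split => // k kH; apply: og; rewrite mem_cat; apply/orP; left.
  by apply/mapP; exists k => //; rewrite mem_iota add0n ltnS.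
have /choice[p Hp] n : exists q : nat -> nat, forall i, (i <= m)%N -> u n (q i) = s i.
  have /choice[q Hq] i : exists k, (i <= m)%N -> u n k = s i.
    have [im|mi] := leqP i m; last by exists 0%N.
    have [_ og _] := HN n; have [k _ <-] : on_grid (u n) (N n) (s i).
      apply: og; rewrite mem_cat; apply/orP; right.
      by apply/mapP; exists i => //; rewrite mem_iota add0n ltnS.
    by exists k.
  by exists q.
have adm n := refined_admissible (sH n) (rf n).
exists u, (fun n => truncated_coef (u n) (refined_coef (H n) (u n)) c), p; split => //.
- by move=> n; exact: (truncated_admissible hB P_complete (adm n)).
- move=> n i im; rewrite ltnNge; apply/negP => le.
  have [g _ _] := HN n; have := is_grid_mono g le.
  by rewrite !Hp ?(ltnW im)// leNgt slt.
- by move=> n k w; exact: (truncated_quad_le (adm n)).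
- move=> i im; apply: (@ito_truncated_cvg u N (fun n => p n i) c (s i)) => //.
  + by move=> n k; have [_ _] := HN n; exact.
  + by move=> n; exact: Hp.
  + exact: sT.
Qed.

End ItoApproximation.

(** * Martingale property, bracket and moments *)

Section MartingaleCriterion.
Context {R : realType} {dO : measure_display} {Omega : measurableType dO}.
Context (P : probability Omega R).

Lemma ae_cvg_add1_powR (A_ : nat -> Omega -> R) (A : Omega -> R) (r : R) :
  (forall w, 0 <= A w) -> ae_cvg P A_ A ->
  ae_cvg P (fun n w => (1 + A_ n w) `^ r) (fun w => (1 + A w) `^ r).
Proof.
move=> A0 /ae_cvgP AA; apply: ae_cvg_intro; apply: filterS AA => w Aw.
have c : {for 1 + A w, continuous (fun x : R => x `^ r)}.
  apply: differentiable_continuous; apply/derivable1_diffP.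
  by apply: derivable_powR; rewrite in_itv/= andbT ltr_pwDl.
by apply: (continuous_cvg _ c); apply: cvgD; [exact: cvg_cst|exact: Aw].
Qed.

Lemma cvg_sum_seq (J : Type) (r : seq J) (f : nat -> J -> R) (l : J -> R) :
  (forall i, f n i @[n --> \oo] --> l i) ->
  (\sum_(i <- r) f n i) @[n --> \oo] --> \sum_(i <- r) l i.
Proof.
move=> H; elim: r => [|i r IH].
  rewrite big_nil (_ : (fun n => _) = fun=> 0); first exact: cvg_cst.
  by apply/funext => n; rewrite big_nil.
rewrite big_cons (_ : (fun n => _) = fun n => f n i + \sum_(j <- r) f n j).
  by apply: cvgD.
by apply/funext => n; rewrite big_cons.
Qed.

Lemma martingale_intro (T : R) (F : R -> set (set Omega)) (M : R -> Omega -> R) :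
  (forall t, t <= T -> F t `<=` measurable) ->
  (forall t, 0 <= t <= T -> measurable_wrt (F t) (M t)) ->
  (forall t, 0 <= t <= T -> P.-integrable setT (EFin \o M t)) ->
  (forall s t D, 0 <= s -> s < t -> t <= T -> F s D ->
     (\int[P]_(w in D) M t w)%R = (\int[P]_(w in D) M s w)%R) ->
  martingale P T F M.
Proof.
move=> Fm aM iM H; split => // s t s0 st tT.
have sT : 0 <= s <= T by rewrite s0 (le_trans st).
have tT' : 0 <= t <= T by rewrite (le_trans s0).
split; [exact: aM|exact: iM|].
move=> D FD; have mD : measurable D by apply: (Fm s) FD; case/andP: sT.
move: st; rewrite le_eqVlt => /predU1P[->//|st].
have E r : 0 <= r <= T ->
    (\int[P]_(w in D) (M r w)%:E = ((\int[P]_(w in D) M r w)%R)%:E)%E.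
  move=> rT; rewrite /Rintegral fineK//; apply: integrable_fin_num => //.
  exact: (integrableS measurableT mD (@subsetT _ _) (iM r rT)).
by rewrite !E// (H s t).
Qed.

Lemma integrable_le (X Y : Omega -> R) : measurable_fun setT X ->
  (forall w, 0 <= X w <= Y w) -> P.-integrable setT (EFin \o Y) ->
  P.-integrable setT (EFin \o X).
Proof.
move=> mX XY iY; apply: (@le_integrable _ _ _ P _ measurableT _ (EFin \o Y)) => //.
  exact/measurable_EFinP.
move=> w _; have /andP[X0 {}XY] := XY w.
by rewrite /= lee_fin !ger0_norm// (le_trans X0).
Qed.

Lemma sqr_sub_le (a y c : R) : y ^+ 2 <= c ^+ 2 -> (a - y) ^+ 2 <= 2 * a ^+ 2 + 2 * c ^+ 2.
Proof. by move=> yc; have := sqr_ge0 (a + y); nra. Qed.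

Lemma Rintegral_indic (D : set Omega) (X : Omega -> R) :
  (\int[P]_(w in D) X w)%R = (\int[P]_w (\1_D w * X w))%R.
Proof.
by rewrite Rintegral_mkcond patch_indic; apply: eq_Rintegral => w _; rewrite /= mulrC.
Qed.

(** Fatou's lemma handles the left side and bounded convergence the right one. The level c only
    bounds the brackets along the sequence and does not enter the resulting constant. *)
Lemma moment_limit (q C c : R) (X_ Q_ : nat -> Omega -> R) (X Q : Omega -> R) :
  0 < q -> 0 <= C ->
  (forall n, measurable_fun setT (X_ n)) -> measurable_fun setT X ->
  (forall n, measurable_fun setT (Q_ n)) -> measurable_fun setT Q ->
  (forall n w, 0 <= Q_ n w <= c) -> (forall w, 0 <= Q w) ->
  ae_cvg P X_ X -> ae_cvg P Q_ Q ->
  (forall n, \int[P]_w (`|X_ n w| `^ q)%:E <=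
     (C * (\int[P]_w ((1 + Q_ n w) `^ (q / 2)))%R)%:E)%E ->
  (\int[P]_w (`|X w| `^ q)%:E <= (C * (\int[P]_w ((1 + Q w) `^ (q / 2)))%R)%:E)%E.
Proof.
move=> q0 C0 mX_ mX mQ_ mQ Qb Q0 XX QQ HK.
have q20 : 0 <= q / 2 by rewrite divr_ge0 ?(ltW q0).
have m1 (f : Omega -> R) : measurable_fun setT f ->
    measurable_fun setT (fun w => (1 + f w) `^ (q / 2)).
  by move=> mf; apply: (measurableT_comp (measurable_powR _)); exact: measurable_funD.
have cv : (\int[P]_w ((1 + Q_ n w) `^ (q / 2)))%R @[n --> \oo] -->
    (\int[P]_w ((1 + Q w) `^ (q / 2)))%R.
  apply: (@bounded_cvg _ _ _ P _ _ ((1 + c) `^ (q / 2))).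
  - by move=> n; exact: m1.
  - exact: m1.
  - move=> n w; have /andP[Qn0 Qnc] := Qb n w.
    by rewrite ger0_norm ?powR_ge0// le_powR2r ?lerD2l// addr_ge0.
  - exact: ae_cvg_add1_powR.
apply: (fatou_powR q0 mX_ mX XX) => e e0.
have C1 : 0 < C + 1 by rewrite ltr_wpDl.
move/cvgrPdist_lt : cv => /(_ _ (divr_gt0 e0 C1)); apply: filterS => n Hn.
apply: (le_trans (HK n)); rewrite -EFinD lee_fin.
set a := (\int[P]_w ((1 + Q_ n w) `^ (q / 2)))%R in Hn *.
set b := (\int[P]_w ((1 + Q w) `^ (q / 2)))%R in Hn *.
have ab : a <= b + e / (C + 1).
  by move: Hn; rewrite ltr_distlC => /andP[_ /ltW].
apply: (le_trans (ler_wpM2l C0 ab)); rewrite mulrDr lerD2l mulrA ler_pdivrMr// mulrC.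
by rewrite ler_pM2l// lerDl.
Qed.

Lemma ui_Rintegral_eq (q K : R) (X_ Y_ : nat -> Omega -> R) (X Y : Omega -> R) (D : set Omega) :
  1 < q -> measurable D ->
  (forall n, measurable_fun setT (X_ n)) -> measurable_fun setT X -> ae_cvg P X_ X ->
  (forall n, measurable_fun setT (Y_ n)) -> measurable_fun setT Y -> ae_cvg P Y_ Y ->
  (forall n, \int[P]_w (`|X_ n w| `^ q)%:E <= K%:E)%E ->
  (forall n, \int[P]_w (`|Y_ n w| `^ q)%:E <= K%:E)%E ->
  (forall n, (\int[P]_(w in D) X_ n w)%R = (\int[P]_(w in D) Y_ n w)%R) ->
  (\int[P]_(w in D) X w)%R = (\int[P]_(w in D) Y w)%R.
Proof.
move=> q1 mD mX_ mX XX mY_ mY YY KX KY E.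
have H1 := ui_cvg q1 mX_ mX XX KX mD.
have H2 := ui_cvg q1 mY_ mY YY KY mD.
have -> : \int[P]_(w in D) X w = limn (fun n => \int[P]_(w in D) X_ n w).
  by apply/esym/cvg_lim.
by under eq_fun do rewrite E; exact: cvg_lim.
Qed.

End MartingaleCriterion.

Section ItoMartingale.
Context {R : realType} {dO : measure_display} {Omega : measurableType dO}.
Context (P : probability Omega R) (T : R) (d : nat) (B : R -> Omega -> 'rV[R]_d).
Local Notation F := (brownian_filtration P B).
Local Notation leb := (@lebesgue_measure R).
Hypotheses (hB : is_brownian_motion P T B) (P_complete : measure_is_complete P).
Hypothesis T0 : 0 < T.
Context (Z : R -> Omega -> 'rV[R]_d) (I : R -> Omega -> R).
Hypotheses (pZ : progressive_vec T F Z) (hI : is_ito_integral P T F B Z I).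
Hypothesis qvar_fin : {ae P, forall w, (qvar_ext Z T w < +oo)%E}.
Local Notation A := (qvar T Z).
Local Notation tau := (stop_at T Z).

Let SI : in_S P T F I. Proof. by case: hI. Qed.

Let F_meas t : t <= T -> F t `<=` measurable.
Proof. exact: (filtration_measurable hB P_complete). Qed.

Let pA : progressive T F A.
Proof. exact: (qvar_progressive pZ (@filtration_negligible _ _ _ P _ B) qvar_fin). Qed.

(** Along a subsequence the convergence in probability in [is_ito_integral] becomes almost sure;
    nothing later refers to the simple processes themselves. *)
Lemma ito_integral_approx (s : nat -> R) (m : nat) (c : R) :
  (forall i, (i <= m)%N -> 0 <= s i <= T) -> (forall i, (i < m)%N -> s i < s i.+1) -> 0 <= c ->
  exists (u : nat -> nat -> R) (h : nat -> nat -> Omega -> 'rV[R]_d) (p : nat -> nat -> nat),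
  [/\ forall n, disc_admissible P T B (u n) (h n),
      forall n i, (i <= m)%N -> u n (p n i) = s i,
      forall n i, (i < m)%N -> (p n i < p n i.+1)%N,
      forall n k w, disc_quad (u n) (h n) k w <= c &
      forall i, (i <= m)%N ->
        ae_cvg P (fun n w => disc_int B (u n) (h n) (p n i) w)
          (fun w => I (Num.min (s i) (tau c w)) w) /\
        ae_cvg P (fun n w => disc_quad (u n) (h n) (p n i) w)
          (fun w => A (Num.min (s i) (tau c w)) w)].
Proof.
have [_ [H [sH HZ HI]]] := hI.
have [phi Hphi] := cvg_in_prob_subseq
  (fun e k _ => sp_dist_measurable hB P_complete T0 e (sH k) pZ)
  (fun e k _ => sp_int_sup_measurable hB P_complete T0 e (sH k) SI) HZ HI.
exact: (ito_approx hB P_complete T0 pZ SI qvar_fin (fun n => sH (phi n)) Hphi).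
Qed.

Lemma stopped_wrt (X : R -> Omega -> R) c t : progressive T F X -> 0 <= c -> 0 <= t <= T ->
  measurable_wrt (F t) (fun w => X (Num.min t (tau c w)) w).
Proof.
move=> pX c0 tT; apply: (progressive_random_time pX tT).
  move=> w; have /andP[s0 _] := stop_at_bounds Z T0 w c0; have /andP[t0 _] := tT.
  by rewrite le_min t0 s0 ge_min lexx.
exact: (stop_at_min_wrt T0 pZ (@filtration_sigma _ _ _ P _ B) (@filtrationS _ _ _ P _ B)
  (@filtration_negligible _ _ _ P _ B) qvar_fin c0 tT).
Qed.

Lemma stopped_measurable (X : R -> Omega -> R) c t : progressive T F X -> 0 <= c ->
  0 <= t <= T -> measurable_fun setT (fun w => X (Num.min t (tau c w)) w).
Proof.
move=> pX c0 tT; apply: (measurable_wrt_measurable (@F_meas t _) (stopped_wrt pX c0 tT)).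
by case/andP : tT.
Qed.

Let disc_meas u h n : disc_admissible P T B u h ->
  measurable_fun setT (disc_int B u h n) /\ measurable_fun setT (disc_quad u h n).
Proof.
move=> adm; have [_ [mM _]] := disc_int_adm hB P_complete adm n.
by have [_ [mA _]] := disc_quad_adm hB P_complete adm n.
Qed.

Lemma disc_int_moment q : 0 < q -> exists2 C, 0 <= C &
  forall u h, disc_admissible P T B u h -> forall n,
  (\int[P]_w (`|disc_int B u h n w| `^ q)%:E <=
   (C * (\int[P]_w ((1 + disc_quad u h n w) `^ (q / 2)))%R)%:E)%E.
Proof.
move=> q0; have [C C0 HC] := disc_bdg hB P_complete q0; exists C => // u h adm n.
apply: le_trans (_ : (((\int[P]_w (`|disc_int B u h n w| `^ q))%R)%:E <= _)%E); last first.
  by rewrite lee_fin; exact: HC.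
rewrite /Rintegral fineK//; apply: integrable_fin_num => //.
apply: all_moments_integrable; apply: all_moments_powR; [exact: ltW|by []|].
by apply: all_moments_norm; case: (disc_int_adm hB P_complete adm n).
Qed.

Lemma Rintegral_disc_quad_le q u h n c : 0 < q -> disc_admissible P T B u h ->
  (forall w, disc_quad u h n w <= c) ->
  (\int[P]_w ((1 + disc_quad u h n w) `^ (q / 2)))%R <= (1 + c) `^ (q / 2).
Proof.
move=> q0 adm Hc; rewrite -[leRHS](Rintegral_cst_prob P).
have Q0 w : 0 <= disc_quad u h n w by exact: disc_quad_ge0 adm _ _.
apply: le_Rintegral => //.
- apply: all_moments_integrable; apply: all_moments_powR => //.
  + by rewrite divr_ge0 ?(ltW q0).
  + by move=> w; rewrite addr_ge0.
  + apply: all_momentsD; first exact: all_moments_cst.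
    by case: (disc_quad_adm hB P_complete adm n).
- exact: finite_measure_integrable_cst.
- move=> w _; apply: le_powR2r; first by rewrite divr_ge0 ?(ltW q0).
    by rewrite addr_ge0.
  by rewrite lerD2l.
Qed.

(** This is the bound for the sign sums of the Tanaka inequality. The weighted sum is itself a
    discrete integral whose bracket is below the unweighted one, so the constant depends neither on
    the subdivision nor on the level c. *)
Lemma stopped_sum_moment q : 0 < q -> exists2 C, 0 <= C &
  forall c (s : nat -> R) m (e : nat -> Omega -> R), 0 <= c ->
  (forall i, (i <= m)%N -> 0 <= s i <= T) -> (forall i, (i < m)%N -> s i < s i.+1) ->
  (forall i, (i < m)%N -> measurable_wrt (F (s i)) (e i)) ->
  (forall i w, (i < m)%N -> `|e i w| <= 1) ->
  (\int[P]_w (`|\sum_(i < m) e i w * (I (Num.min (s i.+1) (tau c w)) w -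
      I (Num.min (s i) (tau c w)) w)| `^ q)%:E <=
   (C * (\int[P]_w ((1 + A (Num.min (s m) (tau c w)) w) `^ (q / 2)))%R)%:E)%E.
Proof.
move=> q0; have [C C0 HC] := disc_int_moment q0; exists C => // c s m e c0 sT slt me e1.
have [u [h [p [adm upE plt quad_c cv]]]] := ito_integral_approx sT slt c0.
have [pI _] := SI.
have me' n i : (i < m)%N -> measurable_wrt (F (u n (p n i))) (e i).
  by move=> im; rewrite upE ?(ltnW im)//; exact: me.
pose g n k w := step_weight (p n) e m k w *: h n k w.
have admg n : disc_admissible P T B (u n) (g n).
  exact: (weighted_admissible (adm n) (plt n) (me' n) e1).
have gE n w : disc_int B (u n) (g n) (p n m) w =
    \sum_(i < m) e i w * (disc_int B (u n) (h n) (p n i.+1) w - disc_int B (u n) (h n) (p n i) w).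
  exact: (weighted_int B (u n) (h n) e (plt n) w (leqnn _)).
apply: (@moment_limit _ _ _ P q C c (fun n => disc_int B (u n) (g n) (p n m))
    (fun n => disc_quad (u n) (h n) (p n m))) => //.
- by move=> n; case: (disc_meas (p n m) (admg n)).
- apply: measurable_sum => -[i im] /=; apply: measurable_funM.
    apply: measurable_wrt_measurable (me i im); apply: F_meas.
    by have /andP[] := sT i (ltnW im).
  by apply: measurable_funB; apply: stopped_measurable => //; apply: sT => //; exact: ltnW.
- by move=> n; case: (disc_meas (p n m) (adm n)).
- by apply: stopped_measurable => //; exact: sT.
- by move=> n w; rewrite (disc_quad_ge0 (adm n)) quad_c.
- by move=> w; exact: qvar_ge0.
- apply: ae_cvg_intro.
  have cvi i : {ae P, forall w, (i <= m)%N ->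
      disc_int B (u n) (h n) (p n i) w @[n --> \oo] --> I (Num.min (s i) (tau c w)) w}.
    have [im|mi] := leqP i m; last by apply: aeW.
    by have [/ae_cvgP H _] := cv i im; apply: filterS H => w Hw _.
  have : {ae P, forall w i, (i <= m)%N ->
      disc_int B (u n) (h n) (p n i) w @[n --> \oo] --> I (Num.min (s i) (tau c w)) w}.
    exact: ae_foralln.
  apply: filterS => w Hw; under eq_fun do rewrite gE.
  apply: cvg_sum_seq => -[i im] /=; apply: cvgMr; apply: cvgB; apply: Hw => //; exact: ltnW.
- by have [] := cv m (leqnn m).
- move=> n; apply: (le_trans (HC (u n) (g n) (admg n) (p n m))).
  rewrite lee_fin; apply: ler_wpM2l; first exact: C0.
  have all1 u' h' k : disc_admissible P T B u' h' ->
      P.-integrable setT (EFin \o (fun w => (1 + disc_quad u' h' k w) `^ (q / 2))).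
    move=> adm'; have Q0 w : 0 <= disc_quad u' h' k w by exact: disc_quad_ge0 adm' _ _.
    apply: all_moments_integrable; apply: all_moments_powR => //.
    + by rewrite divr_ge0 ?(ltW q0).
    + by move=> w; rewrite addr_ge0.
    + apply: all_momentsD; first exact: all_moments_cst.
      by case: (disc_quad_adm hB P_complete adm' k).
  apply: le_Rintegral; [exact: measurableT|exact: all1|exact: all1|].
  move=> w _; apply: le_powR2r; first by rewrite divr_ge0 ?(ltW q0).
    by rewrite addr_ge0// (disc_quad_ge0 (admg n)).
  by rewrite lerD2l (weighted_quad_le (adm n) (plt n) e1).
Qed.

Lemma stopped_moment q : 0 < q -> exists2 C, 0 <= C &
  forall c t, 0 <= c -> 0 <= t <= T ->
  (\int[P]_w (`|I (Num.min t (tau c w)) w| `^ q)%:E <=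
   (C * (\int[P]_w ((1 + A (Num.min t (tau c w)) w) `^ (q / 2)))%R)%:E)%E.
Proof.
move=> q0; have [C C0 HC] := disc_int_moment q0; exists C => // c t c0 tT.
have [//|//|u [h [p [adm upE _ quad_c /(_ 0%N (leqnn 0))[cvI cvA]]]]] :=
  @ito_integral_approx (fun=> t) 0 c _ _ c0.
have [pI _] := SI.
apply: (@moment_limit _ _ _ P q C c (fun n => disc_int B (u n) (h n) (p n 0%N))
    (fun n => disc_quad (u n) (h n) (p n 0%N))) => //.
- by move=> n; case: (disc_meas (p n 0%N) (adm n)).
- exact: stopped_measurable.
- by move=> n; case: (disc_meas (p n 0%N) (adm n)).
- exact: stopped_measurable.
- by move=> n w; rewrite (disc_quad_ge0 (adm n)) quad_c.
- by move=> w; exact: qvar_ge0.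
- by move=> n; exact: HC.
Qed.

Lemma stop_at_eventually c w : clock T Z T w <= c -> tau c w = T.
Proof.
move=> Tc; have c0 : 0 <= c.
  by apply: le_trans Tc; rewrite addr_ge0 ?qvar_ge0 ?(ltW T0).
apply/eqP; rewrite eq_le; have /andP[_ ->] := stop_at_bounds Z T0 w c0.
apply: ub_le_sup; last by rewrite /= lexx (ltW T0).
by exists T => r [/andP[]].
Qed.

Lemma stop_at_mono c c' w : 0 <= c -> c <= c' -> tau c w <= tau c' w.
Proof.
move=> c0 cc; apply: ub_le_sup; first by exists T => r [/andP[]].
split; first exact: stop_at_bounds.
apply: le_trans cc; apply: (@hitting_le _ T (clock T Z ^~ w) c) => //.
- by rewrite /clock qvar0 addr0.
- exact: (@clock_continuous _ _ _ _ _ _ _ T0 pZ w).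
Qed.

(** This holds for every w, since the default value in [qvar] makes the clock finite everywhere. *)
Lemma near_stop_at w : \forall n \near \oo, tau n%:R w = T.
Proof.
exists (Num.truncn (clock T Z T w)).+1 => // n /= nb; apply: stop_at_eventually.
by apply/ltW/(lt_le_trans (truncnS_gt _)); rewrite ler_nat.
Qed.

Section Moments.
Context (q : R) (q0 : 0 < q).
Hypothesis iA : P.-integrable setT (EFin \o (fun w => (1 + A T w) `^ (q / 2))).

Lemma stopped_power_le c t : 0 <= c -> 0 <= t <= T ->
  (\int[P]_w ((1 + A (Num.min t (tau c w)) w) `^ (q / 2)))%R <=
  (\int[P]_w ((1 + A T w) `^ (q / 2)))%R.
Proof.
move=> c0 tT; have H w : (1 + A (Num.min t (tau c w)) w) `^ (q / 2) <= (1 + A T w) `^ (q / 2).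
  apply: le_powR2r; first by rewrite divr_ge0 ?(ltW q0).
    by rewrite addr_ge0// qvar_ge0.
  rewrite lerD2l; apply: (qvar_le T0 pZ) => //.
  by have /andP[_ tT'] := tT; rewrite ge_min tT'.
apply: (le_Rintegral measurableT _ iA); last by move=> w _; exact: H.
apply: integrable_le iA; last by move=> w; rewrite powR_ge0 H.
apply: (measurableT_comp (measurable_powR _)).
by apply: measurable_funD; [exact: measurable_cst|exact: stopped_measurable].
Qed.

(** The unstopped bound follows from the stopped ones by Fatou's lemma along integer levels. The
    stopped bounds are kept with the same K, for uniform integrability in [ito_martingale]. *)
Lemma ito_moment : exists K : R, forall t, 0 <= t <= T ->
  (\int[P]_w (`|I t w| `^ q)%:E <= K%:E)%E /\
  forall c, 0 <= c -> (\int[P]_w (`|I (Num.min t (tau c w)) w| `^ q)%:E <= K%:E)%E.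
Proof.
have [C C0 HC] := stopped_moment q0; have [pI _] := SI.
exists (C * (\int[P]_w ((1 + A T w) `^ (q / 2)))%R) => t tT; have /andP[t0 tT'] := tT.
have Hs c : 0 <= c -> (\int[P]_w (`|I (Num.min t (tau c w)) w| `^ q)%:E <=
    (C * (\int[P]_w ((1 + A T w) `^ (q / 2)))%R)%:E)%E.
  move=> c0; apply: (le_trans (HC c t c0 tT)).
  by rewrite lee_fin; apply: ler_wpM2l; [exact: C0|exact: stopped_power_le].
split => //; apply: (@fatou_powR _ _ _ P (fun n w => I (Num.min t (tau n%:R w)) w)) => //.
- by move=> n; exact: stopped_measurable.
- apply: measurable_wrt_measurable (progressive_section pI t0 (lexx t) tT').
  exact: F_meas.
- apply: aeW => w e e0; apply: filterS (near_stop_at w) => n ->.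
  by rewrite min_l// subrr normr0.
- move=> e e0; apply: nearW => n; apply: (le_trans (Hs _ (ler0n _ n))).
  by rewrite -EFinD lee_fin lerDl ltW.
Qed.

Lemma ito_sum_moment : exists K : R, forall (s : nat -> R) m (e : nat -> Omega -> R),
  (forall i, (i <= m)%N -> 0 <= s i <= T) -> (forall i, (i < m)%N -> s i < s i.+1) ->
  (forall i, (i < m)%N -> measurable_wrt (F (s i)) (e i)) ->
  (forall i w, (i < m)%N -> `|e i w| <= 1) ->
  (\int[P]_w (`|\sum_(i < m) e i w * (I (s i.+1) w - I (s i) w)| `^ q)%:E <= K%:E)%E.
Proof.
have [C C0 HC] := stopped_sum_moment q0; have [pI _] := SI.
exists (C * (\int[P]_w ((1 + A T w) `^ (q / 2)))%R) => s m e sT slt me e1.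
have F_sT i : (i <= m)%N -> F (s i) `<=` measurable.
  by move=> im; apply: F_meas; have /andP[] := sT i im.
apply: (@fatou_powR _ _ _ P (fun n w => \sum_(i < m) e i w *
    (I (Num.min (s i.+1) (tau n%:R w)) w - I (Num.min (s i) (tau n%:R w)) w))) => //.
- move=> n; apply: measurable_sum => -[i im] /=; apply: measurable_funM.
    by apply: measurable_wrt_measurable (me i im); apply: F_sT; exact: ltnW.
  by apply: measurable_funB; apply: stopped_measurable => //; apply: sT => //; exact: ltnW.
- apply: measurable_sum => -[i im] /=; apply: measurable_funM.
    by apply: measurable_wrt_measurable (me i im); apply: F_sT; exact: ltnW.
  have mI k : (k <= m)%N -> measurable_fun setT (I (s k)).
    move=> km; have /andP[s0 s1] := sT k km.
    exact: (measurable_wrt_measurable (F_sT k km) (progressive_section pI s0 (lexx _) s1)).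
  by apply: measurable_funB; apply: mI => //; exact: ltnW.
- apply: aeW => w r r0; apply: filterS (near_stop_at w) => n E.
  rewrite [X in `|X|](_ : _ = 0) ?normr0//; apply/eqP; rewrite subr_eq0; apply/eqP.
  apply: eq_bigr => -[i im] _ /=; rewrite E !min_l//.
    by have /andP[] := sT i (ltnW im).
  by have /andP[] := sT i.+1 im.
- move=> r r0; apply: nearW => n; apply: (le_trans (HC n%:R s m e (ler0n _ n) sT slt me e1)).
  rewrite -EFinD lee_fin; apply: ler_wpDr; first exact: ltW.
  by apply: ler_wpM2l; [exact: C0|apply: stopped_power_le; [exact: ler0n|exact: sT]].
Qed.

End Moments.

Section StoppedMartingales.
Context (c s t : R) (D : set Omega).
Hypotheses (c0 : 0 <= c) (s0 : 0 <= s) (st : s < t) (tT : t <= T) (FD : F s D).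

(** The approximation is applied to the subdivision s < t, so that both times lie on every grid and
    the discrete identities hold exactly before passing to the limit. *)
Let pts (i : nat) : R := if i is 0%N then s else t.

Let ptsT i : (i <= 1)%N -> 0 <= pts i <= T.
Proof.
case: i => [|[|//]] _ /=; first by rewrite s0 (le_trans (ltW st)).
by rewrite tT (le_trans s0 (ltW st)).
Qed.

Let sT : 0 <= s <= T. Proof. exact: (@ptsT 0). Qed.
Let tT' : 0 <= t <= T. Proof. exact: (@ptsT 1). Qed.
Let mD : measurable D. Proof. by apply: (F_meas _ FD); case/andP : sT. Qed.

Let indic_adm u : u = s -> adapted_moments P (F u) (\1_D : Omega -> R).
Proof.
move=> ->; split.
  by apply: measurable_indic; apply: sub_sigma_algebra.
apply: (@all_moments_bounded _ _ _ _ _ 1); first exact: measurable_indic.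
by move=> w; rewrite indicE; case: (_ \in _); rewrite ?normr1 ?normr0.
Qed.

Lemma stopped_ito_martingale :
  (\int[P]_(w in D) I (Num.min t (tau c w)) w)%R =
  (\int[P]_(w in D) I (Num.min s (tau c w)) w)%R.
Proof.
have slt i : (i < 1)%N -> pts i < pts i.+1 by case: i.
have [u [h [p [adm upE plt quad_c cv]]]] := ito_integral_approx ptsT slt c0.
have [pI _] := SI.
have [cv0 _] := cv 0%N isT; have [cv1 _] := cv 1%N isT.
have [C C0 HC] := @disc_int_moment 2 (ltr0Sn _ _).
have bd n k : (\int[P]_w (`|disc_int B (u n) (h n) k w| `^ 2)%:E <=
    (C * (1 + c) `^ (2 / 2))%:E)%E.
  apply: (le_trans (HC (u n) (h n) (adm n) k)); rewrite lee_fin; apply: ler_wpM2l; first exact: C0.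
  by apply: Rintegral_disc_quad_le => // w; exact: quad_c.
apply: (@ui_Rintegral_eq _ _ _ P 2 (C * (1 + c) `^ (2 / 2))
  (fun n => disc_int B (u n) (h n) (p n 1%N)) (fun n => disc_int B (u n) (h n) (p n 0%N))).
- by rewrite ltr1n.
- exact: mD.
- by move=> n; case: (disc_meas (p n 1%N) (adm n)).
- exact: stopped_measurable.
- exact: cv1.
- by move=> n; case: (disc_meas (p n 0%N) (adm n)).
- exact: stopped_measurable.
- exact: cv0.
- by move=> n; exact: bd.
- by move=> n; exact: bd.
- move=> n; rewrite 2!(Rintegral_indic P D).
  exact: (disc_martingale hB P_complete (adm n) (ltnW (plt n 0%N isT)) (indic_adm (upE n 0%N isT))).
Qed.

Lemma stopped_bracket_martingale :
  (\int[P]_(w in D) (I (Num.min t (tau c w)) w ^+ 2 - A (Num.min t (tau c w)) w))%R =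
  (\int[P]_(w in D) (I (Num.min s (tau c w)) w ^+ 2 - A (Num.min s (tau c w)) w))%R.
Proof.
have slt i : (i < 1)%N -> pts i < pts i.+1 by case: i.
have [u [h [p [adm upE plt quad_c cv]]]] := ito_integral_approx ptsT slt c0.
have [pI _] := SI.
(* Fourth moments, because the square of the integral has to be bounded in L^2 to be uniformly
   integrable. *)
have [C C0 HC] := @disc_int_moment 4 (ltr0Sn _ _).
pose X n k w := disc_int B (u n) (h n) k w ^+ 2 - disc_quad (u n) (h n) k w.
have mX n k : measurable_fun setT (X n k).
  have [mM mA] := disc_meas k (adm n).
  by apply: measurable_funB => //; exact: measurable_funX.
have cvX i (i1 : (i <= 1)%N) : ae_cvg P (fun n => X n (p n i)) (fun w =>
    I (Num.min (pts i) (tau c w)) w ^+ 2 - A (Num.min (pts i) (tau c w)) w).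
  have [/ae_cvgP c1 /ae_cvgP c2] := cv i i1.
  apply: ae_cvg_intro; apply: filterS2 c1 c2 => w c1 c2.
  by apply: cvgB => //; rewrite expr2; apply: cvgM.
pose K := 2 * (C * (1 + c) `^ (4 / 2)) + 2 * c ^+ 2.
have bd n k : (\int[P]_w (`|X n k w| `^ 2)%:E <= K%:E)%E.
  have [mM mA] := disc_meas k (adm n).
  pose Y w := `|disc_int B (u n) (h n) k w| `^ 4.
  have mY : measurable_fun setT (fun w => (Y w)%:E).
    by apply: powR_integrable_measurable.
  apply: (@le_trans _ _ (\int[P]_w (2%:E * (Y w)%:E + (2 * c ^+ 2)%:E))%E).
    apply: ge0_le_integral => //.
    - exact: powR_integrable_measurable.
    - by apply: emeasurable_funD => //; apply: emeasurable_funM.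
    - move=> w _; rewrite -EFinM -EFinD lee_fin /Y !powR_mulrn//.
      have Q0 : 0 <= disc_quad (u n) (h n) k w by exact: disc_quad_ge0 (adm n) _ _.
      have Qc := quad_c n k w; rewrite real_normK ?num_real// /X.
      set x := disc_int B (u n) (h n) k w; set y := disc_quad (u n) (h n) k w in Q0 Qc *.
      have -> : `|x| ^+ 4 = (x ^+ 2) ^+ 2.
        by rewrite -normrX ger0_norm -?exprM// (exprM x 2 2) sqr_ge0.
      have yc : y ^+ 2 <= c ^+ 2 by rewrite ler_sqr ?nnegrE.
      exact: sqr_sub_le.
  rewrite ge0_integralD//; last 3 first.
  - by move=> w _; rewrite -EFinM lee_fin mulr_ge0// powR_ge0.
  - exact: emeasurable_funM.
  - by move=> w _; rewrite lee_fin mulr_ge0// sqr_ge0.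
  rewrite ge0_integralZl_EFin//; last by move=> w _; rewrite lee_fin powR_ge0.
  rewrite integral_cst//= probability_setT mule1.
  have -> : K%:E = (2%:E * (C * (1 + c) `^ (4 / 2))%:E + (2 * c ^+ 2)%:E)%E by [].
  apply: leeD2r; rewrite lee_pmul2l//.
  apply: (le_trans (HC (u n) (h n) (adm n) k)); rewrite lee_fin; apply: ler_wpM2l; first exact: C0.
  by apply: Rintegral_disc_quad_le => // w; exact: quad_c.
have mL r : 0 <= r <= T -> measurable_fun setT (fun w =>
    I (Num.min r (tau c w)) w ^+ 2 - A (Num.min r (tau c w)) w).
  move=> rT; apply: measurable_funB; last exact: stopped_measurable.
  by apply: measurable_funX; exact: stopped_measurable.
apply: (@ui_Rintegral_eq _ _ _ P 2 K (fun n => X n (p n 1%N)) (fun n => X n (p n 0%N))).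
- by rewrite ltr1n.
- exact: mD.
- by move=> n.
- exact: mL.
- exact: (cvX 1%N).
- by move=> n.
- exact: mL.
- exact: (cvX 0%N).
- by move=> n; exact: bd.
- by move=> n; exact: bd.
- move=> n; rewrite 2!(Rintegral_indic P D).
  exact: (disc_bracket hB P_complete (adm n) (ltnW (plt n 0%N isT)) (indic_adm (upE n 0%N isT))).
Qed.

End StoppedMartingales.

Lemma ito_integral_measurable t : 0 <= t <= T -> measurable_wrt (F t) (I t).
Proof.
move=> /andP[t0 tT]; have [pI _] := SI; exact: (progressive_section pI t0 (lexx t) tT).
Qed.

(** Here q > 1 matters: the L^q bound, uniform in the stopping level, gives uniform integrability,
    so the martingale identity survives the removal of the stopping. *)
Lemma ito_martingale q : 1 < q ->
  P.-integrable setT (EFin \o (fun w => (1 + A T w) `^ (q / 2))) -> martingale P T F I.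
Proof.
move=> q1 iA; have q0 : 0 < q by exact: lt_trans q1.
have [K HK] := ito_moment q0 iA; have [pI _] := SI.
have mI t : 0 <= t <= T -> measurable_fun setT (I t).
  move=> tT; apply: measurable_wrt_measurable (ito_integral_measurable tT).
  by apply: F_meas; case/andP : tT.
apply: martingale_intro => //.
- exact: ito_integral_measurable.
- by move=> t tT; have [_] := powR_integrable (ltW q1) (mI t tT) (HK t tT).1.
- move=> s t D s0 st tT FD.
  have sT : 0 <= s <= T by rewrite s0 (le_trans (ltW st)).
  have tT' : 0 <= t <= T by rewrite tT (le_trans s0 (ltW st)).
  have cv r : 0 <= r <= T ->
      ae_cvg P (fun n w => I (Num.min r (tau n%:R w)) w) (I r).
    move=> /andP[_ rT]; apply: aeW => w e e0; apply: filterS (near_stop_at w) => n ->.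
    by rewrite min_l// subrr normr0.
  apply: (@ui_Rintegral_eq _ _ _ P q K (fun n w => I (Num.min t (tau n%:R w)) w)
    (fun n w => I (Num.min s (tau n%:R w)) w)) => //.
  + by apply: (F_meas _ FD); case/andP : sT.
  + by move=> n; apply: stopped_measurable.
  + exact: mI.
  + exact: cv.
  + by move=> n; apply: stopped_measurable.
  + exact: mI.
  + exact: cv.
  + by move=> n; apply: (HK t tT').2; exact: ler0n.
  + by move=> n; apply: (HK s sT).2; exact: ler0n.
  + by move=> n; apply: stopped_ito_martingale => //; exact: ler0n.
Qed.

Lemma stopped_ito_square_integrable c t : 0 <= c -> 0 <= t <= T ->
  P.-integrable setT (EFin \o (fun w => I (Num.min t (tau c w)) w ^+ 2)).
Proof.
move=> c0 tT; have [C C0 HC] := @stopped_moment 2 (ltr0Sn _ _); have [pI _] := SI.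
have mI := stopped_measurable pI c0 tT.
have [+ _] := @powR_integrable _ _ _ P _ 2 _ (ler1n _ 2) mI (HC c t c0 tT).
rewrite (_ : (fun w => _) = (fun w => I (Num.min t (tau c w)) w ^+ 2))//.
by apply/funext => w; rewrite powR_mulrn// real_normK ?num_real.
Qed.

Lemma ito_bracket : is_bracket P T F I A.
Proof.
have [pI _] := SI; split.
- by split => //; apply: aeW => w; exact: (@qvar_continuous _ _ _ _ _ _ _ T0 pZ w).
- by apply: aeW => w; exact: qvar0.
- apply: aeW => w s t; rewrite !in_itv/= => sT /andP[_ tT] st.
  exact: (qvar_le T0 pZ).
(* Square integrability is available after stopping: up to [tau k%:R] the energy is at most k. *)
exists (fun k => tau k%:R); split.
- move=> k; exact: (stop_at_stopping T0 pZ (@filtration_sigma _ _ _ P _ B)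
    (@filtration_negligible _ _ _ P _ B) qvar_fin (ler0n _ k)).
- by move=> k w; apply: stop_at_mono; rewrite ?ler0n// ler_nat.
- by apply: aeW => w; have [k _ Hk] := near_stop_at w; exists k; apply: Hk => /=.
move=> k; have k0 : (0 : R) <= k%:R by exact: ler0n.
apply: martingale_intro.
- exact: F_meas.
- move=> t tT; apply: measurable_funB; last exact: stopped_wrt.
  by apply: measurable_funX; exact: stopped_wrt.
- move=> t tT.
  have iQ : P.-integrable setT (EFin \o (fun w => A (Num.min t (tau k%:R w)) w)).
    apply: (@integrable_le _ _ _ P _ (fun=> k%:R)).
    + exact: stopped_measurable.
    + move=> w; rewrite qvar_ge0/=; have /andP[b0 bT] := stop_at_bounds Z T0 w k0.
      apply: (@le_trans _ _ (clock T Z (tau k%:R w) w)).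
        apply: ler_wpDr => //; apply: (qvar_le T0 pZ) => //.
        by rewrite ge_min lexx orbT.
      apply: (@hitting_le _ T (clock T Z ^~ w) k%:R) => //.
      * by rewrite /clock qvar0 addr0.
      * exact: (@clock_continuous _ _ _ _ _ _ _ T0 pZ w).
    + exact: finite_measure_integrable_cst.
  have := integrable_RD (stopped_ito_square_integrable k0 tT) (integrable_RZl (-1) iQ).
  by under [X in EFin \o X]eq_fun do rewrite mulN1r.
- by move=> s t D s0 st tT FD; exact: stopped_bracket_martingale.
Qed.

End ItoMartingale.

(** * Spaces of processes *)

Section LowerIntegral.
Import HBNNSimple.
Context {R : realType} {dO : measure_display} {Omega : measurableType dO}.
Context (P : probability Omega R).
Implicit Types (f g J phi : Omega -> \bar R).

(** The integral of a nonnegative function is a supremum over the simple functions below it,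
    measurable or not, hence monotone. *)
Lemma le_nonmeasurable_integral f g : (forall w, 0 <= f w)%E -> (forall w, f w <= g w)%E ->
  (\int[P]_w f w <= \int[P]_w g w)%E.
Proof.
move=> f0 fg; have g0 w : (0 <= g w)%E by exact: le_trans (fg w).
rewrite !ge0_integralTE//; apply: le_ereal_sup => _ [h /= hf <-].
by exists h => //= w; exact: le_trans (fg w).
Qed.

(* For non-measurable nonnegative functions the integral is a lower integral; it is
   additive as soon as one summand is measurable. *)
Lemma nonmeasurable_integral_le_add J f phi :
  (forall w, 0 <= J w)%E -> measurable_fun setT f -> (forall w, 0 <= f w)%E ->
  (forall w, 0 <= phi w)%E -> {ae P, forall w, (J w <= f w + phi w)%E} ->
  (\int[P]_w J w <= \int[P]_w f w + \int[P]_w phi w)%E.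
Proof.
move=> J0 mf f0 phi0 [N [mN N0 sN]].
rewrite ge0_integralTE//; apply: ge_ereal_sup => _ [h /= hJ <-].
rewrite -integralT_nnsfun.
(* Off the exceptional set this is the positive part of h - f: it is measurable and lies below phi,
   so its integral is at most the lower integral of phi. *)
pose D := (fun w => maxe ((h w)%:E - f w) 0)%E \_ (~` N).
have mh : measurable_fun setT (fun w => (h w)%:E) by exact/measurable_EFinP.
have mD : measurable_fun setT D.
  apply/(measurable_restrictT _ (measurableC mN)); apply: measurable_funTS.
  by apply: measurable_maxe => //; exact: emeasurable_funB.
have D0 w : (0 <= D w)%E by rewrite /D patchE; case: ifP => // _; rewrite le_max lexx orbT.
apply: (@le_trans _ _ (\int[P]_w (f w + D w))%E).
  apply: ae_ge0_le_integral => //.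
  - by move=> w _; rewrite lee_fin.
  - by move=> w _; rewrite adde_ge0.
  - exact: emeasurable_funD.
  exists N; split => // w /= /not_implyP[_ nle]; apply: contrapT => nN; apply: nle.
  rewrite /D patchE ifT ?inE//=; case: (f w) (f0 w) => [r r0| _|//].
    apply: (@le_trans _ _ (r%:E + ((h w)%:E - r%:E))%E).
      by rewrite -EFinB -EFinD lee_fin addrC subrK.
    by rewrite leeD2l// le_max lexx.
  rewrite addye ?leey//; apply/eqP => E.
  by have : (0 <= -oo :> \bar R)%E by rewrite -E le_max lexx orbT.
rewrite ge0_integralD//; apply: leeD2l; apply: le_nonmeasurable_integral => // w.
rewrite /D patchE; case: ifPn => // /set_mem nN; rewrite ge_max phi0 andbT.
have le : (J w <= f w + phi w)%E by apply: contrapT => nle; apply: nN; exact: sN.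
have := le_trans (hJ w) le; case: (f w) (f0 w) => [r r0| _ _|//].
  by rewrite leeBlDl.
by rewrite addeNy leNye.
Qed.

End LowerIntegral.

Section ExtendedPower.
Context {R : realType}.
Implicit Types (q : R) (a b : \bar R).

Lemma le_poweR q a b : 0 <= q -> (0 <= a)%E -> (a <= b)%E -> (a `^ q <= b `^ q)%E.
Proof.
move=> q0 a0 ab; apply: gt0_ler_poweR => //; rewrite in_itv/= ?a0 ?leey//.
by rewrite (le_trans a0 ab).
Qed.

Lemma poweR_add_le q a b : 0 < q -> (0 <= a)%E -> (0 <= b)%E ->
  ((a + b) `^ q <= (2 `^ q)%:E * (a `^ q + b `^ q))%E.
Proof.
move=> q0; have qn : q != 0 by rewrite gt_eqF.
have t0 : (0 < (2 `^ q)%:E)%E by rewrite lte_fin powR_gt0.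
case: a b => [a| |] [b| |]//=; rewrite ?lee_fin.
- by move=> a0 b0; exact: powR_add_le (ltW q0) a0 b0.
- by move=> _ _; rewrite (negbTE qn) addey// gt0_muley// leey.
- by move=> _ _; rewrite (negbTE qn) addye// gt0_muley// leey.
- by move=> _ _; rewrite (negbTE qn) addye// gt0_muley// leey.
Qed.

End ExtendedPower.

Section TotalVariation.
Context {R : realType}.

Lemma total_variation_majorant (a b : R) (f m : R -> R) :
  (forall s t, a <= s -> s <= t -> t <= b -> `|f t - f s| <= m t - m s) ->
  (total_variation a b f <= (m b - m a)%:E)%E.
Proof.
move=> fm; apply: ge_ereal_sup => _ [_ [s sab <-] <-]; rewrite lee_fin /variation.
have mono : {in `[a, b] &, nondecreasing_fun (@idfun R)} by [].
have nd := nondecreasing_fun_itv_partition mono sab.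
apply: (@le_trans _ _ (\sum_(0 <= n < size s)
   ((m \o nth b (a :: s)) n.+1 - (m \o nth b (a :: s)) n))).
  rewrite !big_nat; apply: ler_sum => i /andP[_ is_]; apply: fm.
  - by apply: itv_partition_nth_ge => //; exact: ltnW.
  - exact: nd.
  - by apply: itv_partition_nth_le => //; rewrite ltnS.
by rewrite telescope_sumr// /= (itv_partition_nth_size b sab).
Qed.

Lemma sum_total_variation (u : nat -> R) (f : R -> R) n :
  (forall k, u k <= u k.+1) ->
  ((\sum_(k < n) `|f (u k.+1) - f (u k)|)%:E <= total_variation (u 0%N) (u n) f)%E.
Proof.
move=> um; have mono : forall n, u 0%N <= u n.
  by elim=> // k /le_trans; apply.
elim: n => [|n IH]; first by rewrite big_ord0 total_variation_ge0.
rewrite big_ord_recr/= EFinD (total_variationD f (mono n) (um n)).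
by apply: leeD => //; exact: total_variation_ge.
Qed.

End TotalVariation.

Section ProductSections.
Context {R : realType} {dO : measure_display} {Omega : measurableType dO}.
Context (P : probability Omega R).
Local Notation leb := (@lebesgue_measure R).

(** The conditions on the generator hold almost everywhere on the product, whereas the Tanaka
    argument runs along a single path. *)
Lemma ae_section (Q : Omega * R -> Prop) : {ae (P \x leb)%E, forall wt, Q wt} ->
  {ae P, forall w, {ae leb, forall t, Q (w, t)}}.
Proof.
move=> [N [mN N0 sN]].
have mx : measurable_fun setT (leb \o xsection N) by exact: measurable_fun_xsection.
have : (\int[P]_w `|(leb \o xsection N) w| = 0)%E.
  rewrite -[RHS]N0; apply: eq_integral => w _.
  by rewrite gee0_abs//= measure_ge0.
move=> /(ae_eq_integral_abs P measurableT mx); apply: filterS => w /(_ I) /= Nw.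
exists (xsection N w); split => //; first exact: measurable_xsection.
by move=> t /= nQ; rewrite /xsection/= inE; apply: sN.
Qed.

End ProductSections.

Section HpSpaces.
Context {R : realType} {dO : measure_display} {Omega : measurableType dO}.
Context (P : probability Omega R) (T : R) (F : R -> set (set Omega)).
Local Notation leb := (@lebesgue_measure R).
Hypotheses (T0 : 0 < T) (F_sigma : forall t, sigma_algebra setT (F t)).
Hypothesis FT_meas : F T `<=` measurable.
Context (q : R) (q0 : 0 < q).
Implicit Types X Y : R -> Omega -> R.

Lemma progressive_norm X : progressive T F X -> progressive T F (fun t w => `|X t w|).
Proof. by move=> pX t tT; apply: measurableT_comp => //; exact: pX. Qed.

Lemma progressiveD X Y : progressive T F X -> progressive T F Y ->
  progressive T F (fun t w => X t w + Y t w).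
Proof. by move=> pX pY t tT; apply: measurable_funD; [exact: pX|exact: pY]. Qed.

Lemma progressiveZ (c : R) X : progressive T F X -> progressive T F (fun t w => c * X t w).
Proof. by move=> pX t tT; apply: measurable_funM; [exact: measurable_cst|exact: pX]. Qed.

Lemma progressive_enorm_path (d : nat) (Z : R -> Omega -> 'rV[R]_d) :
  progressive_vec T F Z -> progressive T F (fun t w => enorm (Z t w)).
Proof.
move=> pZ t tT; rewrite (_ : (fun u => _) =
  (fun x : R => x `^ 2^-1) \o (fun u : R * g_sigma_algebraType (F t) => enorm (Z u.1 u.2) ^+ 2)).
  by apply: (measurableT_comp (measurable_powR _)); exact: (progressive_enorm pZ tT).
by apply/funext => u /=; rewrite powR12_sqrt ?sqr_ge0// sqrtr_sqr ger0_norm// enorm_ge0.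
Qed.

Lemma nonneg_integral_measurable X : progressive T F X -> (forall t w, 0 <= X t w) ->
  measurable_fun setT (fun w => (\int[leb]_(t in `[0%R, T]) (X t w)%:E)%E).
Proof.
move=> pX X0; have TT : 0 <= T <= T by rewrite (ltW T0) lexx.
have mI := progressive_integral pX TT X0.
have mw : measurable_fun [set: g_sigma_algebraType (F T)]
    (fun w => \int[leb]_(t in `[0%R, T]) (X t w)%:E)%E.
  apply: (measurable_comp _ _ mI (measurable_fun_pair (@measurable_cst _ _ _ _ setT T)
    (@measurable_id _ (g_sigma_algebraType (F T)) setT))).
    exact: measurableX.
  by move=> _ [w _ <-]; split => //=; rewrite in_itv/= (ltW T0) lexx.
move=> _ U mU; have := mw measurableT _ mU; rewrite !setTI => H; apply: FT_meas.
by rewrite -(sigma_algebra_id (F_sigma T)).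
Qed.

Lemma abs_integral_measurable X : progressive T F X ->
  measurable_fun setT (fun w => (\int[leb]_(t in `[0%R, T]) `|X t w|%:E)%E).
Proof. by move=> pX; apply: nonneg_integral_measurable => //; exact: progressive_norm. Qed.

Lemma abs_integral_ge0 X w : (0 <= \int[leb]_(t in `[0%R, T]) `|X t w|%:E)%E.
Proof. by apply: integral_ge0 => t _; rewrite lee_fin. Qed.

Lemma abs_integral_power_measurable X : progressive T F X ->
  measurable_fun setT (fun w => (\int[leb]_(t in `[0%R, T]) `|X t w|%:E) `^ q)%E.
Proof. by move=> pX; exact: (measurableT_comp (measurable_poweR q) (abs_integral_measurable pX)). Qed.

Lemma path_abs_measurable X w : progressive T F X ->
  measurable_fun `[0, T] (fun t => `|X t w|%:E).
Proof.
move=> pX; apply/measurable_EFinP.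
exact: (progressive_path w (progressive_norm pX) (ltW T0)).
Qed.

(** The summand phi may be nonmeasurable; it is the supremum of a path in [in_Sp_in_Hp]. *)
Lemma in_Hp_bound X (f phi : Omega -> \bar R) : progressive T F X ->
  measurable_fun setT f -> (forall w, 0 <= f w)%E -> (forall w, 0 <= phi w)%E ->
  (\int[P]_w f w < +oo)%E -> (\int[P]_w phi w < +oo)%E ->
  {ae P, forall w, ((\int[leb]_(t in `[0%R, T]) `|X t w|%:E) `^ q <= f w + phi w)%E} ->
  in_Hp P T F q X.
Proof.
move=> pX mf f0 phi0 ff fphi H; split => //.
apply: le_lt_trans (lte_add_pinfty ff fphi).
by apply: nonmeasurable_integral_le_add => // w; exact: poweR_ge0.
Qed.

Lemma in_Hp_le X Y : progressive T F X -> in_Hp P T F q Y ->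
  (forall t w, `|X t w| <= `|Y t w|) -> in_Hp P T F q X.
Proof.
move=> pX [pY fY] XY; apply: (@in_Hp_bound _ _ (cst 0%E) pX _ _ _ fY) => //.
- exact: abs_integral_power_measurable.
- by move=> w; exact: poweR_ge0.
- by rewrite integral0.
- apply: aeW => w; rewrite adde0; apply: le_poweR; [exact: ltW|exact: abs_integral_ge0|].
  apply: ge0_le_integral => //; [exact: path_abs_measurable..|].
  by move=> t _; rewrite lee_fin.
Qed.

Lemma in_HpD X Y : in_Hp P T F q X -> in_Hp P T F q Y ->
  in_Hp P T F q (fun t w => X t w + Y t w).
Proof.
move=> [pX fX] [pY fY]; have pXY := progressiveD pX pY.
pose a X w := ((\int[leb]_(t in `[0%R, T]) `|X t w|%:E) `^ q)%E.
have ma Z : progressive T F Z -> measurable_fun setT (a Z).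
  by move=> pZ; exact: abs_integral_power_measurable.
have a0 Z w : (0 <= a Z w)%E by exact: poweR_ge0.
apply: (@in_Hp_bound _ (fun w => (2 `^ q)%:E * (a X w + a Y w))%E (cst 0%E) pXY).
- by apply: emeasurable_funM => //; apply: emeasurable_funD; exact: ma.
- by move=> w; rewrite mule_ge0 ?lee_fin ?powR_ge0// adde_ge0.
- by [].
- rewrite ge0_integralZl_EFin ?powR_ge0//; last 2 first.
  + by move=> w _; rewrite adde_ge0.
  + by apply: emeasurable_funD; exact: ma.
  rewrite ge0_integralD//; [|exact: ma..].
  by apply: lte_mul_pinfty; rewrite ?lee_fin ?powR_ge0//; exact: lte_add_pinfty fX fY.
- by rewrite integral0.
apply: aeW => w; rewrite adde0.
apply: le_trans (poweR_add_le q0 (abs_integral_ge0 X w) (abs_integral_ge0 Y w)).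
apply: le_poweR; [exact: ltW|exact: (abs_integral_ge0 (fun t w => X t w + Y t w))|].
rewrite -ge0_integralD//=; [|exact: path_abs_measurable..].
apply: ge0_le_integral => //.
- exact: (path_abs_measurable w pXY).
- by apply: emeasurable_funD; exact: path_abs_measurable.
- by move=> t _; rewrite -EFinD lee_fin ler_normD.
Qed.

Lemma in_Hp_cst (c : R) : in_Hp P T F q (fun _ _ => c).
Proof.
have pc : progressive T F (fun _ _ => c) by move=> t tT; exact: measurable_cst.
split => //.
have -> : (fun w : Omega => ((\int[leb]_(t in `[0%R, T]) `|c|%:E) `^ q)%E) =
    cst ((`|c| * T) `^ q)%:E.
  apply/funext => w; rewrite integral_cst//= lebesgue_measure_itv/= lte_fin T0.
  by rewrite -EFinB subr0 -EFinM.
by rewrite integral_cst//= probability_setT mule1 ltry.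
Qed.

Lemma in_HpZ (c : R) X : in_Hp P T F q X -> in_Hp P T F q (fun t w => c * X t w).
Proof.
move=> [pX fX]; have pcX := progressiveZ c pX.
pose a w := ((\int[leb]_(t in `[0%R, T]) `|X t w|%:E) `^ q)%E.
have ma : measurable_fun setT a.
  by exact: abs_integral_power_measurable.
have a0 w : (0 <= a w)%E by exact: poweR_ge0.
apply: (@in_Hp_bound _ (fun w => (`|c| `^ q)%:E * a w)%E (cst 0%E) pcX).
- by apply: emeasurable_funM.
- by move=> w; rewrite mule_ge0 ?lee_fin ?powR_ge0.
- by [].
- rewrite ge0_integralZl_EFin ?powR_ge0//.
  by apply: lte_mul_pinfty; rewrite ?lee_fin ?powR_ge0.
- by rewrite integral0.
apply: aeW => w; rewrite adde0.
have -> : (\int[leb]_(t in `[0%R, T]) `|c * X t w|%:E =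
    `|c|%:E * \int[leb]_(t in `[0%R, T]) `|X t w|%:E)%E.
  rewrite -ge0_integralZl_EFin//; last exact: path_abs_measurable.
  by apply: eq_integral => t _; rewrite normrM EFinM.
by rewrite poweRM//; exact: abs_integral_ge0.
Qed.

Lemma in_Hp_integrable X : in_Hp P T F q X ->
  {ae P, forall w, leb.-integrable `[0, T] (EFin \o (fun t => X t w))}.
Proof.
move=> [pX fX]; pose a w := ((\int[leb]_(t in `[0%R, T]) `|X t w|%:E) `^ q)%E.
have ia : P.-integrable setT a.
  apply/integrableP; split.
    by exact: abs_integral_power_measurable.
  by under eq_integral do rewrite gee0_abs ?poweR_ge0//.
apply: filterS (integrable_ae measurableT ia) => w /(_ I) fa.
apply/integrableP; split.
  by apply/measurable_EFinP; exact: (progressive_path w pX (ltW T0)).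
rewrite ltey; apply: contraL fa => /eqP E.
by rewrite /a /= E poweRyr ?gt_eqF.
Qed.

Lemma in_Sp_in_Hp Y : in_Sp P T F q Y -> in_Hp P T F q Y.
Proof.
move=> [[pY _] fY].
have Tq : 0 < T `^ q by rewrite powR_gt0.
pose S w := ereal_sup [set (`|Y t w| `^ q)%:E | t in `[0%R, T]].
have S0 w : (0 <= S w)%E.
  apply: (@le_trans _ _ (`|Y 0 w| `^ q)%:E); first by rewrite lee_fin powR_ge0.
  by apply: ereal_sup_ubound; exists 0 => //=; rewrite in_itv/= lexx (ltW T0).
(* After division by T the time integral is at most the supremum, so that no constant multiplies the
   possibly nonmeasurable S. *)
pose Y' t w := T^-1 * Y t w.
suff [pY' fY'] : in_Hp P T F q Y'.
  have := in_HpZ T (conj pY' fY').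
  by rewrite (_ : (fun t w => _) = Y)//; apply/funext => t; apply/funext => w;
    rewrite /Y' mulrA divff ?mul1r// gt_eqF.
apply: (@in_Hp_bound Y' (cst 0%E) S) => //; first exact: progressiveZ.
  by rewrite integral0.
apply: aeW => w; rewrite add0e.
case E : (S w) (S0 w) => [r| |//]; last by move=> _; exact: leey.
rewrite lee_fin => r0.
have H : (\int[leb]_(t in `[0%R, T]) `|Y' t w|%:E <= (r `^ q^-1)%:E)%E.
  apply: (@le_trans _ _ (\int[leb]_(t in `[0%R, T]) (cst (T^-1 * r `^ q^-1)%:E) t)%E).
    apply: ge0_le_integral => //.
    - by apply: path_abs_measurable; exact: progressiveZ.
    - move=> t tT; rewrite lee_fin /Y' normrM ger0_norm ?invr_ge0 ?(ltW T0)//.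
      rewrite ler_wpM2l ?invr_ge0 ?(ltW T0)//.
      have : ((`|Y t w| `^ q)%:E <= r%:E)%E.
        by rewrite -E; apply: ereal_sup_ubound; exists t.
      rewrite lee_fin => /(le_powR2r (_ : 0 <= q^-1)); rewrite invr_ge0 (ltW q0).
      move=> /(_ isT (powR_ge0 _ _)).
      by rewrite -powRrM mulfV ?gt_eqF// powRr1.
  rewrite integral_cst//= lebesgue_measure_itv/= lte_fin T0 -EFinB subr0 -EFinM lee_fin.
  by rewrite mulrAC mulVf ?mul1r// gt_eqF.
apply: (le_trans (le_poweR (ltW q0) (abs_integral_ge0 Y' w) H)).
by rewrite poweR_EFin -powRrM mulVf ?gt_eqF// powRr1.
Qed.

Lemma in_Mp_in_Hp (d : nat) (Z : R -> Omega -> 'rV[R]_d) :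
  in_Mp P T F q Z -> in_Hp P T F q (fun t w => enorm (Z t w)).
Proof.
move=> [pZ fZ]; have pe := progressive_enorm_path pZ.
have pe2 := progressive_enorm pZ.
have q20 : 0 < q / 2 by rewrite divr_gt0.
pose Q w := (\int[leb]_(t in `[0%R, T]) (enorm (Z t w) ^+ 2)%:E)%E.
have Q0 w : (0 <= Q w)%E by apply: integral_ge0 => t _; rewrite lee_fin sqr_ge0.
have mQ : measurable_fun setT Q.
  by apply: nonneg_integral_measurable => // t w; exact: sqr_ge0.
have mQp : measurable_fun setT (fun w => (Q w) `^ (q / 2))%E.
  by exact: (measurableT_comp (measurable_poweR _) mQ).
(* The first factor comes from the bound a (T + 1) on the time integral of |Z|, the second from
   splitting a^q = (1 + r)^(q/2), where r is the energy. *)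
pose k := (T + 1) `^ q * 2 `^ (q / 2).
have k0 : 0 <= k by rewrite mulr_ge0 ?powR_ge0.
apply: (@in_Hp_bound _ (fun w => k%:E * (1 + Q w `^ (q / 2)))%E (cst 0%E) pe).
- by apply: emeasurable_funM => //; exact: emeasurable_funD.
- by move=> w; rewrite mule_ge0 ?lee_fin// adde_ge0// poweR_ge0.
- by [].
- rewrite ge0_integralZl_EFin//; last 2 first.
  + by move=> w _; rewrite adde_ge0// poweR_ge0.
  + exact: emeasurable_funD.
  rewrite ge0_integralD//; last by move=> w _; rewrite poweR_ge0.
  apply: lte_mul_pinfty; rewrite ?lee_fin//.
  apply: lte_add_pinfty fZ; by rewrite integral_cst//= probability_setT mule1 ltry.
- by rewrite integral0.
apply: aeW => w; rewrite adde0.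
case E : (Q w) (Q0 w) => [r| |//]; last first.
  rewrite poweRyr ?gt_eqF// addey// => _.
  by rewrite gt0_muley ?leey// lte_fin mulr_gt0// powR_gt0// addr_gt0.
rewrite lee_fin => r0.
(* |z| <= (a + |z|^2 / a) / 2 with a = sqrt (1 + int |Z|^2) *)
pose a := Num.sqrt (1 + r).
have r1 : 0 < 1 + r by rewrite ltr_pwDl.
have a0 : 0 < a by rewrite sqrtr_gt0.
have a2 : a ^+ 2 = 1 + r by rewrite sqr_sqrtr// ltW.
have H : (\int[leb]_(t in `[0%R, T]) `|enorm (Z t w)|%:E <= (a * (T + 1))%:E)%E.
  apply: (@le_trans _ _ (\int[leb]_(t in `[0%R, T])
      (a%:E + a^-1%:E * (enorm (Z t w) ^+ 2)%:E))%E).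
    have m2 : measurable_fun `[0, T] (fun t => (enorm (Z t w) ^+ 2)%:E).
      by apply/measurable_EFinP; exact: (progressive_path w pe2 (ltW T0)).
    apply: ge0_le_integral => //.
    - exact: (path_abs_measurable w pe).
    - by apply: emeasurable_funD => //; exact: emeasurable_funM.
    - move=> t _; rewrite -EFinM -EFinD lee_fin (ger0_norm (enorm_ge0 _)).
      set x := enorm _; have x0 : 0 <= x by exact: enorm_ge0.
      rewrite -(ler_pM2l a0) mulrDr mulrA divff ?gt_eqF// mul1r.
      have := sqr_ge0 (a - x); have := sqr_ge0 a; have := mulr_ge0 (ltW a0) x0.
      clear; nra.
  rewrite ge0_integralD//=; last 3 first.
  - by move=> t _; rewrite lee_fin ltW.
  - by move=> t _; rewrite -EFinM lee_fin mulr_ge0 ?invr_ge0 ?(ltW a0)// sqr_ge0.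
  - apply: emeasurable_funM => //; apply/measurable_EFinP.
    exact: (progressive_path w pe2 (ltW T0)).
  rewrite integral_cst//= lebesgue_measure_itv/= lte_fin T0 -EFinB subr0 -EFinM.
  rewrite ge0_integralZl_EFin//; last 3 first.
  - by move=> t _; rewrite lee_fin sqr_ge0.
  - by apply/measurable_EFinP; exact: (progressive_path w pe2 (ltW T0)).
  - by rewrite invr_ge0 ltW.
  rewrite -/(Q w) E -EFinM -EFinD lee_fin mulrDr mulr1 lerD2l.
  by rewrite mulrC ler_pdivrMr// -expr2 a2 lerDr.
apply: (le_trans (le_poweR (ltW q0) (abs_integral_ge0 (fun t w => enorm (Z t w)) w) H)).
rewrite poweR_EFin lee_fin.
have aq : a `^ q = (1 + r) `^ (q / 2).
  by rewrite /a -powR12_sqrt ?(ltW r1)// -powRrM mulrC.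
rewrite powRM ?(ltW a0) ?addr_ge0 ?(ltW T0)// aq /k mulrC -mulrA.
rewrite ler_wpM2l ?powR_ge0//.
by apply: (le_trans (powR_add_le (ltW q20) ler01 r0)); rewrite powR1.
Qed.

End HpSpaces.

(** * A pathwise Tanaka inequality *)

Section StepSign.
Context {R : realType}.
Local Notation leb := (@lebesgue_measure R).
Implicit Types (u : nat -> R) (y G N h : R -> R).

Lemma measurable_sg : measurable_fun setT (Num.sg : R -> R).
Proof.
rewrite (_ : Num.sg = fun x : R => if 0 < x then 1 else if x < 0 then -1 else 0).
  apply: measurable_fun_ifT => //; first exact: measurable_fun_ltr.
  by apply: measurable_fun_ifT => //; exact: measurable_fun_ltr.
apply/funext => x; case: ltgtP => [x0|x0|<-]; last by rewrite sgr0.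
  by rewrite gtr0_sg.
by rewrite ltr0_sg.
Qed.

(** The sign is a subgradient of the absolute value. Summed along a grid, the part given away
    corresponds to the local time in the continuous formula. *)
Lemma sg_mul_sub_le (a b : R) : Num.sg a * (b - a) <= `|b| - `|a|.
Proof.
case: (ltgtP a 0) => [a0|a0|->].
- by rewrite ltr0_sg// (ltr0_norm a0) mulN1r opprB opprK addrC lerD2r -normrN ler_norm.
- by rewrite gtr0_sg// (gtr0_norm a0) mul1r lerD2r ler_norm.
- by rewrite sgr0 mul0r normr0 subr0.
Qed.

Lemma sg_close (a b : R) : `|a - b| < `|a| -> Num.sg b = Num.sg a.
Proof.
case: (ltgtP a 0) => [a0|a0|->]; last by rewrite normr0 normr_lt0.
- rewrite (ltr0_norm a0) ltr_norml opprK => /andP[H _].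
  by rewrite !ltr0_sg//; move: H; rewrite ltrDl oppr_gt0.
- rewrite (gtr0_norm a0) ltr_norml => /andP[_ H].
  by rewrite !gtr0_sg//; move: H; rewrite ltrBlDr ltrDl.
Qed.

(** Left-point signs on cells open on the left, as in a predictable integrand. On a grid starting at
    0 the time 0 lies in no cell. *)
Definition step_sign u n y (s : R) : R :=
  \sum_(k < n) (u k < s <= u k.+1)%R%:R * Num.sg (y (u k)).

Lemma interval_count u n s : (forall k, u k <= u k.+1) ->
  \sum_(k < n) (u k < s <= u k.+1)%R%:R = (u 0%N < s <= u n)%R%:R :> R.
Proof.
move=> um; have mono : forall k, u 0%N <= u k by elim=> // k /le_trans; apply.
elim: n => [|n IH].
  by rewrite big_ord0; case: ltP => //= H; rewrite leNgt H.
rewrite big_ord_recr/= IH; have [sn|sn] := leP s (u n).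
  by rewrite andbT/= addr0 (le_trans sn (um n)) andbT.
by rewrite andbF add0r (le_lt_trans (mono n) sn).
Qed.

Lemma step_sign_eq u n y s c : (forall k, u k <= u k.+1) -> u 0%N < s <= u n ->
  (forall k, u k < s <= u k.+1 -> Num.sg (y (u k)) = c) -> step_sign u n y s = c.
Proof.
move=> um sn H; transitivity ((u 0%N < s <= u n)%R%:R * c); last by rewrite sn mul1r.
rewrite -interval_count// mulr_suml; apply: eq_bigr => k _.
by case: (boolP (_ < _ <= _)) => [/H ->|]; rewrite ?mul0r.
Qed.

Lemma step_sign_le1 u n y s : (forall k, u k <= u k.+1) -> `|step_sign u n y s| <= 1.
Proof.
move=> um; apply: (le_trans (ler_norm_sum _ _ _)).
apply: (@le_trans _ _ (\sum_(k < n) (u k < s <= u k.+1)%R%:R)).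
  apply: ler_sum => k _; rewrite normrM ger0_norm//.
  by rewrite ler_piMr// normr_sg; case: (_ == _).
by rewrite interval_count//; case: (_ < _ <= _).
Qed.

Lemma step_sign_measurable u n y : measurable_fun setT (step_sign u n y).
Proof.
apply: measurable_sum => k; apply: measurable_funM => //.
rewrite (_ : (fun s => _) = \1_(`]u k, u k.+1]%classic)).
  exact: measurable_indic.
by apply/funext => s; rewrite indicE/= in_setE in_itv || rewrite indicE mem_setE in_itv.
Qed.

Definition unif T m (k : nat) : R := k%:R * (T / m.+1%:R).

Lemma unif_mono T m k : 0 <= T -> unif T m k <= unif T m k.+1.
Proof. by move=> T0; rewrite ler_wpM2r ?divr_ge0// ler_nat. Qed.

Lemma unif_step T m k : unif T m k.+1 = unif T m k + T / m.+1%:R.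
Proof. by rewrite /unif -natr1 mulrDl mul1r. Qed.

Lemma unif0 T m : unif T m 0 = 0. Proof. by rewrite /unif mul0r. Qed.

Lemma unif_last T m : unif T m m.+1 = T.
Proof. by rewrite /unif mulrC divfK. Qed.

Lemma unif_bounds T m k : 0 <= T -> (k <= m.+1)%N -> 0 <= unif T m k <= T.
Proof.
move=> T0 km; rewrite /unif mulr_ge0 ?divr_ge0//= mulrA ler_pdivrMr// mulrC.
by rewrite ler_wpM2l// ler_nat.
Qed.

(** Near a point where y does not vanish its sign is constant, and the left end of the cell of s
    comes that close once the mesh is small. *)
Lemma step_sign_cvg T y s : 0 < T -> {within `[0, T], continuous y} -> 0 < s <= T ->
  y s != 0 -> \forall m \near \oo, step_sign (unif T m) m.+1 y s = Num.sg (y s).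
Proof.
move=> T0 cy /andP[s0 sT] ys; have ys0 : 0 < `|y s| by rewrite normr_gt0.
have sT' : 0 <= s <= T by rewrite sT ltW.
have [dl dl0 H] := (within_continuous_eps T y).1 cy s sT' _ ys0.
have := near_infty_natSinv_lt (PosNum (divr_gt0 dl0 T0)); apply: filterS => m /= mdl.
apply: step_sign_eq; first by move=> k; rewrite unif_mono// ltW.
  by rewrite unif0 unif_last s0.
move=> k /andP[ks sk]; apply: sg_close; apply: H.
  by rewrite mulr_ge0 ?divr_ge0 ?(ltW T0)//= (le_trans (ltW ks)).
rewrite ger0_norm ?subr_ge0 ?(ltW ks)//; move: sk; rewrite unif_step -lerBlDl.
move=> /le_lt_trans; apply; by move: mdl; rewrite ltr_pdivlMr// mulrC.
Qed.

End StepSign.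

Section SignIntegral.
Context {R : realType}.
Local Notation leb := (@lebesgue_measure R).
Context (T : R) (y G N h : R -> R).
Hypotheses (T0 : 0 < T) (cy : {within `[0, T], continuous y}).
Let sigma m := step_sign (unif T m) m.+1 y.

Let sigma_le1 m s : `|sigma m s| <= 1.
Proof. by apply: step_sign_le1 => k; rewrite unif_mono// ltW. Qed.

(** The factor 2: one copy of N comes from the pointwise bound on h, the other pays for the zeros of
    y. Off the zeros, dominated convergence exchanges the sign of y for the grid sign. *)
Lemma sign_integral_bound (D : set R) : measurable D -> D `<=` `]0, T]%classic ->
  measurable_fun D y -> measurable_fun D h ->
  leb.-integrable D (EFin \o G) -> leb.-integrable D (EFin \o N) ->
  (forall s, D s -> 0 <= h s <= N s - Num.sg (y s) * G s) ->
  (forall s, D s -> 0 <= N s) -> (forall s, D s -> y s = 0 -> `|G s| <= N s) ->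
  leb.-integrable D (EFin \o h) /\ forall e, 0 < e -> \forall m \near \oo,
   (\int[leb]_(s in D) h s)%R <= 2 * (\int[leb]_(s in D) N s)%R -
     (\int[leb]_(s in D) (sigma m s * G s))%R + e.
Proof.
move=> mD D0T my mh iG iN hN N0 GN.
have comb (a b c d' f e : R) :
  a <= b - c -> f - d' <= b -> d' < c + e -> a <= 2 * b - f + e by lra.
have mG : measurable_fun D G by apply/measurable_EFinP; exact: (measurable_int leb).
have mN : measurable_fun D N by apply/measurable_EFinP; exact: (measurable_int leb).
have iGn : leb.-integrable D (EFin \o (fun s => `|G s|)) by exact: integrable_norm iG.
have dom (f : R -> R) : measurable_fun D f -> (forall s, D s -> `|f s| <= `|G s|) ->
    leb.-integrable D (EFin \o f).
  move=> mf fG; apply: (@le_integrable _ _ _ leb _ mD _ (EFin \o G)) => //.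
  exact/measurable_EFinP.
pose S s := Num.sg (y s) * G s.
have mS : measurable_fun D S.
  by apply: measurable_funM => //; exact: (measurableT_comp measurable_sg my).
have sg1 (x : R) : `|Num.sg x| <= 1 by rewrite normr_sg; case: (_ == _).
have mul_le (a b : R) : `|a| <= 1 -> `|a * b| <= `|b|.
  by move=> a1; rewrite normrM ler_piMl.
have iS : leb.-integrable D (EFin \o S) by apply: dom => // s _; exact: mul_le.
(* The integrand with the zeros of y removed. Since S vanishes at the zeros too, [Psi m] tends to S
   at every point of D. *)
pose Psi m s := (y s != 0)%:R * (sigma m s * G s).
have mnz : measurable_fun D (fun s => (y s != 0)%:R : R).
  rewrite (_ : (fun s => _) = (fun s => `|Num.sg (y s)|)).
    by apply: measurableT_comp => //; exact: (measurableT_comp measurable_sg my).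
  by apply/funext => s; rewrite normr_sg.
have msG m : measurable_fun D (fun s => sigma m s * G s).
  by apply: measurable_funM => //; apply: measurable_funTS; exact: step_sign_measurable.
have mPsi m : measurable_fun D (Psi m) by exact: measurable_funM.
have isG m : leb.-integrable D (EFin \o (fun s => sigma m s * G s)).
  by apply: dom => // s _; exact: mul_le.
have nz1 s : `|(y s != 0)%:R : R| <= 1 by case: (_ != _); rewrite ?normr1 ?normr0.
have PsiG m s : `|Psi m s| <= `|G s|.
  by apply: (le_trans (mul_le _ _ (nz1 s))); exact: mul_le.
have iPsi m : leb.-integrable D (EFin \o Psi m) by apply: dom.
have iBR (a b : R -> R) : leb.-integrable D (EFin \o a) -> leb.-integrable D (EFin \o b) ->
    leb.-integrable D (EFin \o (fun s => a s - b s)).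
  move=> ia ib; rewrite (_ : _ \o _ = (EFin \o a) \- (EFin \o b))%E//.
  exact: integrableB.
have iNS : leb.-integrable D (EFin \o (fun s => N s - S s)) by exact: iBR.
have ih : leb.-integrable D (EFin \o h).
  apply: (@le_integrable _ _ _ leb _ mD _ (EFin \o (fun s => N s - S s))) => //.
    exact/measurable_EFinP.
  by move=> s Ds; have /andP[h0 h1] := hN s Ds; rewrite lee_fin ger0_norm// (le_trans h1)// ler_norm.
split => // e e0.
have cv : (\int[leb]_(s in D) Psi m s)%R @[m --> \oo] --> (\int[leb]_(s in D) S s)%R.
  have [|||||_ _ cv] := @dominated_convergence _ _ _ leb D mD
    (fun m => EFin \o Psi m) (EFin \o S) (EFin \o (fun s => `|G s|)).
  - by move=> m; apply/measurable_EFinP; exact: mPsi.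
  - exact/measurable_EFinP.
  - apply: aeW => s Ds; apply: cvg_EFin; first exact: nearW.
    apply/cvgrPdist_lt => r r0; have [ys|ys] := eqVneq (y s) 0.
      by apply: nearW => m /=; rewrite /S /Psi ys eqxx sgr0 !mul0r subrr normr0.
    have := D0T s Ds; rewrite /= in_itv/= => s0T.
    apply: filterS (step_sign_cvg T0 cy s0T ys) => m E.
    by rewrite /= /S /Psi /sigma E ys mul1r subrr normr0.
  - exact: iGn.
  - by apply: aeW => s m Ds; rewrite /= lee_fin.
  rewrite /Rintegral; apply: fine_cvg; rewrite fineK//.
  exact: integrable_fin_num.
move/cvgrPdist_lt : cv => /(_ e e0); apply: filterS => m.
rewrite ltr_distlC => /andP[_ Hm].
have H1 : (\int[leb]_(s in D) h s)%R <= (\int[leb]_(s in D) N s)%R - (\int[leb]_(s in D) S s)%R.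
  rewrite -RintegralB//; apply: le_Rintegral => // s Ds.
  by have /andP[] := hN s Ds.
have H2 : (\int[leb]_(s in D) (sigma m s * G s))%R - (\int[leb]_(s in D) Psi m s)%R <=
    (\int[leb]_(s in D) N s)%R.
  rewrite -RintegralB//; apply: le_Rintegral => //; first exact: iBR.
  move=> s Ds; rewrite /Psi; have [ys|ys] := eqVneq (y s) 0.
    rewrite mul0r subr0; apply: le_trans (GN s Ds ys); apply: (le_trans (ler_norm _)).
    exact: mul_le.
  by rewrite mul1r subrr N0.
move: H1 H2 Hm.
set a := (\int[leb]_(s in D) h s)%R; set b := (\int[leb]_(s in D) N s)%R.
set c := (\int[leb]_(s in D) S s)%R; set d' := (\int[leb]_(s in D) Psi m s)%R.
set f := (\int[leb]_(s in D) (sigma m s * G s))%R.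
exact: comb.
Qed.

End SignIntegral.

Section TanakaPath.
Context {R : realType}.
Local Notation leb := (@lebesgue_measure R).
Context (T : R) (y G N h : R -> R).
Hypotheses (T0 : 0 < T) (cy : {within `[0, T], continuous y}).
Hypothesis iG : leb.-integrable `[0, T] (EFin \o G).

Let Gam (t : R) : R := (\int[leb]_(s in `[0%R, t]) G s)%R.

Lemma Rintegral_itv_increment s t : 0 <= s -> s <= t -> t <= T ->
  (\int[leb]_(r in `]s, t]) G r)%R = Gam t - Gam s.
Proof.
move=> s0 st tT; rewrite /Gam Rintegral_itvB ?bnd_simp//.
by apply: integrableS iG => //; apply: subset_itvl; rewrite bnd_simp.
Qed.

Lemma Rintegral_step_sign (u : nat -> R) n : (forall k, u k <= u k.+1) ->
  (forall k, (k <= n)%N -> 0 <= u k <= T) ->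
  (\int[leb]_(s in `[0%R, T]) (step_sign u n y s * G s))%R =
  \sum_(k < n) Num.sg (y (u k)) * (Gam (u k.+1) - Gam (u k)).
Proof.
move=> um; elim: n => [|n IH] uT.
  rewrite big_ord0; under eq_Rintegral do rewrite /step_sign big_ord0 mul0r.
  by rewrite /Rintegral integral0.
have mI : measurable (`[0, T]%classic : set R) by [].
have bd (f : R -> R) c : measurable_fun setT f -> (forall s, `|f s| <= c) ->
    leb.-integrable `[0, T] (EFin \o (fun s => f s * G s)).
  move=> mf fc; apply: (@le_integrable _ _ _ leb _ mI _ (EFin \o (fun s => c * G s))).
  - apply/measurable_EFinP; apply: measurable_funM; first exact: measurable_funTS.
    by apply/measurable_EFinP; exact: (measurable_int leb).
  - move=> s _; rewrite lee_fin !normrM ler_wpM2r//.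
    by rewrite (le_trans (fc s))// ler_norm.
  - rewrite (_ : _ \o _ = fun s => (c%:E * (EFin \o G) s)%E)//.
    exact: integrableZl.
under eq_Rintegral do rewrite /step_sign big_ord_recr/= mulrDl -/(step_sign u n y _).
rewrite RintegralD//; last 2 first.
- by apply: (bd _ 1); [exact: step_sign_measurable|move=> s; exact: step_sign_le1].
- apply: (bd _ 1).
    apply: measurable_funM => //.
    rewrite (_ : (fun s => _) = \1_(`]u n, u n.+1]%classic)); first exact: measurable_indic.
    by apply/funext => s; rewrite indicE mem_setE in_itv.
  move=> s; rewrite normrM; apply: mulr_ile1 => //.
    by case: (_ < _ <= _); rewrite ?normr1 ?normr0.
  by rewrite normr_sg; case: (_ == _).
rewrite big_ord_recr/= IH; last by move=> k kn; apply: uT; exact: leqW.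
congr (_ + _); have /andP[un0 unT] := uT n (leqnSn n); have /andP[_ un1T] := uT n.+1 (leqnn _).
rewrite -Rintegral_itv_increment//.
have -> : (\int[leb]_(s in `]u n, u n.+1]) G s)%R =
    (\int[leb]_(s in `[0%R, T]) ((u n < s <= u n.+1)%R%:R * G s))%R.
  rewrite (_ : `]u n, u n.+1]%classic = `[0, T]%classic `&` `]u n, u n.+1]%classic).
    rewrite Rintegral_mkcondr; apply: eq_Rintegral => s _; rewrite patchE mem_setE in_itv/=.
    by case: ifP => _; rewrite ?mul1r ?mul0r.
  apply/seteqP; split => s /=; last by case.
  rewrite !in_itv/= => /andP[s1 s2]; rewrite s1 s2; split => //.
  by rewrite (le_trans un0 (ltW s1)) (le_trans s2).
rewrite -RintegralZl//; last first.
  apply: (bd (fun s => (u n < s <= u n.+1)%R%:R) 1).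
    rewrite (_ : (fun s => _) = \1_(`]u n, u n.+1]%classic)); first exact: measurable_indic.
    by apply/funext => s; rewrite indicE mem_setE in_itv.
  by move=> s; case: (_ < _ <= _); rewrite ?normr1 ?normr0.
by apply: eq_Rintegral => s _; rewrite mulrCA mulrA.
Qed.

(** The increments of K are nonnegative and those of V are taken in absolute value, so their signs
    can be discarded. The signs against I are kept, since the sum of its absolute increments has no
    bound uniform in the grid. *)
Lemma tanaka_sum (c : R) (V K I : R -> R) (u : nat -> R) n : (forall k, u k <= u k.+1) ->
  (forall k, (k <= n)%N -> 0 <= u k <= T) ->
  (forall t, 0 <= t <= T -> y t = c - Gam t - V t - K t + I t) ->
  (forall s t, 0 <= s -> s <= t -> t <= T -> K s <= K t) ->
  - \sum_(k < n) Num.sg (y (u k)) * (Gam (u k.+1) - Gam (u k)) <=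
  `|y (u n)| + \sum_(k < n) `|V (u k.+1) - V (u k)| + (K (u n) - K (u 0%N)) -
  \sum_(k < n) Num.sg (y (u k)) * (I (u k.+1) - I (u k)).
Proof.
move=> um uT yE Kmono.
(* The induction keeps the initial value of |y|, which makes its increments telescope; it is dropped
   at the end. *)
suff H : - \sum_(k < n) Num.sg (y (u k)) * (Gam (u k.+1) - Gam (u k)) <=
  (`|y (u n)| - `|y (u 0%N)|) + \sum_(k < n) `|V (u k.+1) - V (u k)| + (K (u n) - K (u 0%N)) -
  \sum_(k < n) Num.sg (y (u k)) * (I (u k.+1) - I (u k)).
  apply: (le_trans H); rewrite !lerD2r gerDl oppr_le0; exact: normr_ge0.
elim: n uT => [|n IH] uT; first by rewrite !big_ord0 !subrr oppr0 !addr0.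
have {}IH := IH (fun k kn => uT k (leqW kn)).
have Tn := uT n (leqnSn n); have Tn1 := uT n.+1 (leqnn _).
have sg_le (a b : R) : Num.sg a * b <= `|b|.
  apply: (le_trans (ler_norm _)); rewrite normrM ler_piMl// normr_sg.
  by case: (_ == _).
have H1 := sg_mul_sub_le (y (u n)) (y (u n.+1)).
have H2 := sg_le (y (u n)) (V (u n.+1) - V (u n)).
have H3 : Num.sg (y (u n)) * (K (u n.+1) - K (u n)) <= K (u n.+1) - K (u n).
  apply: (le_trans (sg_le _ _)); rewrite ger0_norm// subr_ge0.
  by apply: Kmono => //; [case/andP : Tn|case/andP : Tn1].
have E : Num.sg (y (u n)) * (y (u n.+1) - y (u n)) =
  - (Num.sg (y (u n)) * (Gam (u n.+1) - Gam (u n))) -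
  Num.sg (y (u n)) * (V (u n.+1) - V (u n)) - Num.sg (y (u n)) * (K (u n.+1) - K (u n)) +
  Num.sg (y (u n)) * (I (u n.+1) - I (u n)).
  by rewrite (yE _ Tn1) {2}(yE _ Tn); ring.
rewrite !big_ord_recr/=; move: IH H1 H2 H3; rewrite E.
move: (\sum_(i < n) Num.sg (y (u i)) * (Gam (u i.+1) - Gam (u i))) => S1.
move: (\sum_(i < n) `|V (u i.+1) - V (u i)|) => S2.
move: (\sum_(i < n) Num.sg (y (u i)) * (I (u i.+1) - I (u i))) => S3.
move: (Num.sg (y (u n)) * (Gam (u n.+1) - Gam (u n))) => a1.
move: (Num.sg (y (u n)) * (V (u n.+1) - V (u n))) => a2.
move: (Num.sg (y (u n)) * (K (u n.+1) - K (u n))) => a3.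
move: (Num.sg (y (u n)) * (I (u n.+1) - I (u n))) => a4.
move: `|y (u n.+1)| `|y (u n)| `|y (u 0%N)| `|V (u n.+1) - V (u n)| => b1 b2 b3 b4.
by move: (K (u n.+1)) (K (u n)) (K (u 0%N)) => k1 k2 k3; lra.
Qed.

Hypotheses (mh : measurable_fun `[0, T] h) (iN : leb.-integrable `[0, T] (EFin \o N)).
Hypotheses (h0 : forall s, 0 <= s <= T -> 0 <= h s) (N0 : forall s, 0 <= s <= T -> 0 <= N s).
Hypothesis hN : {ae leb, forall s, 0 <= s <= T -> h s <= N s - Num.sg (y s) * G s}.
Hypothesis GN : {ae leb, forall s, 0 <= s <= T -> y s = 0 -> `|G s| <= N s}.

Lemma tanaka_bound (c : R) (V K I : R -> R) :
  (forall t, 0 <= t <= T -> y t = c - Gam t - V t - K t + I t) ->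
  (forall s t, 0 <= s -> s <= t -> t <= T -> K s <= K t) ->
  leb.-integrable `[0, T] (EFin \o h) /\ \forall m \near \oo,
  (\int[leb]_(s in `[0%R, T]) h s)%R <= 2 * (\int[leb]_(s in `[0%R, T]) N s)%R + 1 + `|y T| +
    \sum_(k < m.+1) `|V (unif T m k.+1) - V (unif T m k)| + (K T - K 0) +
    `|\sum_(k < m.+1) Num.sg (y (unif T m k)) * (I (unif T m k.+1) - I (unif T m k))|.
Proof.
move=> yE Kmono.
have comb (a b S1 S2 b1 k Q q : R) : - Q <= q -> - S1 <= b1 + S2 + k - Q ->
  a <= 2 * b - S1 + 1 -> a <= 2 * b + 1 + b1 + S2 + k + q by lra.
have [Nul [mNul Nul0 sNul]] : {ae leb, forall s, 0 <= s <= T ->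
    h s <= N s - Num.sg (y s) * G s /\ (y s = 0 -> `|G s| <= N s)}.
  have FF := ae_filter_ringOfSetsType leb.
  by apply: (@filterS2 _ _ FF _ _ _ _ hN GN) => s H1 H2 sT; split; [exact: H1|exact: H2].
pose D := `]0, T]%classic `\` Nul.
have mD : measurable D by apply: measurableD.
have D0T : D `<=` `]0, T]%classic by move=> s [].
have D0T' : D `<=` `[0, T]%classic.
  by move=> s [+ _]; rewrite /= !in_itv/= => /andP[/ltW -> ->].
have DT s : D s -> 0 <= s <= T by move=> /D0T'; rewrite /= in_itv.
have Dnul s : D s -> h s <= N s - Num.sg (y s) * G s /\ (y s = 0 -> `|G s| <= N s).
  move=> [sT nN]; have {}sT : 0 <= s <= T by move: sT; rewrite /= in_itv/= => /andP[/ltW -> ->].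
  by apply: contrapT => nH; apply: nN; apply: sNul => /= /(_ sT).
have my : measurable_fun `[0, T] y by apply: subspace_continuous_measurable_fun.
have RD (f : R -> R) : leb.-integrable `[0, T] (EFin \o f) ->
    (\int[leb]_(s in D) f s)%R = (\int[leb]_(s in `[0%R, T]) f s)%R.
  move=> jf; have jf' : leb.-integrable `]0, T] (EFin \o f).
    by apply: integrableS jf => //; apply: subset_itvr; rewrite bnd_simp.
  rewrite -Rintegral_itv_obnd_cbnd// /Rintegral.
  by rewrite (@negligible_integral _ _ _ leb `]0, T]%classic Nul (EFin \o f)).
have um m k : unif T m k <= unif T m k.+1 by exact: unif_mono (ltW T0).
have uT m k : (k <= m.+1)%N -> 0 <= unif T m k <= T by exact: unif_bounds (ltW T0).
have [|||||||ihD Hm] := @sign_integral_bound R T y G N h T0 cy D mD D0T.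
- exact: measurable_funS my.
- exact: measurable_funS mh.
- exact: integrableS iG.
- exact: integrableS iN.
- by move=> s Ds; rewrite h0 ?DT//=; case: (Dnul s Ds).
- by move=> s Ds; exact: N0 (DT s Ds).
- by move=> s Ds; case: (Dnul s Ds).
have ih : leb.-integrable `[0, T] (EFin \o h).
  apply/integrableP; split; first exact/measurable_EFinP.
  have mh' : measurable_fun `]0, T] (fun s => `|(EFin \o h) s|)%E.
    apply/measurable_EFinP; apply: measurableT_comp => //.
    by apply: measurable_funS mh => //; apply: subset_itvr; rewrite bnd_simp.
  rewrite -(@integral_itv_obnd_cbnd _ 0 (BRight T) (fun s => `|(EFin \o h) s|)%E)//.
  rewrite (@ge0_negligible_integral _ _ _ leb `]0, T]%classic Nul)//.
  by case/integrableP : ihD.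
split => //; apply: filterS (Hm 1 ltr01) => m.
have jsG : leb.-integrable `[0, T] (EFin \o (fun s => step_sign (unif T m) m.+1 y s * G s)).
  apply: (@le_integrable _ _ _ leb _ _ _ (EFin \o G)) => //.
  - apply/measurable_EFinP; apply: measurable_funM.
      by apply: measurable_funTS; exact: step_sign_measurable.
    by apply/measurable_EFinP; exact: (measurable_int leb).
  - by move=> s _; rewrite lee_fin normrM ler_piMl// step_sign_le1.
rewrite (RD _ ih) (RD _ iN) (RD _ jsG) (Rintegral_step_sign (um m) (uT m)).
have := tanaka_sum (um m) (uT m) yE Kmono; rewrite unif_last unif0.
move: (\sum_(k < m.+1) Num.sg (y (unif T m k)) * (I (unif T m k.+1) - I (unif T m k))) => Q.
have := ler_norm (- Q); rewrite normrN.
move: (\sum_(k < m.+1) Num.sg (y (unif T m k)) * (Gam (unif T m k.+1) - Gam (unif T m k))) => S1.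
move: (\sum_(k < m.+1) `|V (unif T m k.+1) - V (unif T m k)|) => S2.
move: (\int[leb]_(s in `[0%R, T]) h s)%R (\int[leb]_(s in `[0%R, T]) N s)%R => a b.
exact: comb.
Qed.

End TanakaPath.

(** * Pointwise bounds on the generator *)

Section GeneratorBounds.
Context {R : realType}.
Implicit Types (rho : R -> R).

Lemma concave_linear_growth rho : (forall u, 0 <= u -> 0 <= rho u) ->
  {in `[0, +oo[ &, {homo rho : u v / u <= v}} ->
  convex_function (`[0, +oo[%classic : set R) (fun u => - rho u) -> rho 0 = 0 ->
  forall u, 0 <= u -> rho u <= rho 1 * (1 + u).
Proof.
move=> rho0 mono conc r0 u u0.
have [u1|/ltW u1] := leP u 1.
  apply: (@le_trans _ _ (rho 1)); first by apply: mono => //; rewrite in_itv/= andbT// ler01.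
  by rewrite ler_peMr ?rho0// lerDl.
have up : 0 < u by exact: lt_le_trans u1.
have i1 : 0 <= u^-1 by rewrite invr_ge0.
have i2 : u^-1 <= 1 by rewrite invf_le1.
(* The point 1 is the convex combination of u and 0 with weight 1/u on u; with rho 0 = 0 concavity
   gives rho(u) / u <= rho(1). *)
have := conc (Itv01 i1 i2) u 0.
rewrite !inE/= !in_itv/= !andbT => /(_ u0 (lexx _)).
change (- rho (u^-1 * u + (1 - u^-1) * 0) <= u^-1 * (- rho u) + (1 - u^-1) * (- rho 0) ->
  rho u <= rho 1 * (1 + u)).
rewrite r0 oppr0 !mulr0 !addr0 mulVf ?gt_eqF// mulrN lerN2.
rewrite mulrC ler_pdivrMr// => H; apply: (le_trans H).
by rewrite ler_wpM2l ?rho0// lerDr.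
Qed.

(** For y nonzero, a = sgn(y) gy is at most c = r + |g0|, so |gy| <= 2 c - a; replacing gy by G in a
    costs b. At y = 0 the sign gives no information and gy = g0 is used. *)
Lemma generator_abs_bound (y gy G g0 r b : R) : 0 <= r ->
  (gy - g0) * Num.sg y <= r -> `|G - gy| <= b -> (y = 0 -> gy = g0) ->
  `|gy| <= 2 * r + 2 * `|g0| + b - Num.sg y * G.
Proof.
move=> r0 H; rewrite ler_norml => /andP[H1 H2] y0.
have g00 : 0 <= `|g0| by []; have := ler_norm g0; have := ler_norm (- g0); rewrite normrN.
move: H y0; case: (ltgtP y 0) => [yn|yp|->].
- rewrite (ltr0_sg yn) mulrN1 => H _ Hn Hp.
  by rewrite ler_norml; apply/andP; split; lra.
- rewrite (gtr0_sg yp) mulr1 => H _ Hn Hp.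
  by rewrite ler_norml; apply/andP; split; lra.
- rewrite sgr0 mul0r => _ -> // Hn Hp.
  by lra.
Qed.

End GeneratorBounds.

(** * Finite lower integrals and lower limits *)

Section FiniteLowerIntegral.
Context {R : realType} {dO : measure_display} {Omega : measurableType dO}.
Context (P : probability Omega R).
Import HBNNSimple.
Implicit Types (f g J phi : Omega -> \bar R).

(** The measurable share of an upper bound: such terms can be added freely, while the remaining
    share is only known through a lower integral. *)
Definition fin_pos f :=
  [/\ measurable_fun setT f, forall w, (0 <= f w)%E & (\int[P]_w f w < +oo)%E].

Lemma fin_posD f g : fin_pos f -> fin_pos g -> fin_pos (fun w => f w + g w)%E.
Proof.
move=> [mf f0 ff] [mg g0 fg]; split; first exact: emeasurable_funD.
  by move=> w; rewrite adde_ge0.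
by rewrite ge0_integralD//; exact: lte_add_pinfty.
Qed.

Lemma fin_pos_cst (c : R) : 0 <= c -> fin_pos (cst c%:E).
Proof. by move=> c0; split => //; rewrite integral_cst//= probability_setT mule1 ltry. Qed.

Lemma nonmeasurable_integralZ_le (c : R) f : 0 < c -> (forall w, 0 <= f w)%E ->
  (\int[P]_w (c%:E * f w) <= c%:E * \int[P]_w f w)%E.
Proof.
move=> c0 f0; have ci0 : 0 <= c^-1 by rewrite invr_ge0 ltW.
rewrite ge0_integralTE; last by move=> w; rewrite mule_ge0// lee_fin ltW.
apply: ge_ereal_sup => _ [h /= hf <-]; rewrite -integralT_nnsfun.
have mh : measurable_fun setT (fun w => (h w)%:E) by exact/measurable_EFinP.
have -> : (\int[P]_w (h w)%:E = c%:E * \int[P]_w (c^-1%:E * (h w)%:E))%E.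
  rewrite ge0_integralZl_EFin//; last by move=> w _; rewrite lee_fin.
  by rewrite muleA -EFinM divff ?mul1e// gt_eqF.
rewrite lee_pmul2l//; apply: le_nonmeasurable_integral => w.
  by rewrite -EFinM lee_fin mulr_ge0.
apply: (@le_trans _ _ (c^-1%:E * (c%:E * f w))%E).
  by rewrite lee_pmul2l// lte_fin invr_gt0.
by rewrite muleA -(EFinM c^-1 c) mulVf ?mul1e// gt_eqF.
Qed.

Lemma lower_integral_finite (c : R) J f phi : 0 < c -> (forall w, 0 <= J w)%E ->
  fin_pos f -> (forall w, 0 <= phi w)%E -> (\int[P]_w phi w < +oo)%E ->
  {ae P, forall w, (J w <= c%:E * (f w + phi w))%E} -> (\int[P]_w J w < +oo)%E.
Proof.
move=> c0 J0 [mf f0 ff] phi0 fphi H.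
have ci0 : 0 < c^-1 by rewrite invr_gt0.
have E w : J w = (c%:E * (c^-1%:E * J w))%E by rewrite muleA -EFinM divff ?mul1e// gt_eqF.
have J'0 w : (0 <= c^-1%:E * J w)%E by rewrite mule_ge0// lee_fin ltW.
rewrite (_ : (fun w => J w) = (fun w => c%:E * (c^-1%:E * J w)))%E; last exact/funext.
apply: le_lt_trans (nonmeasurable_integralZ_le c0 J'0) _.
apply: lte_mul_pinfty => //; first by rewrite lee_fin ltW.
apply: le_lt_trans (lte_add_pinfty ff fphi).
apply: nonmeasurable_integral_le_add => //; apply: filterS H => w H.
by rewrite -(@lee_pmul2l _ c%:E)// -E.
Qed.

(** The hypothesis holds from an index that depends on the path; the lower limit removes that index
    and leaves a function to which Fatou's lemma applies. *)
Lemma le_limn_einf (x A : \bar R) (c : (\bar R)^nat) : (0 <= A)%E -> (forall n, 0 <= c n)%E ->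
  (\forall n \near \oo, x <= A + c n)%E -> (x <= A + limn_einf c)%E.
Proof.
move=> A0 c0 H; case: A A0 H => [r r0 H| _ _|//].
  have {}H : (\forall n \near \oo, x - r%:E <= c n)%E.
    by apply: filterS H => n; rewrite leeBlDl.
  rewrite -leeBlDl// limn_einf_lim; apply: lime_ge; first exact: is_cvg_einfs.
  have [N _ HN] := H; exists N => // n /= Nn; apply: le_ereal_inf_tmp => _ [k /= nk <-].
  by apply: HN => /=; exact: leq_trans nk.
rewrite addye ?leey// -ltNye; apply: (@lt_le_trans _ _ 0%E) => //.
rewrite limn_einf_lim; apply: lime_ge; first exact: is_cvg_einfs.
by apply: nearW => n; apply: le_ereal_inf_tmp => _ [k /= _ <-].
Qed.

Lemma le_limn_einfZ (r : R) (x A : \bar R) (c : (\bar R)^nat) : 0 < r ->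
  (0 <= A)%E -> (forall n, 0 <= c n)%E ->
  (\forall n \near \oo, x <= r%:E * (A + c n))%E -> (x <= r%:E * (A + limn_einf c))%E.
Proof.
move=> r0 A0 c0 H; have E : x = (r%:E * (r^-1%:E * x))%E.
  by rewrite muleA -EFinM divff ?mul1e// gt_eqF.
rewrite E lee_pmul2l//; apply: le_limn_einf => //; apply: filterS H => n.
by rewrite {1}E lee_pmul2l.
Qed.

Lemma limn_einf_fin_pos (f_ : nat -> Omega -> \bar R) (C : R) :
  (forall n, measurable_fun setT (f_ n)) -> (forall n w, 0 <= f_ n w)%E ->
  (forall n, \int[P]_w f_ n w <= C%:E)%E ->
  fin_pos (fun w => limn_einf (f_ ^~ w)).
Proof.
move=> mf f0 fC; split.
- rewrite /limn_einf; apply: measurableT_comp => //.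
  by apply: measurable_fun_limn_esup => n; exact: measurableT_comp.
- move=> w; rewrite limn_einf_lim; apply: lime_ge; first exact: is_cvg_einfs.
  by apply: nearW => n; apply: le_ereal_inf_tmp => _ [k /= _ <-].
- apply: (le_lt_trans (fatou P measurableT mf (fun n w _ => f0 n w))).
  apply: (@le_lt_trans _ _ C%:E); last exact: ltry.
  rewrite limn_einf_lim; apply: lime_le; first exact: is_cvg_einfs.
  apply: nearW => n; apply: le_trans (fC n).
  by apply: ereal_inf_lbound; exists n => /=.
Qed.

Lemma poweR_sum_le (q : R) (s : seq (\bar R)) (x : \bar R) : 0 < q ->
  all (fun y => (0 <= y)%E) s -> (0 <= x)%E -> (x <= \sum_(y <- s) y)%E -> s != [::] ->
  (x `^ q <= ((size s)%:R `^ q)%:E * \sum_(y <- s) (y `^ q))%E.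
Proof.
move=> q0 s0 x0 xs sn.
have [M Ms MP] : exists2 M, M \in s & forall y, y \in s -> (y <= M)%E.
  elim: s sn {s0 xs} => [//|a [|b s] IH] _.
    by exists a; rewrite ?inE// => y; rewrite inE => /eqP ->.
  have [//|M Ms MP] := IH; have [aM|Ma] := leP a M.
    by exists M => [|y]; rewrite in_cons ?Ms ?orbT// => /predU1P[->//|/MP].
  exists a; first by rewrite inE eqxx.
  move=> y; rewrite inE => /predU1P[->//|/MP yM]; exact: le_trans yM (ltW Ma).
have M0 : (0 <= M)%E by move/allP : s0; apply.
have sumM : forall r : seq (\bar R), (forall y, y \in r -> (y <= M)%E) ->
    (\sum_(y <- r) y <= (size r)%:R%:E * M)%E.
  elim=> [|a r IH] rM; first by rewrite big_nil mul0e.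
  rewrite big_cons /= -natr1 EFinD ge0_muleDl ?lee_fin// mul1e addeC.
  apply: leeD; last by apply: rM; rewrite inE eqxx.
  by apply: IH => y yr; apply: rM; rewrite inE yr orbT.
have sz : (0 <= (size s)%:R%:E :> \bar R)%E by rewrite lee_fin.
apply: (le_trans (le_poweR (ltW q0) x0 (le_trans xs (sumM s MP)))).
rewrite poweRM// poweR_EFin lee_wpmul2l ?lee_fin ?powR_ge0//.
rewrite (big_rem M Ms)/= leeDl// big_seq.
by elim/big_ind: _ => // [u v u0 v0|u _]; [exact: adde_ge0|exact: poweR_ge0].
Qed.

End FiniteLowerIntegral.

(** * Integrability of the generator *)

Section ReflectedSolution.
Context {R : realType} {dO : measure_display} {Omega : measurableType dO}.
Context (P : probability Omega R) (T : R) (d : nat) (B : R -> Omega -> 'rV[R]_d).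
Local Notation F := (brownian_filtration P B).
Local Notation leb := (@lebesgue_measure R).
Hypotheses (T0 : 0 < T) (P_complete : measure_is_complete P) (hB : is_brownian_motion P T B).
Context (p : R) (p1 : 1 < p).
Context (V : R -> Omega -> R) (hV : in_Vp P T F p V).
Context (g : Omega -> R -> R -> 'rV[R]_d -> R) (hg : is_generator T F g).
Context (rho : R -> R) (r1 mu lam : R) (f : R -> Omega -> R).
Hypotheses (r1_ge0 : 0 <= r1) (rho_ge0 : forall u, 0 <= u -> 0 <= rho u).
Hypothesis rho_le : forall u, 0 <= u -> rho u <= r1 * (1 + u).
Hypothesis g_osgood : {ae (P \x leb)%E, forall wt, 0 <= wt.2 <= T -> forall y1 y2 z,
  (g wt.1 wt.2 y1 z - g wt.1 wt.2 y2 z) * Num.sg (y1 - y2) <= rho `|y1 - y2|}.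
Hypotheses (mu_ge0 : 0 <= mu) (lam_ge0 : 0 <= lam) (hf : in_Hp P T F p f).
Hypothesis f_ge0 : forall t w, 0 <= t <= T -> 0 <= f t w.
Hypothesis g_linear : {ae (P \x leb)%E, forall wt, 0 <= wt.2 <= T -> forall y z,
  `|g wt.1 wt.2 y z - g wt.1 wt.2 y 0| <= f wt.2 wt.1 + mu * `|y| + lam * enorm z}.
Hypothesis g00 : in_Hp P T F p (fun t w => g w t 0 0).
Context (xi : Omega -> R) (Y : R -> Omega -> R) (Z : R -> Omega -> 'rV[R]_d).
Context (K : R -> Omega -> R) (I : R -> Omega -> R).
Hypotheses (hY : in_Sp P T F p Y) (hZ : in_Mp P T F p Z) (hK : in_Vplusp P T F p K).
Hypothesis hI : is_ito_integral P T F B Z I.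
Hypothesis G_int : {ae P, forall w,
  leb.-integrable `[0, T] (fun t => `|g w t (Y t w) (Z t w)|%:E) /\
  leb.-integrable `[0, T] (fun t => (enorm (Z t w) ^+ 2)%:E)}.
Hypothesis Y_eq : {ae P, forall w, forall t, 0 <= t <= T ->
  Y t w = xi w + \int[leb]_(s in `[t, T]) g w s (Y s w) (Z s w)
    + (V T w - V t w) + (K T w - K t w) - (I T w - I t w)}.

Let p0 : 0 < p. Proof. exact: lt_trans p1. Qed.
Let pY : progressive T F Y. Proof. by case: hY => -[]. Qed.
Let pZ : progressive_vec T F Z. Proof. by case: hZ. Qed.
Let FT_meas : F T `<=` measurable.
Proof. exact: (filtration_measurable hB P_complete (lexx T)). Qed.
Let F_sigma t : sigma_algebra setT (F t). Proof. exact: filtration_sigma. Qed.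
Let TT : 0 <= T <= T. Proof. by rewrite lexx ltW. Qed.

Let h t w := g w t (Y t w) 0.
Let G t w := g w t (Y t w) (Z t w).

Let ph : progressive T F h.
Proof.
have [_ H] := hg; apply: (H Y (fun _ _ => 0)) => // i t tT.
by rewrite (_ : (fun u => _) = fun=> 0); [exact: measurable_cst|apply/funext => u; rewrite mxE].
Qed.

Let pG : progressive T F G. Proof. by have [_ H] := hg; exact: H. Qed.

(** The bound of [generator_abs_bound] with rho replaced by r1 (1 + |y|), which accounts for 2 r1
    and 2 r1 + mu; every summand then lies in the space H^p. *)
Definition generator_majorant t w :=
  2 * r1 + (2 * r1 + mu) * `|Y t w| + 2 * `|g w t 0 0| + f t w + lam * enorm (Z t w).
Local Notation N := generator_majorant.

Lemma majorant_ge0 t w : 0 <= t <= T -> 0 <= N t w.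
Proof.
move=> tT; rewrite /N; apply: addr_ge0; last by rewrite mulr_ge0 ?enorm_ge0.
apply: addr_ge0; last exact: f_ge0.
apply: addr_ge0; last by rewrite mulr_ge0.
by apply: addr_ge0; rewrite mulr_ge0// addr_ge0// mulr_ge0.
Qed.

Lemma majorant_Hp : in_Hp P T F p N.
Proof.
have norm_Hp X : in_Hp P T F p X -> in_Hp P T F p (fun t w => `|X t w|).
  move=> HX; apply: (in_Hp_le T0 F_sigma FT_meas p0 _ HX).
    by apply: progressive_norm; case: HX.
  by move=> t w; rewrite normr_id.
have addHp X X' : in_Hp P T F p X -> in_Hp P T F p X' ->
    in_Hp P T F p (fun t w => X t w + X' t w) by exact: in_HpD.
have scaleHp (c : R) X : in_Hp P T F p X -> in_Hp P T F p (fun t w => c * X t w).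
  exact: in_HpZ.
have c_Hp : in_Hp P T F p (fun _ _ => 2 * r1) by exact: in_Hp_cst.
have Y_Hp : in_Hp P T F p Y by exact: in_Sp_in_Hp.
have Z_Hp : in_Hp P T F p (fun t w => enorm (Z t w)) by exact: in_Mp_in_Hp.
exact: (addHp _ _ (addHp _ _ (addHp _ _ (addHp _ _ c_Hp (scaleHp _ _ (norm_Hp _ Y_Hp)))
  (scaleHp 2 _ (norm_Hp _ g00))) hf) (scaleHp lam _ Z_Hp)).
Qed.

(** The first bound feeds the Tanaka estimate and the second controls the zeros of Y in it. The
    third converts the estimate for g(Y, 0) back into one for g(Y, Z), for the variation of the
    drift. *)
Lemma generator_bounds : {ae P, forall w, {ae leb, forall t, 0 <= t <= T ->
  [/\ `|h t w| <= N t w - Num.sg (Y t w) * G t w, (Y t w = 0 -> `|G t w| <= N t w) &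
      `|G t w| <= `|h t w| + N t w]}}.
Proof.
have H1 := ae_section g_osgood; have H2 := ae_section g_linear.
apply: filterS2 H1 H2 => w H1 H2.
have FF := ae_filter_ringOfSetsType leb.
apply: (@filterS2 _ _ FF _ _ _ _ H1 H2) => t {}H1 {}H2 tT.
have /= {}H1 := H1 tT; have /= {}H2 := H2 tT (Y t w) (Z t w).
have := H1 (Y t w) 0 0; rewrite subr0 -/(h t w) => {}H1.
rewrite -/(h t w) -/(G t w) in H2.
have y0 : 0 <= `|Y t w| by [].
have b0 : 0 <= r1 * `|Y t w| by rewrite mulr_ge0.
have b1 : 0 <= mu * `|Y t w| by rewrite mulr_ge0.
have b2 : 0 <= lam * enorm (Z t w) by rewrite mulr_ge0 ?enorm_ge0.
have b3 := f_ge0 w tT; have b4 : 0 <= `|g w t 0 0| by [].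
have NE : N t w = 2 * (r1 * (1 + `|Y t w|)) + 2 * `|g w t 0 0| +
  (f t w + mu * `|Y t w| + lam * enorm (Z t w)) by rewrite /N; ring.
have rr := rho_le y0.
have r0 : 0 <= rho `|Y t w| by exact: rho_ge0.
have hy : Y t w = 0 -> h t w = g w t 0 0 by rewrite /h => ->.
split.
- apply: (le_trans (generator_abs_bound r0 H1 H2 hy)); rewrite NE lerD2r.
  by rewrite !lerD2r ler_pM2l.
- move=> yE; have : `|G t w| <= `|G t w - h t w| + `|h t w|.
    by rewrite -{1}(subrK (h t w) (G t w)) ler_normD.
  rewrite {2}(hy yE) => /le_trans; apply; rewrite NE addrC.
  apply: lerD => //; apply: ler_wpDl; last by rewrite ler_peMl// ler1n.
  by rewrite mulr_ge0// mulr_ge0// addr_ge0.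
- apply: (@le_trans _ _ (`|h t w| + `|G t w - h t w|)).
    by rewrite -{1}(subrKC (h t w) (G t w)) ler_normD.
  rewrite lerD2l; apply: (le_trans H2); rewrite NE ler_wpDl//.
  by rewrite addr_ge0// mulr_ge0// mulr_ge0// addr_ge0.
Qed.

Lemma solution_paths : {ae P, forall w,
  [/\ {within `[0, T], continuous (Y ^~ w)},
      leb.-integrable `[0, T] (EFin \o (G ^~ w)),
      leb.-integrable `[0, T] (EFin \o (N ^~ w)),
      (forall s t, 0 <= s -> s <= t -> t <= T -> K s w <= K t w) &
      exists c, forall t, 0 <= t <= T ->
        Y t w = c - (\int[leb]_(s in `[0%R, t]) G s w)%R - V t w - K t w + I t w]}.
Proof.
have cY : as_continuous P T Y by case: hY => -[].
have mK : as_nondecreasing P T K by case: hK.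
have iN := in_Hp_integrable T0 F_sigma FT_meas p0 majorant_Hp.
apply: (filterS2 _ _ (filterI cY mK) (filterI iN (filterI G_int Y_eq))).
move=> w [{}cY {}mK] [{}iN [[iG _] Yw]].
have iG' : leb.-integrable `[0, T] (EFin \o (G ^~ w)).
  apply/integrableP; split.
    by apply/measurable_EFinP; exact: (progressive_path w pG (ltW T0)).
  by have /integrableP[_] := iG; under eq_integral do rewrite /= normr_id.
split => //.
  move=> s t s0 st tT; apply: mK; rewrite ?in_itv/= ?s0 ?tT ?(le_trans st tT)//.
  by rewrite andbT (le_trans s0).
(* The backward equation is read forward: all terminal values are collected in c. *)
exists (xi w + (\int[leb]_(s in `[0%R, T]) G s w)%R + V T w + K T w - I T w).
move=> t tT; have /andP[t0 tT'] := tT; rewrite Yw//.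
have -> : (\int[leb]_(s in `[t, T]) g w s (Y s w) (Z s w))%R =
    (\int[leb]_(s in `[0%R, T]) G s w)%R - (\int[leb]_(s in `[0%R, t]) G s w)%R.
  rewrite -(Rintegral_itv_increment iG' t0 tT' (lexx T)) Rintegral_itv_obnd_cbnd//.
  apply: integrableS iG' => //; apply: subset_itvr; by rewrite bnd_simp.
ring.
Qed.

Let Q m w := \sum_(k < m.+1) Num.sg (Y (unif T m k) w) *
  (I (unif T m k.+1) w - I (unif T m k) w).

Let qvar_fin : {ae P, forall w, (qvar_ext Z T w < +oo)%E}.
Proof.
apply: filterS G_int => w [_ /integrableP[_]].
by under eq_integral do rewrite /= ger0_norm ?sqr_ge0//.
Qed.

Lemma qvar_power_fin_pos : fin_pos P (fun w => qvar_ext Z T w `^ (p / 2))%E.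
Proof.
split.
- apply: (measurableT_comp (measurable_poweR _)).
  apply: (nonneg_integral_measurable T0 F_sigma FT_meas (progressive_enorm pZ)).
  by move=> t w; exact: sqr_ge0.
- by move=> w; exact: poweR_ge0.
- by case: hZ.
Qed.

Lemma qvar_moment_integrable :
  P.-integrable setT (EFin \o (fun w => (1 + qvar T Z T w) `^ (p / 2))).
Proof.
have p20 : 0 < p / 2 by rewrite divr_gt0.
have pA := qvar_progressive pZ (@filtration_negligible _ _ _ P _ B) qvar_fin.
have mA : measurable_fun setT (qvar T Z T).
  apply: (measurable_wrt_measurable FT_meas).
  exact: (progressive_section pA (ltW T0) (lexx T) (lexx T)).
apply/integrableP; split.
  apply/measurable_EFinP; apply: (measurableT_comp (measurable_powR _)).
  exact: measurable_funD.
under eq_integral do rewrite /= ger0_norm ?powR_ge0//.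
have fp := fin_posD (fin_pos_cst P ler01) qvar_power_fin_pos.
apply: (@lower_integral_finite _ _ _ P (2 `^ (p / 2)) _ _ (cst 0%E) _ _ fp) => //.
- by move=> w; rewrite lee_fin powR_ge0.
- by rewrite integral0.
apply: filterS qvar_fin => w fin; rewrite adde0 -(qvarE T0 pZ fin (lexx T)) poweR_EFin.
rewrite -[leRHS]/((2 `^ (p / 2) * (1 + qvar T Z T w `^ (p / 2)))%:E) lee_fin.
by have := powR_add_le (ltW p20) ler01 (qvar_ge0 T Z T w); rewrite powR1.
Qed.

Lemma in_calMp_ito : in_calMp P T F p I.
Proof.
have SI : in_S P T F I by case: hI.
split => //.
  exact: (ito_martingale hB P_complete T0 pZ hI qvar_fin p1 qvar_moment_integrable).
exists (qvar T Z); first exact: (ito_bracket hB P_complete T0 pZ hI qvar_fin).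
apply: (@lower_integral_finite _ _ _ P 1 _ _ (cst 0%E) ltr01 _ qvar_power_fin_pos) => //.
- by move=> w; exact: poweR_ge0.
- by rewrite integral0.
by apply: filterS qvar_fin => w fin; rewrite adde0 mul1e (qvarE T0 pZ fin (lexx T)).
Qed.

Let Q_meas m : measurable_fun setT (Q m).
Proof.
have [pI _] : in_S P T F I by case: hI.
have mS X k : progressive T F X -> (k <= m.+1)%N -> measurable_fun setT (X (unif T m k)).
  move=> pX km; have /andP[u0 uT] := unif_bounds (ltW T0) km.
  apply: (measurable_wrt_measurable FT_meas).
  exact: (progressive_section pX u0 uT (lexx T)).
apply: measurable_sum => -[k km] /=; apply: measurable_funM.
  by apply: (measurableT_comp measurable_sg); apply: mS => //; exact: ltnW.
by apply: measurable_funB; apply: mS => //; exact: ltnW.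
Qed.

(** A lower limit, because along each path the Tanaka bound starts at its own rank. The moment bound
    uniform in m and Fatou's lemma make it integrable. *)
Lemma sign_sum_fin_pos :
  fin_pos P (fun w => limn_einf (fun m => (`|Q m w| `^ p)%:E)).
Proof.
have [C HC] := ito_sum_moment hB P_complete T0 pZ hI qvar_fin p0 qvar_moment_integrable.
apply: (@limn_einf_fin_pos _ _ _ P (fun m w => (`|Q m w| `^ p)%:E) C).
- by move=> m; apply: powR_integrable_measurable.
- by move=> m w; rewrite lee_fin powR_ge0.
move=> m; apply: (HC (unif T m) m.+1 (fun k w => Num.sg (Y (unif T m k) w))).
- by move=> i im; exact: (unif_bounds (ltW T0)).
- by move=> i _; rewrite unif_step ltrDl divr_gt0.
- move=> i im; have /andP[u0 uT] := unif_bounds (ltW T0) (ltnW im).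
  apply: (measurableT_comp measurable_sg).
  exact: (progressive_section pY u0 (lexx _) uT).
- by move=> i w _; rewrite normr_sg; case: (_ == _).
Qed.

Lemma power_measurable (X : Omega -> R) : measurable_wrt (F T) X ->
  measurable_fun setT (fun w => (`|X w| `^ p)%:E).
Proof.
move=> mX; apply: powR_integrable_measurable => //.
exact: (measurable_wrt_measurable FT_meas mX).
Qed.

Lemma Y_terminal_fin_pos : fin_pos P (fun w => (`|Y T w| `^ p)%:E).
Proof.
split.
- by apply: power_measurable; exact: (progressive_section pY (ltW T0) (lexx _) (lexx _)).
- by move=> w; rewrite lee_fin powR_ge0.
have [_ fY] := hY; apply: le_lt_trans fY; apply: le_nonmeasurable_integral => w.
  by rewrite lee_fin powR_ge0.
by apply: ereal_sup_ubound; exists T => //=; rewrite in_itv.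
Qed.

(** The increment of K involves two times only, so it is measurable; for a nondecreasing path it is
    the total variation. *)
Lemma K_variation_fin_pos : fin_pos P (fun w => (`|K T w - K 0 w| `^ p)%:E).
Proof.
have [[pK _ _ fK] _] := hK; split.
- apply: power_measurable; apply: measurable_funB.
    exact: (progressive_section pK (ltW T0) (lexx _) (lexx _)).
  exact: (progressive_section pK (lexx _) (ltW T0) (lexx _)).
- by move=> w; rewrite lee_fin powR_ge0.
apply: le_lt_trans fK; apply: le_nonmeasurable_integral => w.
  by rewrite lee_fin powR_ge0.
rewrite -poweR_EFin; apply: le_poweR; [exact: ltW|by rewrite lee_fin|].
exact: (total_variation_ge _ (ltW T0)).
Qed.

Let Hp_fin_pos X : in_Hp P T F p X ->
  fin_pos P (fun w => (\int[leb]_(t in `[0%R, T]) `|X t w|%:E) `^ p)%E.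
Proof.
move=> [pX fX]; split => //; first exact: (abs_integral_power_measurable T0 F_sigma FT_meas p pX).
by move=> w; exact: poweR_ge0.
Qed.

Let tvV w := total_variation 0 T (V ^~ w).
Let tvV_ge0 w : (0 <= tvV w)%E. Proof. exact: total_variation_ge0 (ltW T0). Qed.

(** The grid variation of V is replaced by its total variation, so that [Q m] alone depends on m and
    [tvV] alone is of unknown measurability. The 1 is the tolerance in the limit of the grid
    signs. *)
Lemma solution_tanaka : {ae P, forall w, leb.-integrable `[0, T] (EFin \o (h ^~ w)) /\
  \forall m \near \oo, (\int[leb]_(t in `[0%R, T]) `|h t w|%:E <=
    \int[leb]_(t in `[0%R, T]) `|2 * N t w|%:E + (1 + (`|Y T w|%:E + (`|K T w - K 0 w|%:E +
      (`|Q m w|%:E + tvV w)))))%E}.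
Proof.
apply: filterS2 solution_paths generator_bounds => w [cY iG iN mK [c Yc]] gb.
have FF := ae_filter_ringOfSetsType leb.
have mh : measurable_fun `[0, T] (h ^~ w) by exact: (progressive_path w ph (ltW T0)).
have mabs : measurable_fun `[0, T] (fun t => `|h t w|) by exact: measurableT_comp.
have [||||ih H] := @tanaka_bound R T (Y ^~ w) (G ^~ w) (N ^~ w) (fun t => `|h t w|)
  T0 cY iG mabs iN _ _ _ _ c (V ^~ w) (K ^~ w) (I ^~ w) Yc mK.
- by [].
- by move=> s sT; exact: majorant_ge0.
- by apply: (@filterS _ _ FF _ _ _ gb) => t gt tT; case: (gt tT).
- by apply: (@filterS _ _ FF _ _ _ gb) => t gt tT; case: (gt tT).
have ih' : leb.-integrable `[0, T] (EFin \o (h ^~ w)).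
  apply/integrableP; split; first exact/measurable_EFinP.
  by have /integrableP[_] := ih; under eq_integral do rewrite /= normr_id.
split => //; apply: filterS H => m H.
have E1 : (\int[leb]_(t in `[0%R, T]) `|h t w|%:E)%E =
    ((\int[leb]_(t in `[0%R, T]) `|h t w|)%R)%:E.
  by rewrite /Rintegral fineK//; apply: integrable_fin_num.
have E2 : (\int[leb]_(t in `[0%R, T]) `|2 * N t w|%:E)%E =
    (2 * (\int[leb]_(t in `[0%R, T]) N t w)%R)%:E.
  rewrite EFinM /Rintegral fineK; last by apply: integrable_fin_num.
  rewrite -integralZl//; apply: eq_integral => t; rewrite inE/= in_itv/= => tT.
  by rewrite -EFinM ger0_norm// mulr_ge0// majorant_ge0.
have E3 : ((\sum_(k < m.+1) `|V (unif T m k.+1) w - V (unif T m k) w|)%:E <= tvV w)%E.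
  have := @sum_total_variation R (unif T m) (V ^~ w) m.+1 (fun k => unif_mono m k (ltW T0)).
  by rewrite unif0 unif_last.
rewrite E1 E2.
apply: (@le_trans _ _ ((2 * (\int[leb]_(t in `[0%R, T]) N t w)%R)%:E + (1 + (`|Y T w|%:E +
  (`|K T w - K 0 w|%:E + (`|Q m w|%:E +
  (\sum_(k < m.+1) `|V (unif T m k.+1) w - V (unif T m k) w|)%:E)))))%E); last first.
  by rewrite !leeD2l.
have KE : `|K T w - K 0 w| = K T w - K 0 w.
  by rewrite ger0_norm// subr_ge0 mK// ltW.
rewrite -!EFinD lee_fin KE; apply: (le_trans H).
by rewrite le_eqVlt; apply/orP; left; apply/eqP; rewrite /Q; ring.
Qed.

Lemma generator_in_Hp : in_Hp P T F p h.
Proof.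
split => //.
have [_ _ _ fV] := hV.
have fp := fin_posD (Hp_fin_pos (in_HpZ T0 F_sigma FT_meas 2 majorant_Hp))
  (fin_posD (fin_pos_cst P ler01) (fin_posD Y_terminal_fin_pos
  (fin_posD K_variation_fin_pos sign_sum_fin_pos))).
(* Six summands: the integral of 2 N, the constant 1, Y at T, the increment of K, [Q m] and the
   variation of V. *)
have p6 : 0 < (6 : R) `^ p by rewrite powR_gt0.
apply: (@lower_integral_finite _ _ _ P (6 `^ p) _ _ (fun w => tvV w `^ p)%E p6 _ fp) => //.
- by move=> w; exact: poweR_ge0.
- by move=> w; exact: poweR_ge0.
apply: filterS solution_tanaka => w [_ H].
set a := (\int[leb]_(t in `[0%R, T]) `|2 * N t w|%:E)%E in H *.
have a0 : (0 <= a)%E by apply: integral_ge0 => t _; rewrite lee_fin.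
set x := (\int[leb]_(t in `[0%R, T]) `|h t w|%:E)%E in H *.
have x0 : (0 <= x)%E by apply: integral_ge0 => t _; rewrite lee_fin.
pose A := (a `^ p + (1 + ((`|Y T w| `^ p)%:E + ((`|K T w - K 0 w| `^ p)%:E + tvV w `^ p))))%E.
have A0 : (0 <= A)%E.
  by rewrite /A !adde_ge0 ?poweR_ge0// lee_fin powR_ge0.
have c0 n : (0 <= (`|Q n w| `^ p)%:E)%E by rewrite lee_fin powR_ge0.
have := @le_limn_einfZ R _ (x `^ p)%E A (fun m => (`|Q m w| `^ p)%:E) p6 A0 c0.
move=> /(_ _)/le_trans; apply.
  apply: filterS H => m H.
  have := @poweR_sum_le R p [:: a; 1%E; `|Y T w|%:E; `|K T w - K 0 w|%:E; `|Q m w|%:E; tvV w]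
    x p0 _ x0.
  rewrite !big_cons !big_nil /= !addr0 => /(_ _ _ _)/le_trans; apply => //.
    by rewrite a0 lee01 !lee_fin !normr_ge0 tvV_ge0.
  rewrite powR1 lee_pmul2l// /A -!addeA leeD2l// leeD2l// leeD2l// leeD2l//.
  by rewrite addeC.
rewrite lee_pmul2l// /A -!addeA !leeD2l//.
by rewrite addeC.
Qed.

(** The first conclusion serves the second: Y - I varies by at most the integral of |G| plus the
    variations of V and K, and |G| is controlled through |h| + N, whose part h comes from the Tanaka
    estimate. *)
Lemma drift_variation : {ae P, forall w,
  (total_variation 0 T (fun t => Y t w - I t w)%R <=
    \int[leb]_(t in `[0%R, T]) `|h t w|%:E + (\int[leb]_(t in `[0%R, T]) `|N t w|%:E +
    (`|K T w - K 0 w|%R%:E + tvV w)))%E /\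
  (total_variation 0 T (fun t => Y t w - I t w)%R < +oo)%E}.
Proof.
have [_ _ bV _] := hV.
apply: (filterS2 _ _ (filterI solution_paths generator_bounds) (filterI bV solution_tanaka)).
move=> w [[_ iG iN mK [c Yc]] gb] [{}bV [ih _]].
have tvfin t : 0 <= t <= T -> total_variation 0 t (V ^~ w) \is a fin_num.
  move=> /andP[t0 tT]; have fT := (bounded_variationP _ (ltW T0)).1 bV.
  rewrite ge0_fin_numE ?total_variation_ge0//.
  apply: (@le_lt_trans _ _ (total_variation 0 T (V ^~ w))).
    by rewrite (total_variationD _ t0 tT) leeDl// total_variation_ge0.
  by rewrite -ge0_fin_numE ?total_variation_ge0// ltW.
have iaG : leb.-integrable `[0, T] (EFin \o (fun s => `|G s w|)) by exact: integrable_norm iG.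
pose Ga t := (\int[leb]_(s in `[0%R, t]) `|G s w|)%R.
pose m t := Ga t + fine (total_variation 0 t (V ^~ w)) + K t w.
have Hm s t : 0 <= s -> s <= t -> t <= T -> `|(Y t w - I t w) - (Y s w - I s w)| <= m t - m s.
  move=> s0 st tT.
  have sT' : 0 <= s <= T by rewrite s0 (le_trans st).
  have tT' : 0 <= t <= T by rewrite tT (le_trans s0).
  have H1 : `|(\int[leb]_(r in `]s, t]) G r w)%R| <= Ga t - Ga s.
    rewrite -(Rintegral_itv_increment iaG s0 st tT); apply: le_normr_Rintegral => //.
    apply: integrableS iG => // r /=; rewrite !in_itv/= => /andP[sr rt].
    by rewrite (le_trans s0 (ltW sr)) (le_trans rt).
  have H2 : `|V t w - V s w| <= fine (total_variation 0 t (V ^~ w)) -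
      fine (total_variation 0 s (V ^~ w)).
    rewrite -lee_fin EFinB !fineK ?tvfin// (total_variationD (V ^~ w) s0 st).
    by rewrite [X in (X - _)%E]addeC addeK ?tvfin//; exact: total_variation_ge.
  have H3 : `|K t w - K s w| = K t w - K s w by rewrite ger0_norm// subr_ge0 mK.
  rewrite (Yc _ tT') (Yc _ sT').
  have -> : c - (\int[leb]_(r in `[0%R, t]) G r w)%R - V t w - K t w + I t w - I t w -
      (c - (\int[leb]_(r in `[0%R, s]) G r w)%R - V s w - K s w + I s w - I s w) =
      - ((\int[leb]_(r in `]s, t]) G r w)%R + (V t w - V s w) + (K t w - K s w)).
    by rewrite (Rintegral_itv_increment iG s0 st tT); ring.
  rewrite normrN; apply: (le_trans (ler_normD _ _)).
  rewrite (_ : m t - m s = (Ga t - Ga s) + (fine (total_variation 0 t (V ^~ w)) -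
    fine (total_variation 0 s (V ^~ w))) + (K t w - K s w)); last by rewrite /m; ring.
  by rewrite H3 lerD2r; apply: (le_trans (ler_normD _ _)); exact: lerD.
have tvle := total_variation_majorant Hm.
have mE : (m T - m 0)%:E = ((Ga T)%:E + (`|K T w - K 0 w|%:E + tvV w))%E.
  rewrite -[tvV w]fineK; last by apply: tvfin; exact: TT.
  rewrite -!EFinD; congr EFin.
  rewrite ger0_norm ?subr_ge0 ?mK ?(ltW T0)// /m /Ga set_itv1 Rintegral_set1.
  by rewrite total_variationxx /=; ring.
have GaE : (Ga T)%:E = (\int[leb]_(s in `[0%R, T]) `|G s w|%:E)%E.
  by rewrite /Ga /Rintegral fineK//; apply: integrable_fin_num.
have mh : measurable_fun `[0, T] (fun t => `|h t w|%:E).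
  exact: (path_abs_measurable T0 w ph).
have mN : measurable_fun `[0, T] (fun t => `|N t w|%:E).
  by have [pN _] := majorant_Hp; exact: (path_abs_measurable T0 w pN).
have mG : measurable_fun `[0, T] (fun t => `|G t w|%:E).
  exact: (path_abs_measurable T0 w pG).
have Gle : (\int[leb]_(t in `[0%R, T]) `|G t w|%:E <= \int[leb]_(t in `[0%R, T]) `|h t w|%:E +
    \int[leb]_(t in `[0%R, T]) `|N t w|%:E)%E.
  rewrite -ge0_integralD//=.
  apply: ae_ge0_le_integral => //.
  - by move=> t _; rewrite -EFinD lee_fin addr_ge0.
  - exact: emeasurable_funD.
  have FF := ae_filter_ringOfSetsType leb.
  apply: (@filterS _ _ FF _ _ _ gb) => t gt; rewrite /= in_itv/= => tT.
  rewrite -EFinD lee_fin (ger0_norm (majorant_ge0 w tT)); by case: (gt tT).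
have tvle2 := le_trans tvle (lexx _); rewrite mE GaE in tvle2.
split; first by apply: (le_trans tvle2); rewrite addeA leeD2r.
exact: le_lt_trans tvle (ltry _).
Qed.

Lemma drift_in_Vp : in_Vp P T F p (fun t w => Y t w - I t w).
Proof.
have [pI cI] : in_S P T F I by case: hI.
have cY : as_continuous P T Y by case: hY => -[].
have [_ _ _ fV] := hV.
split.
- by move=> t tT; apply: measurable_funB; [exact: pY|exact: pI].
- by apply: filterS2 cY cI => w {}cY {}cI x; apply: cvgB; [exact: cY|exact: cI].
- apply: filterS drift_variation => w [_ fin]; apply/(bounded_variationP _ (ltW T0)).
  by rewrite ge0_fin_numE// total_variation_ge0// ltW.
have fp := fin_posD (Hp_fin_pos generator_in_Hp) (fin_posD (Hp_fin_pos majorant_Hp)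
  K_variation_fin_pos).
(* Four summands: the integrals of |h| and N, the increment of K and the variation of V. *)
have p4 : 0 < (4 : R) `^ p by rewrite powR_gt0.
apply: (@lower_integral_finite _ _ _ P (4 `^ p) _ _ (fun w => tvV w `^ p)%E p4 _ fp) => //.
- by move=> w; exact: poweR_ge0.
- by move=> w; exact: poweR_ge0.
apply: filterS drift_variation => w [H _].
set a := (\int[leb]_(t in `[0%R, T]) `|h t w|%:E)%E in H *.
have a0 : (0 <= a)%E by apply: integral_ge0 => t _; rewrite lee_fin.
set b := (\int[leb]_(t in `[0%R, T]) `|N t w|%:E)%E in H *.
have b0 : (0 <= b)%E by apply: integral_ge0 => t _; rewrite lee_fin.
have := @poweR_sum_le R p [:: a; b; `|K T w - K 0 w|%:E; tvV w] _ p0 _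
  (total_variation_ge0 (fun t => Y t w - I t w) (ltW T0)).
rewrite !big_cons !big_nil /= !addr0 => /(_ _ _ _)/le_trans; apply => //.
  by rewrite a0 b0 lee_fin normr_ge0 tvV_ge0.
by rewrite lee_pmul2l// -!addeA.
Qed.

End ReflectedSolution.

Theorem theorem3 (R : realType) (dO : measure_display)
    (Omega : measurableType dO) (P : probability Omega R) (T : R) (d : nat)
    (B : R -> Omega -> 'rV[R]_d) (F : R -> set (set Omega))
    (hT : 0 < T) (hd : (1 <= d)%N)
    (P_complete : measure_is_complete P)
    (hB : is_brownian_motion P T B)
    (hF : F = brownian_filtration P B)
    (hFT : (measurable : set (set Omega)) = F T)
    (p : R) (hp : 1 < p)
    (V : R -> Omega -> R) (hV : in_Vp P T F p V)
    (g : Omega -> R -> R -> 'rV[R]_d -> R) (hg : is_generator T F g)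
    (g_osgood : one_sided_osgood P T g)
    (g_linear : linear_growth_z P T F p g)
    (g00 : in_Hp P T F p (fun t w => g w t 0 0))
    (xi : Omega -> R) (hxi : in_Lp P T F p xi)
    (L : R -> Omega -> R) (hL : in_S P T F L)
    (hLT : {ae P, forall w, L T w <= xi w})
    (Y : R -> Omega -> R) (Z : R -> Omega -> 'rV[R]_d) (K : R -> Omega -> R)
    (hsol : rbsde_solution P T F B xi g V L Y Z K)
    (hY : in_Sp P T F p Y) (hZ : in_Mp P T F p Z) (hK : in_Vplusp P T F p K) :
  in_Hp P T F p (fun t w => g w t (Y t w) 0) /\
  exists X : R -> Omega -> R,
    [/\ in_calMp_plus_Vp P T F p X,
        in_Hp P T F p (fun t w => g w t (X t w) 0) &
        {ae P, forall w, forall t, 0 <= t <= T -> L t w <= X t w}].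
Proof.
move: F hF hFT hV hg g_linear g00 hxi hL hsol hY hZ hK => _ -> hFT hV hg.
move=> [mu [lam [f [mu0 lam0 hf f0 g_lin]]]] g00 hxi hL hsol hY hZ hK.
have [rho [rho0 rho_mono rho_conc [rho00 _] [_ g_os]]] := g_osgood.
have [_ G_int [I hI Y_eq] L_le _] := hsol.
have rho_le := concave_linear_growth rho0 rho_mono rho_conc rho00.
have r1 := rho0 1 ler01.
have hH := generator_in_Hp hT P_complete hB hp hV hg r1 rho0 rho_le g_os mu0 lam0 hf f0 g_lin
  g00 hY hZ hK hI G_int Y_eq.
split; first exact: hH.
exists Y; split => //; exists I, (fun t w => Y t w - I t w); split.
- exact: (in_calMp_ito hT P_complete hB hp hZ hI G_int).
- exact: (drift_in_Vp hT P_complete hB hp hV hg r1 rho0 rho_le g_os mu0 lam0 hf f0 g_lin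
    g00 hY hZ hK hI G_int Y_eq).
- by move=> t w _; rewrite subrKC.
Qed.
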